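(* Any finite trivalent graph is the boundary of a fake surface with boundary. That is, for every finite trivalent graph $T$ there is a fake surface with boundary $F$ whose boundary $\partial F$ is (PL homeomorphic to) $T$.
   Context: A trivalent graph is a graph (regarded as a one-dimensional polyhedron) in which every vertex has degree $3$. Let $Y$ denote the open cone on three points, i.e. three half-open segments glued at a common endpoint (the center). A fake surface with boundary is a compact 2-dimensional polyhedron $F$ in which every point has a neighborhood PL homeomorphic to one of the following models, the point corresponding to the indicated point of the model. Interior models: (i) an open disk; (ii) $Y\times(-1,1)$ at the point (center, $0$); (iii) the open cone on the $1$-skeleton of a tetrahedron, at the cone point. Boundary models: (iv) the half-disk $(-1,1)\times[0,1)$ at the point $(0,0)$, with boundary locally $(-1,1)\times\{0\}$; (v) $Y\times[0,1)$ at the point (center, $0$), with boundary locally $Y\times\{0\}$; (vi) an open disk together with a quarter-plane $[0,1)\times[0,1)$ glued along its side $[0,1)\times\{0\}$ to a radius of the disk, at the center of the disk (identified with the corner of the quarter-plane), with boundary locally the other side $\{0\}\times[0,1)$ of the quarter-plane. The boundary $\partial F$ is the set of points of $F$ having a neighborhood of type (iv), (v) or (vi). *)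

(* Defs.v *)
(* Piecewise-linear topology of subsets of R^n, for R : realType
   (MathComp and MathComp-Analysis). *)
From HB Require Import structures.
From mathcomp Require Import all_boot all_order all_algebra.
From mathcomp Require Import all_classical all_reals all_analysis.
Set Implicit Arguments.
Unset Strict Implicit.
Unset Printing Implicit Defensive.
Import Order.TTheory GRing.Theory Num.Theory.
Import numFieldNormedType.Exports.

Local Open Scope classical_set_scope.
Local Open Scope ring_scope.

Section Polyhedra.
Context {R : realType}.

(* Convex hull of the rows of P.  The rows need not be affinely independent, so
   this is an arbitrary convex polytope spanned by at most k points. *)
Definition polytope k n (P : 'M[R]_(k, n)) : set 'rV[R]_n :=
  [set w *m P | w in [set w : 'rV[R]_k |
    (forall i, 0 <= w 0 i) /\ \sum_i w 0 i = 1]].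

Definition affinely_independent k n (P : 'M[R]_(k, n)) : bool :=
  row_free (row_mx P (const_mx 1 : 'cV[R]_k)).

Definition local_cover k n (A : set 'rV[R]_n) (a : 'rV[R]_n)
    (s : seq 'M[R]_(k, n)) : Prop :=
  (forall P, P \in s -> polytope P `<=` A) /\
  within A (nbhs a) [set x | exists2 P, P \in s & polytope P x].

Definition polyhedron n (A : set 'rV[R]_n) : Prop :=
  forall a, A a -> exists k (s : seq 'M[R]_(k, n)), local_cover A a s.

(* A set that is locally a finite union of polytopes with at most d + 1
   vertices, and contains a nondegenerate d-simplex. *)
Definition polyhedron_of_dim d n (A : set 'rV[R]_n) : Prop :=
  (forall a, A a -> exists s : seq 'M[R]_(d.+1, n), local_cover A a s) /\
  (exists2 P : 'M[R]_(d.+1, n), affinely_independent P & polytope P `<=` A).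

(* The domain A is automatically a polyhedron and f automatically continuous
   on A, since the finitely many polytopes involved are closed. *)
Definition piecewise_linear m n (A : set 'rV[R]_m) (f : 'rV[R]_m -> 'rV[R]_n)
    : Prop :=
  forall a, A a -> exists k (s : seq 'M[R]_(k, m)), local_cover A a s /\
    forall P, P \in s -> exists (M : 'M[R]_(m, n)) (b : 'rV[R]_n),
      forall x, polytope P x -> f x = x *m M + b.

Definition PL_homeomorphism m n (A : set 'rV[R]_m) (B : set 'rV[R]_n)
    (f : 'rV[R]_m -> 'rV[R]_n) : Prop :=
  piecewise_linear A f /\ set_fun A B f /\
  exists g, [/\ piecewise_linear B g, set_fun B A g,
    {in A, cancel f g} & {in B, cancel g f}].

Definition PL_homeomorphic m n (A : set 'rV[R]_m) (B : set 'rV[R]_n) : Prop :=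
  exists f, PL_homeomorphism A B f.

(* x has a neighborhood in F that is PL homeomorphic to M, with x corresponding
   to the origin; all the local models below are based at the origin. *)
Definition modelled_on n k (F : set 'rV[R]_n) (M : set 'rV[R]_k)
    (x : 'rV[R]_n) : Prop :=
  exists U : set 'rV[R]_n, [/\ U `<=` F, within F (nbhs x) U &
    exists2 f, PL_homeomorphism U M f & f x = 0].

Definition prod_set m n (A : set 'rV[R]_m) (B : set 'rV[R]_n)
    : set 'rV[R]_(m + n) :=
  [set x | A (lsubmx x) /\ B (rsubmx x)].

(* Open cone with apex the origin; an embedded cone when each ray from the
   origin meets L at most once, e.g. if L lies in an affine hyperplane that
   misses the origin. *)
Definition open_cone n (L : set 'rV[R]_n) : set 'rV[R]_n :=
  [set x | exists t y, [/\ 0 <= t < 1, L y & x = t *: y]].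

Definition origin n : set 'rV[R]_n := [set 0].
Definition open_segment : set 'rV[R]_1 := [set x | -1 < x 0 0 < 1].
Definition half_open_segment : set 'rV[R]_1 := [set x | 0 <= x 0 0 < 1].

Definition Y : set 'rV[R]_3 :=
  open_cone (range (fun i : 'I_3 => delta_mx 0 i)).

(* The tetrahedron is the standard simplex of R^4. *)
Definition tetrahedron_1skeleton : set 'rV[R]_4 :=
  [set x | exists i j (t : R), 0 <= t <= 1 /\
     x = (1 - t) *: delta_mx 0 i + t *: delta_mx 0 j].

(* As usual in the PL category, the disk is the square [-1, 1]^2. *)
Definition open_disk : set 'rV[R]_(1 + 1) := prod_set open_segment open_segment.

Definition Y_times_open : set 'rV[R]_(3 + 1) := prod_set Y open_segment.

Definition cone_tetrahedron : set 'rV[R]_4 := open_cone tetrahedron_1skeleton.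

Definition half_disk : set 'rV[R]_(1 + 1) :=
  prod_set open_segment half_open_segment.

Definition Y_times_half_open : set 'rV[R]_(3 + 1) :=
  prod_set Y half_open_segment.

(* In R^3: the disk in the plane z = 0, and the quarter-plane [0,1) x [0,1) in
   the plane y = 0, which meets the disk in the radius [0,1) x {0} x {0}. *)
Definition disk_with_quarter_plane : set 'rV[R]_(1 + 1 + 1) :=
  prod_set open_disk (@origin 1) `|`
  prod_set (prod_set half_open_segment (@origin 1)) half_open_segment.

Definition interior_point n (F : set 'rV[R]_n) (x : 'rV[R]_n) : Prop :=
  [\/ modelled_on F open_disk x, modelled_on F Y_times_open x |
      modelled_on F cone_tetrahedron x].

Definition boundary_point n (F : set 'rV[R]_n) (x : 'rV[R]_n) : Prop :=
  [\/ modelled_on F half_disk x, modelled_on F Y_times_half_open x |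
      modelled_on F disk_with_quarter_plane x].

Definition fake_surface_with_boundary n (F : set 'rV[R]_n) : Prop :=
  [/\ compact F, polyhedron_of_dim 2 F &
      forall x, F x -> interior_point F x \/ boundary_point F x].

Definition fake_boundary n (F : set 'rV[R]_n) : set 'rV[R]_n :=
  [set x | F x /\ boundary_point F x].

End Polyhedra.

(* Finite graphs, with loops and multiple edges allowed. *)
Record multigraph := Multigraph {
  vertex : finType;
  edge : finType;
  ends : edge -> vertex * vertex }.

(* A loop contributes 2 to the degree. *)
Definition degree (G : multigraph) (v : vertex G) : nat :=
  (#|[pred e : edge G | (ends e).1 == v]| +
   #|[pred e : edge G | (ends e).2 == v]|)%N.

Definition trivalent (G : multigraph) : Prop :=
  forall v : vertex G, degree v = 3%N.

Section Realization.
Context {R : realType}.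

Definition unit_segment : set 'rV[R]_1 := [set x | 0 <= x 0 0 <= 1].

(* T is G regarded as a polyhedron: each edge is a PL path joining the points
   that represent its ends, and T is the disjoint union of the vertices and of
   the injectively parametrized open edges. *)
Definition realization (G : multigraph) n (T : set 'rV[R]_n) : Prop :=
  exists (p : vertex G -> 'rV[R]_n) (c : edge G -> R -> 'rV[R]_n),
    [/\ injective p,
        forall e, [/\ piecewise_linear unit_segment (fun x => c e (x 0 0)),
          c e 0 = p (ends e).1 & c e 1 = p (ends e).2],
        forall e e' (t t' : R), 0 < t < 1 -> 0 < t' < 1 ->
          c e t = c e' t' -> e = e' /\ t = t',
        forall e (t : R) v, 0 < t < 1 -> c e t <> p v &
        T = range p `|` [set x | exists e (t : R), 0 <= t <= 1 /\ x = c e t]].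

Definition finite_trivalent_graph n (T : set 'rV[R]_n) : Prop :=
  exists G : multigraph, trivalent G /\ realization G T.

End Realization.

(* Main.v *)
(* Over each edge take the product of an interval with a lollipop: two arcs from a
   point q to a point p, and a whisker from q to a free end.  At a vertex, the three
   whiskers are identified, and the three circles are glued into a theta graph with
   branch points p and q, each circle being the union of two of its three arcs.  Then p
   and the arcs have disk neighborhoods everywhere, q sweeps out a triple line along each
   edge and has the link K4 at a vertex, and the whisker ends sweep out a copy of the
   graph, which is the boundary.  The surface is embedded in R^N by piecewise affine
   coordinates, of which affine combinations serve as charts.

   A point cannot have both a boundary and an interior neighborhood: the link of a
   boundary model is separated by a point, whereas any two points of the link of an
   interior model lie on a common circle.  Since PL maps are affine near the beginning
   of each ray, the intermediate value theorem suffices to exploit this.  A graph without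
   edges is empty, and bounds the surface of a tetrahedron. *)
Require Import Defs.
From HB Require Import structures.
From mathcomp Require Import all_boot all_order all_algebra.
From mathcomp Require Import all_classical all_reals all_analysis.
From mathcomp Require Import ring lra.
Set Implicit Arguments.
Unset Strict Implicit.
Unset Printing Implicit Defensive.
Import Order.TTheory GRing.Theory Num.Theory.
Import numFieldNormedType.Exports.
Local Open Scope classical_set_scope.
Local Open Scope ring_scope.

(** * Affine maps on convex polytopes *)

Section Polytopes.
Context {R : realType}.

(** The charts are affine on the whole ambient space and localized by affine inequalities, so
    whatever a chart has to see must be an ambient coordinate. Hat functions tell which vertex or
    edge is near; depth functions tell apart the arcs of a circle or of a theta graph and vanish
    where these come together. No quotient is taken: strips meet where no coordinate distinguishes
    them.

    The theta graph gives the right links because three circles of two arcs each supply six arcs,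
    glued in pairs, so an arc over a vertex borders just two strips. The link of q over a vertex has
    as its four vertices the direction of the whisker and those of the three triple lines; a whisker
    strip joins the first to one of the others, and an arc joins two of the others, which makes K4.

    As [polyhedron_of_dim 2] asks for pieces with three vertices, all subdivisions preserve the
    number of vertices.

    The graph [T] is known only through some PL parametrization of its edges. It is therefore
    compared with the boundary by checking that two families of paths make the same
    identifications. *)

Definition simplex k : set 'rV[R]_k :=
  [set w | (forall i, 0 <= w 0 i) /\ \sum_i w 0 i = 1].

Definition affine_fun n (A : set 'rV[R]_n) (phi : 'rV[R]_n -> R) : Prop :=
  exists (c : 'cV[R]_n) (b : R), forall x, A x -> phi x = (x *m c) 0 0 + b.

Definition affine_map m n (A : set 'rV[R]_m) (f : 'rV[R]_m -> 'rV[R]_n) : Prop :=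
  exists (M : 'M[R]_(m, n)) (b : 'rV[R]_n), forall x, A x -> f x = x *m M + b.

Definition map_rows k m n (f : 'rV[R]_m -> 'rV[R]_n) (P : 'M[R]_(k, m)) :
  'M[R]_(k, n) := \matrix_(i, j) f (row i P) 0 j.

Lemma affine_mapP m n (A : set 'rV[R]_m) (f : 'rV[R]_m -> 'rV[R]_n) :
  affine_map A f <-> forall j, affine_fun A (fun x => f x 0 j).
Proof.
split=> [[M [b fE]] j|].
  exists (col j M), (b 0 j) => x Ax; rewrite fE// !mxE; congr (_ + _).
  by apply: eq_bigr => i _; rewrite !mxE.
move=> /choice[c /choice[b fE]].
exists (\matrix_(i, j) c j i 0), (\row_j b j) => x Ax.
apply/rowP => j; rewrite (fE j)// !mxE; congr (_ + _).
by apply: eq_bigr => i _; rewrite !mxE.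
Qed.

Lemma affine_funS n (A B : set 'rV[R]_n) phi :
  A `<=` B -> affine_fun B phi -> affine_fun A phi.
Proof. by move=> AB [c [b phiE]]; exists c, b => x /AB/phiE. Qed.

Lemma affine_mapS m n (A B : set 'rV[R]_m) (f : 'rV[R]_m -> 'rV[R]_n) :
  A `<=` B -> affine_map B f -> affine_map A f.
Proof. by move=> AB [c [b phiE]]; exists c, b => x /AB/phiE. Qed.

Lemma eq_affine_fun n (A : set 'rV[R]_n) phi psi :
  (forall x, A x -> psi x = phi x) -> affine_fun A phi -> affine_fun A psi.
Proof. by move=> e [c [b phiE]]; exists c, b => x Ax; rewrite e// phiE. Qed.

Lemma affine_fun_cst n (A : set 'rV[R]_n) (a : R) : affine_fun A (fun=> a).
Proof. by exists 0, a => x _; rewrite mulmx0 mxE add0r. Qed.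

Lemma affine_fun_coord n (A : set 'rV[R]_n) i : affine_fun A (fun x => x 0 i).
Proof. by exists (delta_mx i 0), 0 => x _; rewrite -colE mxE addr0. Qed.

Lemma affine_funD n (A : set 'rV[R]_n) phi psi :
  affine_fun A phi -> affine_fun A psi -> affine_fun A (fun x => phi x + psi x).
Proof.
move=> [c [b phiE]] [c' [b' psiE]]; exists (c + c'), (b + b') => x Ax.
by rewrite phiE// psiE// mulmxDr [in RHS]mxE addrACA.
Qed.

Lemma affine_funZ n (A : set 'rV[R]_n) (a : R) phi :
  affine_fun A phi -> affine_fun A (fun x => a * phi x).
Proof.
move=> [c [b phiE]]; exists (a *: c), (a * b) => x Ax.
by rewrite phiE// -scalemxAr [in RHS]mxE mulrDr.
Qed.

Lemma affine_funN n (A : set 'rV[R]_n) phi :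
  affine_fun A phi -> affine_fun A (fun x => - phi x).
Proof.
move=> /(affine_funZ (-1)); apply: eq_affine_fun => x _.
by rewrite mulN1r.
Qed.

Lemma affine_funB n (A : set 'rV[R]_n) phi psi :
  affine_fun A phi -> affine_fun A psi -> affine_fun A (fun x => phi x - psi x).
Proof. by move=> h /affine_funN; exact: affine_funD. Qed.

Lemma affine_fun_sum n (A : set 'rV[R]_n) (I : Type) (r : seq I) (P : pred I) phi :
  (forall i, affine_fun A (phi i)) ->
  affine_fun A (fun x => \sum_(i <- r | P i) phi i x).
Proof.
move=> h; elim: r => [|i r IH].
  by apply: eq_affine_fun (affine_fun_cst A 0) => x _; rewrite big_nil.
case Pi: (P i); last first.
  by apply: eq_affine_fun IH => x _; rewrite big_cons Pi.
by apply: eq_affine_fun (affine_funD (h i) IH) => x _; rewrite big_cons Pi.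
Qed.

Lemma polytope_row k n (P : 'M[R]_(k, n)) i : polytope P (row i P).
Proof.
exists (delta_mx 0 i); last by rewrite -rowE.
split=> [j|]; first by rewrite mxE ler0n.
rewrite (bigD1 i)//= mxE !eqxx big1 ?addr0// => j ji.
by rewrite mxE (negPf ji) andbF.
Qed.

Lemma affine_fun_polytope k n (P : 'M[R]_(k, n)) phi (w : 'rV[R]_k) :
  affine_fun (polytope P) phi -> simplex w ->
  phi (w *m P) = \sum_i w 0 i * phi (row i P).
Proof.
move=> [c [b phiE]] sw; rewrite phiE; last by exists w.
have phir i : phi (row i P) = (row i P *m c) 0 0 + b.
  exact/phiE/polytope_row.
under eq_bigr do rewrite phir mulrDr.
rewrite big_split/= -mulr_suml sw.2 mul1r; congr (_ + _).
rewrite -mulmxA mxE; apply: eq_bigr => i _; congr (_ * _).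
by rewrite -row_mul [RHS]mxE.
Qed.

Lemma affine_map_polytope k m n (P : 'M[R]_(k, m)) (f : 'rV[R]_m -> 'rV[R]_n) w :
  affine_map (polytope P) f -> simplex w -> f (w *m P) = w *m map_rows f P.
Proof.
move=> /affine_mapP fP sw; apply/rowP => j.
rewrite (affine_fun_polytope (fP j) sw) mxE.
by apply: eq_bigr => i _; rewrite [in RHS]mxE.
Qed.

Lemma polytope_map_rows k m n (P : 'M[R]_(k, m)) (f : 'rV[R]_m -> 'rV[R]_n) :
  affine_map (polytope P) f -> polytope (map_rows f P) = f @` polytope P.
Proof.
move=> fP; apply/seteqP; split=> [_ [w sw <-]|_ [_ [w sw <-] <-]].
  by exists (w *m P); [exists w|exact: affine_map_polytope].
by exists w => //; rewrite -affine_map_polytope.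
Qed.

(* A dependency c among the points, small enough to be added to the barycentre,
   gives two convex combinations that represent the same point. *)
Lemma affine_map_of_rows k m n (P : 'M[R]_(k, m)) (Q : 'M[R]_(k, n))
    (f : 'rV[R]_m -> 'rV[R]_n) :
  (forall w, simplex w -> f (w *m P) = w *m Q) -> affine_map (polytope P) f.
Proof.
move=> fP; case: k P Q fP => [|k] P Q fP.
  (* No weights on an empty family sum to 1, so the polytope is empty. *)
  by exists 0, 0 => x [w [_]]; rewrite big_ord0 => /esym/eqP; rewrite oner_eq0.
pose P1 := row_mx P (const_mx 1 : 'cV[R]_k.+1).
have ker c : c *m P1 = 0 :> 'rV__ -> c *m Q = 0.
  move=> cP1.
  have [cP c1] : c *m P = 0 /\ \sum_i c 0 i = 0.
    move: cP1; rewrite mul_mx_row -[RHS]row_mx0 => /eq_row_mx[-> /matrixP/(_ 0 0)].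
    by rewrite !mxE; under eq_bigr do rewrite mxE mulr1.
  pose N := \sum_i `|c 0 i| + 1.
  have N0 : 0 < N by rewrite ltr_wpDl// sumr_ge0.
  have k0 : 0 < k.+1%:R^-1 :> R by rewrite invr_gt0 ltr0n.
  pose w0 : 'rV[R]_k.+1 := const_mx k.+1%:R^-1.
  have sw0 : simplex w0.
    split=> [i|]; first by rewrite mxE ltW.
    under eq_bigr do rewrite mxE.
    by rewrite sumr_const card_ord -[LHS]mulr_natr mulVf// pnatr_eq0.
  pose a := k.+1%:R^-1 / N.
  have a0 : 0 < a by rewrite divr_gt0.
  have sw1 : simplex (w0 + a *: c).
    split=> [i|]; last first.
      under eq_bigr do rewrite mxE [X in _ + X]mxE.
      by rewrite big_split/= sw0.2 -mulr_sumr c1 mulr0 addr0.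
    rewrite !mxE; have : `|a * c 0 i| <= k.+1%:R^-1.
      rewrite normrM gtr0_norm// /a mulrAC ler_pdivrMr// ler_pM2l//.
      by rewrite /N (bigD1 i)//= -addrA lerDl addr_ge0// sumr_ge0.
    by rewrite ler_norml => /andP[h _]; rewrite -(subrr k.+1%:R^-1) lerD2l.
  have := fP _ sw1; rewrite mulmxDl -scalemxAl cP scaler0 addr0 fP//.
  rewrite mulmxDl -scalemxAl => /eqP; rewrite -subr_eq0 opprD addNKr oppr_eq0.
  by rewrite scaler_eq0 gt_eqF//= => /eqP.
(* The rows of [P1 *m pinvmx P1 - 1] are killed by [P1], hence by [Q] according to [ker]. So the
   pseudo-inverse yields an exact solution of [P1 *m B = Q], whose upper block is the linear part
   and whose last row is the translation. *)
have PQ : P1 *m (pinvmx P1 *m Q) = Q.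
  apply/row_matrixP => i; apply/eqP; rewrite -subr_eq0 -linearB/=.
  rewrite mulmxA -{2}[Q]mul1mx -mulmxBl row_mul ker//.
  by rewrite -row_mul mulmxBl mulmxKpV ?mul1mx ?subrr ?row0.
pose B := pinvmx P1 *m Q.
exists (usubmx B), (dsubmx B) => _ [w sw <-]; rewrite fP// -{1}PQ -/B.
rewrite mulmxA mul_mx_row -{1}(vsubmxK B) mul_row_col; congr (_ + _).
suff -> : w *m const_mx 1 = 1%:M :> 'M[R]_1 by rewrite mul1mx.
apply/matrixP => i j; rewrite !ord1 !mxE -[RHS]sw.2.
by apply: eq_bigr => l _; rewrite mxE mulr1.
Qed.

Lemma polytope_convex k n (P : 'M[R]_(k, n)) x y (t : R) :
  polytope P x -> polytope P y -> 0 <= t <= 1 ->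
  polytope P ((1 - t) *: x + t *: y).
Proof.
move=> [w [w0 w1] <-] [w' [w'0 w'1] <-] /andP[t0 t1].
exists ((1 - t) *: w + t *: w'); last by rewrite mulmxDl !scalemxAl.
split=> [i|].
  by rewrite !mxE addr_ge0// mulr_ge0// subr_ge0.
under eq_bigr do rewrite !mxE.
by rewrite big_split/= -!mulr_sumr w1 w'1 !mulr1 subrK.
Qed.

End Polytopes.

(** * Sup-norm estimates, continuity and compactness *)

Section Topology.
Context {R : realType}.

Lemma rV_norm_le n (x : 'rV[R]_n) (e : R) :
  0 <= e -> (forall j, `|x 0 j| <= e) -> `|x| <= e.
Proof.
move=> e0 xe; rewrite [leLHS]/Num.norm/= mx_normrE.
by apply/bigmax_leP; split=> // -[i j] _ /=; rewrite ord1.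
Qed.

Lemma rV_coord_le n (x : 'rV[R]_n) j : `|x 0 j| <= `|x|.
Proof.
rewrite [leRHS]/Num.norm/= mx_normrE.
by apply/bigmax_geP; right; exists (0, j).
Qed.

Lemma rV_norm_lt n (x : 'rV[R]_n) (e : R) :
  0 < e -> (forall j, `|x 0 j| < e) -> `|x| < e.
Proof.
move=> e0 xe; rewrite [ltLHS]/Num.norm/= mx_normrE.
by apply/bigmax_ltP; split=> // -[i j] _ /=; rewrite ord1.
Qed.

Lemma within_nbhsP n (A : set ('rV[R]_n)) (a : 'rV[R]_n) (S : set ('rV[R]_n)) :
  within A (nbhs a) S <->
  exists2 e : R, 0 < e & forall y, A y -> `|y - a| < e -> S y.
Proof.
split=> [/nbhs_ballP[e /= e0 h]|[e e0 h]].
  exists e => // y Ay ya; apply: h => //.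
  by rewrite -ball_normE/= -opprB normrN.
apply/nbhs_ballP; exists e => //= y; rewrite -ball_normE/= -opprB normrN => ya Ay.
exact: h.
Qed.

Lemma affine_map_lip m n (f : 'rV[R]_m -> 'rV[R]_n) : affine_map setT f ->
  exists2 C, 0 < C & forall x y, `|f x - f y| <= C * `|x - y|.
Proof.
move=> [M [b fE]]; exists (1 + \sum_i \sum_j `|M i j|).
  by rewrite ltr_pwDl// sumr_ge0// => i _; rewrite sumr_ge0.
move=> x y; rewrite !fE// opprD addrACA subrr addr0 -mulmxBl.
set z := x - y; apply: rV_norm_le => [|j].
  by rewrite mulr_ge0// addr_ge0// sumr_ge0// => i _; rewrite sumr_ge0.
rewrite mxE (le_trans (ler_norm_sum _ _ _))//.
rewrite mulrDl mul1r mulr_suml ler_wpDl// ler_sum// => i _.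
rewrite normrM mulrC ler_pM// ?rV_coord_le//.
by rewrite (bigD1 j)//= lerDl sumr_ge0.
Qed.

Lemma affine_map_continuous m n (f : 'rV[R]_m -> 'rV[R]_n) :
  affine_map setT f -> continuous f.
Proof.
move=> /affine_map_lip[C C0 fC] x A /nbhs_ballP[e /= e0 eA].
apply/nbhs_ballP; exists (e / C) => /=; first exact: divr_gt0.
move=> y; rewrite -ball_normE/= => xy; apply: eA; rewrite -ball_normE/=.
by rewrite (le_lt_trans (fC _ _))// mulrC -ltr_pdivlMr.
Qed.

Lemma affine_fun_continuous n (phi : 'rV[R]_n -> R) :
  affine_fun setT phi -> continuous phi.
Proof.
move=> phiA.
have /affine_map_lip[C C0 phiC] :
    affine_map setT (fun x => const_mx (phi x) : 'rV[R]_1).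
  by apply/affine_mapP => j; apply: eq_affine_fun phiA => x _; rewrite mxE.
move=> x A /nbhs_ballP[e /= e0 eA].
apply/nbhs_ballP; exists (e / C) => /=; first exact: divr_gt0.
move=> y; rewrite -ball_normE/= => xy; apply: eA; rewrite -ball_normE/=.
apply: (@le_lt_trans _ _ (C * `|x - y|)); last by rewrite mulrC -ltr_pdivlMr.
by rewrite (le_trans _ (phiC x y))// (le_trans _ (rV_coord_le _ 0))// !mxE.
Qed.

Lemma simplex_compact k : compact (@simplex R k).
Proof.
apply: bounded_closed_compact.
  exists 1; split=> // e e1 w [w0 w1] /=; apply: (le_trans _ (ltW e1)).
  apply: rV_norm_le => // j; rewrite ger0_norm//.
  by rewrite -w1 (bigD1 j)//= lerDl sumr_ge0.
have -> : @simplex R k =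
    \bigcap_i ((fun w : 'rV[R]_k => w 0 i) @^-1` [set x | 0 <= x]) `&`
    (fun w : 'rV[R]_k => \sum_i w 0 i) @^-1` [set x | x = 1].
  apply/seteqP; split=> [w [w0 w1]|w [w0 w1]]; split=> // i.
    by move=> _; exact: w0.
  exact: (w0 i I).
apply: closedI.
  apply: closed_bigI => i _; apply: preimage_closed; last exact: closed_ge.
  by move=> x _; exact: coord_continuous.
apply: preimage_closed; last exact: closed_eq.
move=> x _; apply: affine_fun_continuous.
apply: affine_fun_sum => i; exact: affine_fun_coord.
Qed.

Lemma polytope_compact k n (P : 'M[R]_(k, n)) : compact (polytope P).
Proof.
change (compact ((fun w => w *m P) @` @simplex R k)).
apply: continuous_compact; last exact: simplex_compact.
apply: continuous_subspaceT; apply: affine_map_continuous.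
by exists P, 0 => x _; rewrite addr0.
Qed.

Lemma polytope_closed k n (P : 'M[R]_(k, n)) : closed (polytope P).
Proof. by apply: compact_closed; [exact: norm_hausdorff|exact: polytope_compact]. Qed.

Definition polytopes k n (s : seq 'M[R]_(k, n)) : set 'rV[R]_n :=
  [set x | exists2 P, P \in s & polytope P x].

Lemma polytopes_cons k n (P : 'M[R]_(k, n)) s :
  polytopes (P :: s) = polytope P `|` polytopes s.
Proof.
apply/seteqP; split=> [x [Q]|x [Px|[Q Qs Qx]]].
- by rewrite in_cons => /orP[/eqP->|Qs Qx]; [left|right; exists Q].
- by exists P; rewrite ?mem_head.
- by exists Q; rewrite // in_cons Qs orbT.
Qed.

Lemma polytopes_compact k n (s : seq 'M[R]_(k, n)) : compact (polytopes s).
Proof.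
elim: s => [|P s IH]; last first.
  by rewrite polytopes_cons; apply: compactU => //; exact: polytope_compact.
suff -> : polytopes ([::] : seq 'M[R]_(k, n)) = set0 by exact: compact0.
by rewrite -subset0 => x [].
Qed.

Lemma polytopes_closed k n (s : seq 'M[R]_(k, n)) : closed (polytopes s).
Proof. by apply: compact_closed; [exact: norm_hausdorff|exact: polytopes_compact]. Qed.

End Topology.

(** * Subdivision of polytopes by hyperplanes *)

Section Cutting.
Context {R : realType}.

Lemma polytope_sub k l n (P : 'M[R]_(k, n)) (Q : 'M[R]_(l, n)) :
  (forall i, polytope P (row i Q)) -> polytope Q `<=` polytope P.
Proof.
move=> h _ [w [w0 w1] <-].
have /choice[W WE] i : exists w, simplex w /\ w *m P = row i Q.
  by have [v] := h i; exists v.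
exists (\sum_i w 0 i *: W i).
  split=> [j|].
    rewrite summxE sumr_ge0// => i _; rewrite mxE mulr_ge0//.
    exact: (WE i).1.1.
  under eq_bigr do rewrite summxE.
  rewrite exchange_big/= -[RHS]w1; apply: eq_bigr => i _.
  by under eq_bigr do rewrite mxE; rewrite -mulr_sumr (WE i).1.2 mulr1.
rewrite mulmx_suml mulmx_sum_row; apply: eq_bigr => i _.
by rewrite -scalemxAl (WE i).2.
Qed.

Definition set_row k n (P : 'M[R]_(k, n)) j (m : 'rV[R]_n) : 'M[R]_(k, n) :=
  \matrix_(i, l) if i == j then m 0 l else P i l.

Lemma row_set_row k n (P : 'M[R]_(k, n)) j m i :
  row i (set_row P j m) = if i == j then m else row i P.
Proof. by apply/rowP => l; case: eqP => h; rewrite !mxE; case: eqP. Qed.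

Lemma set_rowE k n (P : 'M[R]_(k, n)) j m :
  set_row P j m = P + delta_mx j 0 *m (m - row j P).
Proof.
apply/matrixP => i l; rewrite !mxE big_ord1 !mxE eqxx andbT.
by case: eqP => [->|_]; rewrite ?mul1r ?mul0r ?addr0// addrC subrK.
Qed.

(** With m the new vertex, [row j P] equals (m - a [row i P]) / b. Substituting this moves the
    weight [w 0 j] to m as [w 0 j / b] and leaves [w 0 i - w 0 j * a / b] at [row i P], which the
    last hypothesis makes nonnegative. *)
Lemma polytope_set_row k n (P : 'M[R]_(k, n)) i j (a b : R) w :
  i != j -> 0 < a -> 0 < b -> a + b = 1 -> simplex w -> w 0 j * a <= w 0 i * b ->
  polytope (set_row P j (a *: row i P + b *: row j P)) (w *m P).
Proof.
move=> ij a0 b0 ab [w0 w1] wij.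
pose c := a * w 0 j / b.
have c0 : 0 <= c by rewrite divr_ge0 ?mulr_ge0// ltW.
have cE : c * b = a * w 0 j by rewrite /c mulfVK// gt_eqF.
have wj : w 0 j + c = w 0 j / b.
  apply: (mulIf (lt0r_neq0 b0)); rewrite mulrDl cE mulfVK ?gt_eqF//.
  by rewrite mulrC -mulrDl addrC ab mul1r.
exists (w + c *: (delta_mx 0 j - delta_mx 0 i)).
  split=> [l|].
    rewrite !mxE /=; case: (eqVneq l i) => [->|li].
      rewrite (negPf ij) sub0r mulrN1 subr_ge0 /c ler_pdivrMr//.
      by rewrite mulrC.
    by rewrite subr0 addr_ge0// mulr_ge0// ler0n.
  under eq_bigr do rewrite 2!mxE.
  rewrite big_split/= w1 -mulr_sumr.
  suff -> : \sum_l (delta_mx 0 j - delta_mx 0 i : 'rV[R]_k) 0 l = 0.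
    by rewrite mulr0 addr0.
  under eq_bigr do rewrite !mxE/=.
  rewrite big_split/= sumrN (bigD1 j)//= eqxx big1 => [|l /negPf->//].
  rewrite (bigD1 i)//= eqxx big1 => [|l /negPf->//].
  by rewrite !addr0; exact: subrr.
rewrite set_rowE mulmxDr mulmxDl -scalemxAl mulmxBl -!rowE mulmxA.
set v := w + _; have -> : v *m delta_mx j 0 = (w 0 j / b)%:M :> 'M[R]_1.
  apply/rowP => l; rewrite ord1 -colE -wj !mxE/= !eqxx.
  by rewrite eq_sym (negPf ij) subr0 mulr1 mulr1n.
rewrite mul_scalar_mx -addrA -[RHS]addr0; congr (_ + _).
have -> : a *: row i P + b *: row j P - row j P = a *: (row i P - row j P).
  have -> : b = 1 - a by rewrite -ab addrAC subrr add0r.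
  by apply/rowP => l; rewrite !mxE; ring.
by rewrite scalerA; apply/rowP => l; rewrite !mxE /c; ring.
Qed.

(** Both lists have the same [k]: cutting never increases the number of vertices of a piece. The
    pieces may overlap and may be degenerate. *)
Definition refines k n (s s' : seq 'M[R]_(k, n)) : Prop :=
  (forall Q, Q \in s' -> exists2 P, P \in s & polytope Q `<=` polytope P) /\
  polytopes s `<=` polytopes s'.

Lemma refines_refl k n (s : seq 'M[R]_(k, n)) : refines s s.
Proof. by split=> // Q Qs; exists Q. Qed.

Lemma refines_trans k n (s s' s'' : seq 'M[R]_(k, n)) :
  refines s s' -> refines s' s'' -> refines s s''.
Proof.
move=> [h1 h2] [h3 h4]; split; last exact: subset_trans h4.
by move=> Q /h3[P /h1[P' P's PP'] QP]; exists P' => //; exact: subset_trans PP'.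
Qed.

Lemma refines_polytopes k n (s s' : seq 'M[R]_(k, n)) :
  refines s s' -> polytopes s' = polytopes s.
Proof.
move=> [h1 h2]; apply/seteqP; split=> // x [Q /h1[P Ps QP] Qx].
by exists P => //; exact: QP.
Qed.

Lemma refines_each k n (good : 'M[R]_(k, n) -> Prop) (s : seq 'M[R]_(k, n)) :
  (forall P, P \in s -> exists2 s', refines [:: P] s' & forall Q, Q \in s' -> good Q) ->
  exists2 s', refines s s' & forall Q, Q \in s' -> good Q.
Proof.
elim: s => [|P s IH] h.
  by exists [::] => //; exact: refines_refl.
have [|s1 [h1 h2] g1] := IH.
  by move=> Q Qs; apply: h; rewrite in_cons Qs orbT.
have [|s2 [h3 h4] g2] := h P; first exact: mem_head.
exists (s2 ++ s1); last by move=> Q; rewrite mem_cat => /orP[/g2|/g1].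
split=> [Q|x].
  rewrite mem_cat => /orP[/h3[P']|/h1[P' P's]].
    by rewrite inE => /eqP->; exists P; rewrite // mem_head.
  by exists P'; rewrite // in_cons P's orbT.
rewrite polytopes_cons => -[Px|/h2[Q Qs Qx]]; last first.
  by exists Q; rewrite // mem_cat Qs orbT.
have [|Q Qs Qx] := h4 x; first by exists P; rewrite // mem_head.
by exists Q; rewrite // mem_cat Qs.
Qed.

(* Cut along an edge on which phi changes sign: each of the two pieces has fewer
   vertices off the hyperplane phi = 0. *)
Lemma polytope_cut k n (P : 'M[R]_(k, n)) phi : affine_fun (polytope P) phi ->
  exists2 s, refines [:: P] s & forall Q, Q \in s ->
    (forall x, polytope Q x -> 0 <= phi x) \/ (forall x, polytope Q x -> phi x <= 0).
Proof.
have [N] := ubnP #|[pred i | phi (row i P) != 0]|; elim: N P => // N IH P PN phiA.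
have [/forallP/= h|] := boolP [forall i, 0 <= phi (row i P)].
  exists [:: P]; first exact: refines_refl.
  move=> Q; rewrite inE => /eqP->; left=> _ [w sw <-].
  by rewrite affine_fun_polytope// sumr_ge0// => i _; rewrite mulr_ge0//; exact: sw.1.
rewrite negb_forall => /existsP[/= j]; rewrite -ltNge => phij.
have [/forallP/= h|] := boolP [forall i, phi (row i P) <= 0].
  exists [:: P]; first exact: refines_refl.
  move=> Q; rewrite inE => /eqP->; right=> _ [w sw <-].
  rewrite affine_fun_polytope// sumr_le0// => i _; rewrite mulr_ge0_le0//.
  exact: sw.1.
rewrite negb_forall => /existsP[/= i]; rewrite -ltNge => phii.
have ij : i != j by apply: contraTneq phii => ->; rewrite -leNgt ltW.
pose d := phi (row i P) - phi (row j P).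
have d0 : 0 < d by rewrite subr_gt0 (lt_trans phij).
(* The weights of the point where the affine function [phi] vanishes on the edge from [row i P] to
   [row j P]. *)
pose a := - phi (row j P) / d; pose b := phi (row i P) / d.
have a0 : 0 < a by rewrite divr_gt0// oppr_gt0.
have b0 : 0 < b by rewrite divr_gt0.
have ab : a + b = 1 by rewrite /a /b -mulrDl addrC divff// gt_eqF.
pose m := a *: row i P + b *: row j P.
have Pm : polytope P m.
  have := polytope_convex (polytope_row P i) (polytope_row P j) (t := b).
  have -> : 1 - b = a by rewrite -ab addrK.
  by apply; rewrite ltW//= -ab lerDr ltW.
have phim : phi m = 0.
  have [c [e phiE]] := phiA.
  have phir r : (row r P *m c) 0 0 = phi (row r P) - e.
    by rewrite phiE ?addrK//; exact: polytope_row.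
  have E (x y : 'M[R]_1) : (a *: x + b *: y) 0 0 = a * x 0 0 + b * y 0 0.
    by rewrite !mxE.
  rewrite (phiE _ Pm) /m mulmxDl -!scalemxAl E !phir -{2}[e]mul1r -ab /a /b /d; field.
  by rewrite gt_eqF.
have sub l : polytope (set_row P l m) `<=` polytope P.
  apply: polytope_sub => r; rewrite row_set_row; case: eqP => // _.
  exact: polytope_row.
have IHl l : phi (row l P) != 0 -> exists2 s, refines [:: set_row P l m] s &
    forall Q, Q \in s -> (forall x, polytope Q x -> 0 <= phi x) \/
                         (forall x, polytope Q x -> phi x <= 0).
  move=> phil; apply: IH; last exact: affine_funS (sub l) phiA.
  rewrite -ltnS (leq_trans _ PN)// ltnS; apply: proper_card; apply/properP; split.
    apply/fintype.subsetP => r; rewrite !inE row_set_row; case: (r =P l) => // ->.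
    by rewrite phim eqxx.
  by exists l; rewrite !inE ?row_set_row ?eqxx ?phim ?eqxx.
have [|s h g] := refines_each (good := fun Q => (forall x, polytope Q x -> 0 <= phi x) \/
                         (forall x, polytope Q x -> phi x <= 0))
    (s := [:: set_row P i m; set_row P j m]).
  move=> Q; rewrite !inE => /orP[]/eqP->; apply: IHl; first by rewrite gt_eqF.
  by rewrite lt_eqF.
exists s => //; apply: refines_trans h; split=> [Q|x [Q]].
  by rewrite !inE => /orP[]/eqP->; exists P; rewrite ?mem_head.
rewrite inE => /eqP-> [w sw <-].
(* The segment from the new vertex to the remaining ones splits the polytope according to the ratio
   of the two weights. *)
have [wij|wij] := leP (w 0 j * a) (w 0 i * b).
  exists (set_row P j m); first by rewrite !inE eqxx orbT.
  exact: polytope_set_row.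
exists (set_row P i m); first by rewrite !inE eqxx.
rewrite /m addrC; apply: polytope_set_row => //; first by rewrite eq_sym.
  by rewrite addrC.
exact: ltW.
Qed.

Lemma polytopes_cut k n (s : seq 'M[R]_(k, n)) phi :
  (forall P, P \in s -> affine_fun (polytope P) phi) ->
  exists2 s', refines s s' & forall Q, Q \in s' ->
    (forall x, polytope Q x -> 0 <= phi x) \/ (forall x, polytope Q x -> phi x <= 0).
Proof. by move=> h; apply: refines_each => P Ps; apply: polytope_cut; exact: h. Qed.

End Cutting.

(** * Local covers and affine charts *)

Section Charts.
Context {R : realType}.

Lemma polytopes_cuts (I : eqType) k n (s : seq 'M[R]_(k, n)) (phi : I -> 'rV[R]_n -> R)
    (l : seq I) : (forall i, affine_fun setT (phi i)) ->
  exists2 s', refines s s' & forall i Q, i \in l -> Q \in s' ->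
    (forall x, polytope Q x -> 0 <= phi i x) \/ (forall x, polytope Q x -> phi i x <= 0).
Proof.
move=> phiA; elim: l => [|i l [s1 h1 g1]]; first by exists s => //; exact: refines_refl.
have [|s2 h2 g2] := @polytopes_cut _ _ _ s1 (phi i).
  by move=> P _; exact: affine_funS (phiA i).
exists s2; first exact: refines_trans h2.
move=> j Q; rewrite in_cons => /orP[/eqP->|jl] Qs2; first exact: g2.
have [P Ps1 QP] := h2.1 _ Qs2.
by have [h|h] := g1 j P jl Ps1; [left|right] => x /QP/h.
Qed.

(** The ball of the sup norm is a cube. After cutting along its facet hyperplanes, the pieces inside
    it are kept; a piece on the outer side of some facet contains no point of the open cube. *)
Lemma polytopes_localize k n (s : seq 'M[R]_(k, n)) (a : 'rV[R]_n) (e : R) : 0 < e ->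
  exists s' : seq 'M[R]_(k, n), [/\
    forall Q, Q \in s' -> exists2 P, P \in s & polytope Q `<=` polytope P,
    forall x, polytopes s' x -> `|x - a| <= e &
    forall x, polytopes s x -> `|x - a| < e -> polytopes s' x].
Proof.
move=> e0.
pose phi (i : 'I_n * bool) (x : 'rV[R]_n) := (-1) ^+ i.2 * (x 0 i.1 - a 0 i.1) - e.
have [|s1 h1 g1] := @polytopes_cuts _ _ _ s phi (enum {: 'I_n * bool}).
  move=> i; apply: affine_funB; last exact: affine_fun_cst.
  apply: affine_funZ; apply: affine_funB; last exact: affine_fun_cst.
  exact: affine_fun_coord.
pose inside (Q : 'M[R]_(k, n)) := `[< forall i x, polytope Q x -> phi i x <= 0 >].
exists [seq Q <- s1 | inside Q]; split.
- by move=> Q; rewrite mem_filter => /andP[_]; exact: h1.1.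
- move=> x [Q]; rewrite mem_filter => /andP[/asboolP h _] Qx.
  apply: rV_norm_le => [|j]; first exact: ltW.
  have := h (j, true) x Qx; have := h (j, false) x Qx; rewrite /phi/= !mxE expr0 expr1.
  by move=> h1' h2'; rewrite ler_norml; apply/andP; split; lra.
- move=> x sx xa; have [Q Qs1 Qx] := h1.2 _ sx.
  exists Q => //; rewrite mem_filter Qs1 andbT; apply/asboolP => i y Qy.
  have [h|h] := g1 i Q (mem_enum _ i) Qs1; last exact: h.
  have := h _ Qx; rewrite leNgt => /negP[].
  rewrite /phi subr_lt0 (le_lt_trans (ler_norm _))// normrM normrX normrN1 expr1n mul1r.
  by rewrite (le_lt_trans _ xa)// (le_trans _ (rV_coord_le _ i.1))// !mxE.
Qed.

(** The second hypothesis says that [A] is open in the finite union, so near each point the pieces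
    can be localized to a cube in which they lie inside [A]. *)
Lemma piecewise_linear_finite k m n (s : seq 'M[R]_(k, m)) (A : set 'rV[R]_m)
    (f : 'rV[R]_m -> 'rV[R]_n) :
  A `<=` polytopes s ->
  (forall a, A a -> exists2 e : R, 0 < e &
     forall y, polytopes s y -> `|y - a| <= e -> A y) ->
  (forall P, P \in s -> affine_map (polytope P `&` A) f) ->
  piecewise_linear A f.
Proof.
move=> As Aopen fA a Aa; have [e e0 eA] := Aopen a Aa.
have [s' [s's s'e ss']] := polytopes_localize s a e0.
have s'A Q : Q \in s' -> polytope Q `<=` A.
  move=> Qs' y Qy; apply: eA; last by apply: s'e; exists Q.
  by have [P Ps QP] := s's Q Qs'; exists P => //; exact: QP.
exists k, s'; split; first split=> //.
  by apply/within_nbhsP; exists e => // y Ay ya; apply: ss' => //; exact: As.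
move=> Q Qs'; have [P Ps QP] := s's Q Qs'.
have [M [b fE]] := fA P Ps; exists M, b => x Qx; apply: fE.
by split; [exact: QP|exact: s'A Qx].
Qed.

(** The points of [Z] at distance at least [e] from [a] form a compact set, whose image is closed
    and misses [f a]. *)
Lemma compact_inverse_continuous m n (Z : set 'rV[R]_m) (f : 'rV[R]_m -> 'rV[R]_n) a (e : R) :
  compact Z -> continuous f -> (forall y, Z y -> f y = f a -> y = a) -> 0 < e ->
  exists2 d : R, 0 < d & forall y, Z y -> `|f y - f a| < d -> `|y - a| < e.
Proof.
move=> Zc fc finj e0.
pose Z' := Z `&` [set y | e <= `|y - a|].
have Z'c : compact Z'.
  apply: (subclosed_compact _ Zc); last by move=> y [].
  apply: closedI; first by apply: compact_closed => //; exact: norm_hausdorff.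
  suff -> : [set y : 'rV[R]_m | e <= `|y - a|] = ~` ball a e.
    by apply: open_closedC; exact: ball_open.
  rewrite -ball_normE; apply/seteqP; split=> y /=; rewrite -opprB normrN.
    by rewrite leNgt => /negP.
  by move=> /negP; rewrite -leNgt.
have fZ'c : closed (f @` Z').
  apply: compact_closed; first exact: norm_hausdorff.
  by apply: continuous_compact => //; exact: continuous_subspaceT.
have : nbhs (f a) (~` (f @` Z')).
  apply: open_nbhs_nbhs; split; first by rewrite openC.
  move=> [y [Zy ey] /(finj _ Zy) ya]; move: ey; rewrite ya /= subrr normr0.
  by rewrite leNgt e0.
move=> /nbhs_ballP[d /= d0 h]; exists d => // y Zy yd.
rewrite ltNge; apply/negP => ey; apply: (h (f y)); last by exists y.
by rewrite -ball_normE/= -opprB normrN.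
Qed.

(** The inverse keeps weights: it sends [w *m map_rows f P] to [w *m P], so [affine_map_of_rows]
    applies without inverting a matrix. *)
Lemma affine_map_inverse k m n (P : 'M[R]_(k, m)) (f : 'rV[R]_m -> 'rV[R]_n)
    (g : 'rV[R]_n -> 'rV[R]_m) :
  affine_map (polytope P) f -> (forall x, polytope P x -> g (f x) = x) ->
  affine_map (polytope (map_rows f P)) g.
Proof.
move=> fA gf; apply: (@affine_map_of_rows _ _ _ _ _ P) => w sw.
by rewrite -affine_map_polytope// gf//; exists w.
Qed.

(* The chart is f up to scaling, restricted to the part of F near x that f sends
   into the bounded model; being a cone, C does not notice the scaling. *)
Lemma modelled_on_chart k n l (s : seq 'M[R]_(k, n)) (x : 'rV[R]_n) (D : set 'rV[R]_n)
    (f : 'rV[R]_n -> 'rV[R]_l) (C B : set 'rV[R]_l) :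
  polytopes s x -> closed D -> nbhs x D ->
  affine_map setT f -> f x = 0 ->
  (forall y z, polytopes s y -> D y -> polytopes s z -> D z -> f y = f z -> y = z) ->
  (forall y, polytopes s y -> D y -> C (f y)) ->
  (exists2 r : R, 0 < r & forall c, C c -> `|c| < r ->
     exists y, [/\ polytopes s y, D y & f y = c]) ->
  (forall c (t : R), C c -> 0 < t -> C (t *: c)) ->
  open B -> (exists K : R, forall b, B b -> `|b| <= K) -> B 0 ->
  modelled_on (polytopes s) (C `&` B) x.
Proof.
move=> sx Dcl Dx fA fx finj fC [r r0 rC] Cscale Bo [K BK] B0.
pose Z := polytopes s `&` D.
have Zc : compact Z.
  apply: (subclosed_compact _ (@polytopes_compact _ _ _ s)); last by move=> y [].
  by apply: closedI => //; exact: polytopes_closed.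
have fcont := affine_map_continuous fA.
have [d0 /= d00 dD] : exists2 d : R, 0 < d & forall y, `|y - x| < d -> D y.
  have /nbhs_ballP[d /= d0' h] := Dx; exists d => // y yd; apply: h.
  by rewrite -ball_normE/= -opprB normrN.
have inv a e : Z a -> 0 < e ->
    exists2 d : R, 0 < d & forall y, Z y -> `|f y - f a| < d -> `|y - a| < e.
  move=> [sa Da]; apply: compact_inverse_continuous => // y [sy Dy]; exact: finj.
have Zx : Z x by split=> //; exact: nbhs_singleton.
have [d1 d10 d1P] := inv x d0 Zx d00.
pose K' := `|K| + 1; have K'0 : 0 < K' by rewrite ltr_wpDl.
(* The scaled model [c *: B] lies in the ball of radius [r], where [f] is onto the cone, and in that
   of radius [d1], whose preimage in [Z] stays within [d0] of [x]. *)
pose c := Num.min d1 r / K'.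
have c0 : 0 < c by rewrite divr_gt0// lt_min d10.
have cB b : B b -> `|c *: b| < Num.min d1 r.
  move=> Bb; rewrite normrZ gtr0_norm// /c mulrAC ltr_pdivrMr// ltr_pM2l ?lt_min ?d10//.
  by rewrite (le_lt_trans (BK _ Bb))// (le_lt_trans (ler_norm K))// ltrDl.
pose f' y := c^-1 *: f y.
have ff' y : f y = c *: f' y by rewrite scalerA divff ?scale1r// gt_eqF.
have f'A : affine_map setT f'.
  have /affine_mapP fAj := fA; apply/affine_mapP => j.
  by apply: eq_affine_fun (affine_funZ c^-1 (fAj j)) => y _; rewrite mxE.
have f'cont := affine_map_continuous f'A.
have fminP y : Z y -> B (f' y) -> `|y - x| < d0.
  move=> Zy /cB; rewrite -ff' lt_min => /andP[h _]; apply: d1P => //.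
  by rewrite fx subr0.
pose U := Z `&` [set y | B (f' y)].
have f'0 : f' x = 0 by rewrite /f' fx scaler0.
(* Near a point of [U], membership in [D] is automatic, because such a point is closer than [d0] to
   [x]. *)
have Uopen a : U a -> exists2 e : R, 0 < e &
     forall y, polytopes s y -> `|y - a| <= e -> U y.
  move=> [Za Ba].
  have : nbhs a [set y | B (f' y)].
    by apply: f'cont; exact: open_nbhs_nbhs.
  move=> /nbhs_ballP[e1 /= e10 e1P].
  have ax : 0 < d0 - `|a - x| by rewrite subr_gt0 fminP.
  exists (Num.min e1 (d0 - `|a - x|) / 2).
    by rewrite divr_gt0// lt_min e10.
  move=> y sy ya.
  have : `|y - a| < Num.min e1 (d0 - `|a - x|).
    rewrite (le_lt_trans ya)// ltr_pdivrMr// ltr_pMr ?lt_min ?e10//.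
    by rewrite ltr1n.
  rewrite lt_min => /andP[ye1 yd]; split; last first.
    by apply: e1P; rewrite -ball_normE/= -opprB normrN.
  split=> //; apply: dD; rewrite -(subrK a y) -addrA (le_lt_trans (ler_normD _ _))//.
  by rewrite -ltrBrDr.
have Us : U `<=` polytopes s by move=> y [[]].
have f'inj y z : U y -> U z -> f' y = f' z -> y = z.
  by move=> [[sy Dy] _] [[sz Dz] _] yz; apply: finj => //; rewrite !ff' yz.
have surj m : (C `&` B) m -> exists y, U y /\ f' y = m.
  move=> [Cm Bm].
  have [||y [sy Dy fy]] := rC (c *: m); first exact: Cscale.
    by have := cB _ Bm; rewrite lt_min => /andP[].
  have yE : f' y = m by rewrite /f' fy scalerA mulVf ?scale1r// gt_eqF.
  by exists y; split=> //; split=> //=; rewrite yE.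
have [g gP] : exists g, forall m, (C `&` B) m -> U (g m) /\ f' (g m) = m.
  have /choice[g gP] m : exists y, (C `&` B) m -> U y /\ f' y = m.
    by have [/surj[y yP]|nm] := pselect ((C `&` B) m); [exists y|exists 0].
  by exists g.
have f'CB y : U y -> (C `&` B) (f' y).
  by move=> [[sy Dy] By]; split=> //; apply: Cscale; [exact: fC|rewrite invr_gt0].
have gf y : U y -> g (f' y) = y.
  by move=> Uy; have [Ug fg] := gP _ (f'CB y Uy); exact: f'inj.
exists U; split=> //.
  have [|e e0 eP] := Uopen x; first by split=> //=; rewrite f'0.
  by apply/within_nbhsP; exists e => // y sy ye; apply: eP => //; exact: ltW.
exists f' => //; split; [|split=> //].
  by apply: (piecewise_linear_finite Us) => // P _; exact: affine_mapS f'A.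
exists g; split.
(* The cover near [m] consists of the images of small pieces around [a]. They are polytopes since
   [f'] is affine, and they cover a neighborhood of [m] by continuity of the inverse. *)
- move=> m CBm; have [Ua fa] := gP m CBm; set a := g m in Ua fa.
  have [e e0 eP] := Uopen a Ua.
  have [s' [s's s'e ss']] := polytopes_localize s a e0.
  have s'U Q : Q \in s' -> polytope Q `<=` U.
    move=> Qs' y Qy; apply: eP; last by apply: s'e; exists Q.
    by have [P Ps QP] := s's Q Qs'; exists P => //; exact: QP.
  have fQ Q : affine_map (polytope Q) f' by exact: affine_mapS f'A.
  exists k, (map (map_rows f') s'); split; first split.
  + move=> _ /mapP[Q Qs' ->]; rewrite polytope_map_rows// => _ [y Qy <-].
    by apply: f'CB; exact: s'U Qy.
  + have [d d0' dP] := inv a e Ua.1 e0.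
    apply/within_nbhsP; exists (d / c); first exact: divr_gt0.
    move=> m' CBm' mm'; have [Um' fm'] := gP m' CBm'.
    have : polytopes s' (g m').
      apply: ss'; first exact: Us.
      apply: dP; first exact: Um'.1.
      by rewrite !ff' fm' fa -scalerBr normrZ gtr0_norm// mulrC -ltr_pdivlMr.
    move=> [Q Qs' Qm']; exists (map_rows f' Q); first exact: map_f.
    by rewrite polytope_map_rows//; exists (g m').
  + move=> _ /mapP[Q Qs' ->]; apply: affine_map_inverse => // y Qy.
    by apply: gf; exact: s'U Qy.
- by move=> m /gP[].
- by move=> y; rewrite inE; exact: gf.
- by move=> m; rewrite inE => /gP[].
Qed.

End Charts.

(** * Rays under PL maps, and the two link properties *)

Section CutRays.
Context {R : realType}.

Lemma seq_uniform_radius (I : eqType) (s : seq I) (Q : I -> R -> Prop) :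
  (forall i d d', Q i d -> 0 < d' <= d -> Q i d') ->
  (forall i, i \in s -> exists2 d : R, 0 < d & Q i d) ->
  exists2 d : R, 0 < d & forall i, i \in s -> Q i d.
Proof.
move=> mono; elim: s => [|i s IH] h; first by exists 1.
have [|d d0 dQ] := IH; first by move=> j js; apply: h; rewrite in_cons js orbT.
have [|d' d'0 d'Q] := h i; first exact: mem_head.
have m0 : 0 < Num.min d d' by rewrite lt_min d0.
exists (Num.min d d') => // j; rewrite in_cons => /orP[/eqP->|js].
  by apply: mono d'Q _; rewrite m0 ge_min lexx orbT.
by apply: mono (dQ _ js) _; rewrite m0 ge_min lexx.
Qed.

Lemma polytope_away k n (P : 'M[R]_(k, n)) a : ~ polytope P a ->
  exists2 d : R, 0 < d & forall y, polytope P y -> ~ (`|y - a| < d).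
Proof.
move=> Pa.
have : nbhs a (~` polytope P).
  by apply: open_nbhs_nbhs; split=> //; rewrite openC; exact: polytope_closed.
move=> /nbhs_ballP[d /= d0 h]; exists d => // y Py yd; apply: (h y) => //.
by rewrite -ball_normE/= -opprB normrN.
Qed.

Lemma piecewise_linear_continuous m n (A : set 'rV[R]_m) (f : 'rV[R]_m -> 'rV[R]_n) a (e : R) :
  piecewise_linear A f -> A a -> 0 < e ->
  exists2 d : R, 0 < d & forall y, A y -> `|y - a| < d -> `|f y - f a| < e.
Proof.
move=> fPL Aa e0; have [k [s [[sA /within_nbhsP[d0 d00 sd0]] fs]]] := fPL a Aa.
have [|P Ps|d d_gt0 dP] := @seq_uniform_radius _ s (fun P d => forall y, polytope P y ->
    `|y - a| < d -> `|f y - f a| < e).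
- move=> P d d' h /andP[_ dd'] y Py ya; apply: h => //; exact: lt_le_trans dd'.
- have [Pa|/polytope_away[d d_gt0 h]] := pselect (polytope P a); last first.
    by exists d => // y Py /(h _ Py).
  have [M [b fE]] := fs P Ps.
  have [|C C0 hC] := @affine_map_lip R m n (fun x => x *m M + b); first by exists M, b.
  exists (e / C) => [|y Py ya]; first exact: divr_gt0.
  by rewrite !fE// (le_lt_trans (hC _ _))// mulrC -ltr_pdivlMr.
exists (Num.min d0 d) => [|y Ay]; first by rewrite lt_min d00.
rewrite lt_min => /andP[ya0 ya]; have [P Ps Py] := sd0 y Ay ya0.
exact: dP Ps y Py ya.
Qed.

(** Among finitely many pieces, one contains points of the ray arbitrarily close to [a]. It contains
    [a] because it is closed, and an initial segment of the ray because it is convex. *)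
Lemma piecewise_linear_ray m n (A : set 'rV[R]_m) (f : 'rV[R]_m -> 'rV[R]_n) a u :
  piecewise_linear A f -> (forall t : R, 0 <= t <= 1 -> A (a + t *: u)) ->
  exists2 e : R, 0 < e <= 1 & exists v, forall t, 0 <= t <= e -> f (a + t *: u) = f a + t *: v.
Proof.
move=> fPL Aray.
have Aa : A a by have := Aray 0; rewrite lexx ler01 scale0r addr0; exact.
have [k [s [[sA /within_nbhsP[d0 d00 sd0]] fs]]] := fPL a Aa.
have [[P [Ps Pray]]|noP] := pselect (exists P, P \in s /\
    forall d : R, 0 < d -> exists t, 0 < t < d /\ polytope P (a + t *: u)); last first.
  have [|P Ps|d d_gt0 dP] := @seq_uniform_radius _ s (fun P d => forall t, 0 < t < d ->
      ~ polytope P (a + t *: u)).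
  - move=> P d d' h /andP[_ dd'] t /andP[t0 td]; apply: h.
    by rewrite t0 (lt_le_trans td).
  - apply: contrapT => h; apply: noP; exists P; split=> // d d_gt0.
    apply: contrapT => h'; apply: h; exists d => // t td Pt.
    by apply: h'; exists t.
  exfalso.
  (* Such a [t] gives a point of the ray that is in the covered neighborhood and yet, by [dP], in no
     piece. The [1 +] allows [u] to be zero. *)
  pose t := Num.min (Num.min d 1) (d0 / (1 + `|u|)) / 2.
  have u1 : 0 < 1 + `|u| by rewrite ltr_pwDl.
  have m0 : 0 < Num.min (Num.min d 1) (d0 / (1 + `|u|)).
    by rewrite !lt_min d_gt0 ltr01 divr_gt0.
  have t0 : 0 < t by rewrite divr_gt0.
  have : t < Num.min (Num.min d 1) (d0 / (1 + `|u|)).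
    by rewrite ltr_pdivrMr// ltr_pMr// ltr1n.
  rewrite !lt_min => /andP[/andP[td t1] tu].
  have [||P Ps Pt] := sd0 (a + t *: u).
  - by apply: Aray; rewrite (ltW t0) ltW.
  - rewrite addrAC subrr add0r normrZ gtr0_norm// (@le_lt_trans _ _ (t * (1 + `|u|)))//.
      by rewrite ler_pM2l// lerDr.
    by rewrite -ltr_pdivlMr.
  by apply: (dP P Ps t) => //; rewrite t0.
have Pa : polytope P a.
  apply: contrapT => /polytope_away[d d_gt0 h].
  have u1 : 0 < 1 + `|u| by rewrite ltr_pwDl.
  have [|t [/andP[t0 td] Pt]] := Pray (d / (1 + `|u|)); first exact: divr_gt0.
  apply: h Pt _.
  rewrite addrAC subrr add0r normrZ gtr0_norm// (@le_lt_trans _ _ (t * (1 + `|u|)))//.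
    by rewrite ler_pM2l// lerDr.
  by rewrite -ltr_pdivlMr.
have [t0 [/andP[t00 t01] Pt0]] := Pray 1 ltr01.
exists t0; first by rewrite t00 ltW.
have [M [b fE]] := fs P Ps.
exists (u *m M) => t /andP[t_ge0 tt0].
have Pt : polytope P (a + t *: u).
  have -> : a + t *: u = (1 - t / t0) *: a + (t / t0) *: (a + t0 *: u).
    rewrite scalerDr scalerA addrA -scalerDl subrK scale1r mulfVK//.
    by rewrite gt_eqF.
  apply: polytope_convex => //; rewrite divr_ge0// ?(ltW t00)//=.
  by rewrite ler_pdivrMr// mul1r.
by rewrite !fE// mulmxDl scalemxAl addrAC.
Qed.

Lemma no_sign_change (h : R -> R) :
  (forall t (e : R), 0 <= t <= 1 -> 0 < e -> exists2 d : R, 0 < d &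
     forall t', 0 <= t' <= 1 -> `|t' - t| < d -> `|h t' - h t| < e) ->
  (forall t, 0 <= t <= 1 -> h t != 0) -> 0 < h 0 -> 0 < h 1.
Proof.
move=> hc hn h0; rewrite ltNge; apply/negP => h1.
have [||t t01 ht] := @IVT R h 0 1 0 ler01.
- apply/subspace_continuousP => t t01.
  move=> A /nbhs_ballP[e /= e0 eA].
  have [|d d0 hd] := hc t e _ e0; first by move: t01; rewrite /= in_itv.
  apply/nbhs_ballP; exists d => //= t'; rewrite -ball_normE/= distrC => t't t'01.
  apply: eA; rewrite -ball_normE/= distrC; apply: hd => //.
- by rewrite ge_min h1 orbT le_max (ltW h0).
have t01' : 0 <= t <= 1 by move: t01; rewrite in_itv.
by have := hn t t01'; rewrite ht eqxx.
Qed.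

(** Linear on each quadrant, with the positive and negative half-axes sent to the rays of [a], [b]
    and of [c], [d]: a cone on the 4-cycle a, c, b, d. *)
Definition pl_plane n (a b c d : 'rV[R]_n) (x y : R) : 'rV[R]_n :=
  Num.max x 0 *: a + Num.max (- x) 0 *: b + (Num.max y 0 *: c + Num.max (- y) 0 *: d).

Lemma max0_lip (x y : R) : `|Num.max x 0 - Num.max y 0| <= `|x - y|.
Proof.
have [hx|hx] := leP x 0; have [hy|hy] := leP y 0; rewrite ?subrr ?normr0// ?subr0 ?sub0r ?normrN.
- rewrite [leLHS]gtr0_norm// distrC ler_normr; apply/orP; left; lra.
- rewrite [leLHS]gtr0_norm// ler_normr; apply/orP; left; lra.
Qed.

Lemma max0_split (x : R) : Num.max x 0 + Num.max (- x) 0 = `|x|.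
Proof.
have [hx|hx] := leP x 0; have [hy|hy] := leP (- x) 0.
- by rewrite (_ : x = 0) ?normr0 ?addr0//; lra.
- by rewrite ler0_norm// add0r.
- by rewrite gtr0_norm// addr0.
- lra.
Qed.

Lemma pl_plane_norm n (a b c d : 'rV[R]_n) x y :
  `|a| <= 1 -> `|b| <= 1 -> `|c| <= 1 -> `|d| <= 1 ->
  `|pl_plane a b c d x y| <= `|x| + `|y|.
Proof.
move=> a1 b1 c1 d1; rewrite -(max0_split x) -(max0_split y).
have m0 (z : R) : 0 <= Num.max z 0 by rewrite le_max lexx orbT.
have h (z : R) (w : 'rV[R]_n) : `|w| <= 1 -> `|Num.max z 0 *: w| <= Num.max z 0.
  by move=> w1; rewrite normrZ ger0_norm// ler_piMr.
rewrite /pl_plane (le_trans (ler_normD _ _))//.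
by rewrite lerD// (le_trans (ler_normD _ _))// lerD// h.
Qed.

Lemma pl_plane_lip n (a b c d : 'rV[R]_n) x y x' y' :
  `|a| <= 1 -> `|b| <= 1 -> `|c| <= 1 -> `|d| <= 1 ->
  `|pl_plane a b c d x y - pl_plane a b c d x' y'| <= (`|x - x'| + `|y - y'|) *+ 2.
Proof.
move=> a1 b1 c1 d1.
have -> : pl_plane a b c d x y - pl_plane a b c d x' y' =
    (Num.max x 0 - Num.max x' 0) *: a + (Num.max (- x) 0 - Num.max (- x') 0) *: b +
    ((Num.max y 0 - Num.max y' 0) *: c + (Num.max (- y) 0 - Num.max (- y') 0) *: d).
  by apply/rowP => i; rewrite !mxE; ring.
have h (z z' : R) (w : 'rV[R]_n) : `|w| <= 1 ->
    `|(Num.max z 0 - Num.max z' 0) *: w| <= `|z - z'|.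
  move=> w1; rewrite normrZ (le_trans _ (max0_lip z z'))// ler_piMr//.
rewrite mulr2n (le_trans (ler_normD _ _))//.
have -> : `|x - x'| + `|y - y'| + (`|x - x'| + `|y - y'|) =
  `|x - x'| + `|- x - - x'| + (`|y - y'| + `|- y - - y'|).
  by rewrite -(opprD x) -(opprD y) !normrN; ring.
by rewrite lerD// (le_trans (ler_normD _ _))// lerD// h.
Qed.

Lemma pl_planeZ n (a b c d : 'rV[R]_n) (t x y : R) : 0 <= t ->
  pl_plane a b c d (t * x) (t * y) = t *: pl_plane a b c d x y.
Proof.
move=> t0; have h z : Num.max (t * z) 0 = t * Num.max z 0.
  by rewrite maxr_pMr// mulr0.
by rewrite /pl_plane -!mulrN !h !scalerDr !scalerA.
Qed.

(* In the link of the origin, u is a cut point; phi separates its two sides. *)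
Definition has_cut_ray k (M : set 'rV[R]_k) : Prop :=
  exists u phi, [/\ u != 0, continuous phi,
    forall t : R, 0 <= t <= 1 -> M (t *: u) /\ phi (t *: u) = 0 :> R,
    forall m, M m -> phi m = 0 -> exists2 t, 0 <= t & m = t *: u &
    forall d : R, 0 < d -> (exists m, [/\ M m, `|m| < d & 0 < phi m]) /\
                           (exists m, [/\ M m, `|m| < d & phi m < 0])].

(* In the link of the origin, any two points lie on a common circle. *)
Definition has_common_planes k (N : set 'rV[R]_k) : Prop :=
  forall n n', N n -> N n' -> exists a b c d,
    [/\ [/\ `|a| <= 1, `|b| <= 1, `|c| <= 1 & `|d| <= 1],
        forall x y x' y', pl_plane a b c d x y = pl_plane a b c d x' y' -> x = x' /\ y = y',
        forall x y, `|x| < 2^-1 -> `|y| < 2^-1 -> N (pl_plane a b c d x y),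
        exists x y, [/\ n = pl_plane a b c d x y, `|x| <= `|n| & `|y| <= `|n|] &
        exists x y, [/\ n' = pl_plane a b c d x y, `|x| <= `|n'| & `|y| <= `|n'|]].

(** Of the rays through (1, 0), (-1, 0) and (0, 1), two nonzero vectors meet at most two. Such a ray
    stands in for the cut ray when the latter leaves the plane, so that one argument serves both
    cases. *)
Lemma third_ray (p1 p2 q1 q2 : R) : ~ (p1 = 0 /\ p2 = 0) -> ~ (q1 = 0 /\ q2 = 0) ->
  exists w1 w2, [/\ ~ (w1 = 0 /\ w2 = 0),
    forall t, 0 <= t -> ~ (p1 = t * w1 /\ p2 = t * w2) &
    forall t, 0 <= t -> ~ (q1 = t * w1 /\ q2 = t * w2)].
Proof.
move=> p0 q0.
have key w1 w2 : ~ (w1 = 0 /\ w2 = 0) -> ~ (exists w1 w2, [/\ ~ (w1 = 0 /\ w2 = 0),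
    forall t, 0 <= t -> ~ (p1 = t * w1 /\ p2 = t * w2) &
    forall t, 0 <= t -> ~ (q1 = t * w1 /\ q2 = t * w2)]) ->
    (exists2 t, 0 <= t & p1 = t * w1 /\ p2 = t * w2) \/
    (exists2 t, 0 <= t & q1 = t * w1 /\ q2 = t * w2).
  move=> w0 h; apply: contrapT => /not_orP[hp hq]; apply: h.
  by exists w1, w2; split=> // t t0 e; [apply: hp|apply: hq]; exists t.
apply: contrapT => h.
have [] := key 1 0 _ h; [lra| |] => -[t t0 [e1 e2]];
have [] := key (-1) 0 _ h; [lra| | |lra| |] => -[t' t'0 [e3 e4]];
have [] := key 0 1 _ h; [lra| | |lra| | |lra| | |lra| |] => -[t'' t''0 [e5 e6]].
all: try (by apply: p0; split; lra).
all: by apply: q0; split; lra.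
Qed.

End CutRays.

(** * Interior and boundary models exclude each other *)

Section Invariance.
Context {R : realType}.

Lemma PL_homeomorphism_inverse m n (A : set 'rV[R]_m) (B : set 'rV[R]_n) f :
  PL_homeomorphism A B f -> exists g, [/\ piecewise_linear A f, piecewise_linear B g,
    (forall y, A y -> B (f y)) /\ (forall z, B z -> A (g z)),
    forall y, A y -> g (f y) = y & forall z, B z -> f (g z) = z].
Proof.
move=> [fPL [fAB [g [gPL gBA fg gf]]]]; exists g; split=> //.
- by move=> y Ay; apply: fg; rewrite inE.
- by move=> z Bz; apply: gf; rewrite inE.
Qed.

(* Near the origin the transition map between the two models sends the cut ray to a
   ray.  A PL plane through two points on different sides of the cut stays connected
   when this ray is removed: go through a point opposite to the ray. *)
Lemma cut_ray_not_common_planes n k l (F : set 'rV[R]_n) (M : set 'rV[R]_k)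
    (N : set 'rV[R]_l) x : F x ->
  modelled_on F M x -> modelled_on F N x -> has_cut_ray M -> ~ has_common_planes N.
Proof.
move=> Fx [U2 [U2F /within_nbhsP[e2 e20 FU2]]].
move=> [f2 /PL_homeomorphism_inverse[g2 [f2PL g2PL [f2M g2U] gf2 fg2]] f20].
move=> [U1 [U1F /within_nbhsP[e1 e10 FU1]]].
move=> [f1 /PL_homeomorphism_inverse[g1 [f1PL g1PL [f1N g1U] gf1 fg1]] f10].
move=> [u [phi [u0 phic uM phi0 phipm]]] planes.
have U1x : U1 x by apply: FU1; rewrite // subrr normr0.
have U2x : U2 x by apply: FU2; rewrite // subrr normr0.
have M0 : M 0 by rewrite -f20; exact: f2M.
have N0 : N 0 by rewrite -f10; exact: f1N.
have g20 : g2 0 = x by rewrite -f20 gf2.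
have g10 : g1 0 = x by rewrite -f10 gf1.
have phi00 : phi 0 = 0 by have := uM 0; rewrite lexx ler01 scale0r => /(_ isT)[].
have nu0 : 0 < `|u| by rewrite normr_gt0.
(* The transition map [f1] after [g2] is a composite of two PL maps, each affine at the beginning of
   a ray; in between, the segment is shortened to stay in [U1]. *)
have [e [v [e0 e1' ray]]] : exists e v, [/\ 0 < e, e <= 1 & forall t : R, 0 <= t <= e ->
    U1 (g2 (t *: u)) /\ f1 (g2 (t *: u)) = t *: v].
  have [|d /andP[d0 d1] [w g2w]] := @piecewise_linear_ray R _ _ M g2 0 u g2PL.
    by move=> t t01; rewrite add0r; exact: (uM t t01).1.
  pose c := Num.min d (e1 / (1 + `|w|) / 2).
  have w1 : 0 < 1 + `|w| by rewrite ltr_pwDl.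
  have c0 : 0 < c by rewrite lt_min d0 !divr_gt0.
  have g2c (t : R) : 0 <= t <= c -> U1 (g2 (t *: u)) /\ g2 (t *: u) = x + t *: w.
    move=> /andP[t0]; rewrite le_min => /andP[td te].
    have gE : g2 (t *: u) = x + t *: w by rewrite -[t *: u]add0r g2w ?g20// t0.
    split=> //; apply: FU1.
      by apply: U2F; apply: g2U; apply: (uM t _).1; rewrite t0 (le_trans td).
    rewrite gE addrAC subrr add0r normrZ ger0_norm//.
    rewrite (@le_lt_trans _ _ (t * (1 + `|w|)))//.
      by rewrite ler_wpM2l// lerDr.
    rewrite -ltr_pdivlMr// (le_lt_trans te)// ltr_pdivrMr// ltr_pMr ?ltr1n//.
    by rewrite divr_gt0.
  have [|d' /andP[d'0 d'1] [v f1v]] := @piecewise_linear_ray R _ _ U1 f1 x (c *: w) f1PL.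
    move=> t /andP[t0 t1]; rewrite scalerA.
    have tc : 0 <= t * c <= c by rewrite mulr_ge0 ?(ltW c0)//= ler_piMl// ltW.
    by have [h <-] := g2c _ tc.
  exists (c * d'), (c^-1 *: v); split=> [||t /andP[t0 tcd]].
  - exact: mulr_gt0.
  - by rewrite mulr_ile1 ?(ltW c0) ?(ltW d'0)// /c ge_min d1.
  - have [|h gE] := g2c t.
      by rewrite t0 (le_trans tcd)// ler_piMr// ltW.
    split=> //; rewrite gE.
    have -> : t *: w = (t / c) *: (c *: w) by rewrite scalerA mulfVK// gt_eqF.
    rewrite f1v; last by rewrite divr_ge0 ?(ltW c0)//= ler_pdivrMr// mulrC.
    by rewrite f10 add0r scalerA.
have psi_inj m m' : M m -> M m' -> U1 (g2 m) -> U1 (g2 m') ->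
    f1 (g2 m) = f1 (g2 m') -> m = m'.
  move=> Mm Mm' Um Um' h; rewrite -(fg2 _ Mm) -(fg2 _ Mm').
  by rewrite -(gf1 _ Um) -(gf1 _ Um') h.
have rayM (t : R) : 0 <= t <= e -> M (t *: u).
  by move=> /andP[t0 te]; apply: (uM t _).1; rewrite t0 (le_trans te).
(* Otherwise the transition map would collapse a segment of the cut ray, against injectivity. *)
have v0 : v != 0.
  apply/eqP => v0; have ee : 0 <= e <= e by rewrite lexx ltW.
  have [Ue fe] := ray e ee.
  have : e *: u = 0.
    apply: psi_inj => //; [exact: rayM|by rewrite g20|].
    by rewrite fe v0 scaler0 g20 f10.
  by move/eqP; rewrite scaler_eq0 (negPf u0) gt_eqF.
have nv0 : 0 < `|v| by rewrite normr_gt0.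
have [d1 d10 d1P] := piecewise_linear_continuous g1PL N0 e20.
have [d2 d20 d2P] := piecewise_linear_continuous f2PL U2x (mulr_gt0 e0 nu0).
have [d3 d30 d3P] := piecewise_linear_continuous g1PL N0 d20.
pose E0 := Num.min d1 d3; have E00 : 0 < E0 by rewrite lt_min d10.
(* The transition map in the opposite direction. Within [E0] of the origin it is defined, and its
   values are too short to reach beyond the controlled segment of the cut ray. *)
pose theta y := f2 (g1 y).
have thetaP y : N y -> `|y| < E0 -> [/\ U2 (g1 y), M (theta y) & `|theta y| < e * `|u|].
  move=> Ny; rewrite lt_min => /andP[yd1 yd3].
  have U2y : U2 (g1 y).
    apply: FU2; first by apply: U1F; exact: g1U.
    by rewrite -g10; apply: d1P; rewrite // subr0.
  split=> //; first exact: f2M.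
  rewrite -[theta y]subr0 -f20; apply: d2P => //.
  by rewrite -g10; apply: d3P; rewrite // subr0.
have theta_ray y (t : R) : N y -> `|y| < E0 -> 0 <= t -> theta y = t *: u ->
    0 <= t <= e /\ y = t *: v.
  move=> Ny yE t0 h; have [U2y My] := thetaP y Ny yE.
  rewrite h normrZ ger0_norm// ltr_pM2r// => te.
  have tte : 0 <= t <= e by rewrite t0 ltW.
  split=> //; rewrite -(ray t tte).2 -h /theta gf2// fg1//.
(* A point of a PL plane with both parameters at most [E] has norm at most twice [E], hence below
   [E0]. The bound [2^-1 / 2] keeps it in [N], and the last bound forces a point of norm below [E]
   on the ray of [v] to have parameter below [e]. *)
pose E := Num.min (E0 / 2 / 2) (Num.min (2^-1 / 2) (e * `|v|)).
have E'0 : 0 < E by rewrite !lt_min !divr_gt0//= mulr_gt0.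
have [d4 d40 d4P] := piecewise_linear_continuous f1PL U1x E'0.
have d4e1 : 0 < Num.min d4 e1 by rewrite lt_min d40.
have [d5 d50 d5P] := piecewise_linear_continuous g2PL M0 d4e1.
have psiP m : M m -> `|m| < d5 ->
    [/\ U1 (g2 m), N (f1 (g2 m)), `|f1 (g2 m)| < E & theta (f1 (g2 m)) = m].
  move=> Mm md; have := d5P m Mm; rewrite subr0 => /(_ md).
  rewrite g20 lt_min => /andP[h4 h1].
  have U1m : U1 (g2 m) by apply: FU1 => //; apply: U2F; exact: g2U.
  split=> //; first exact: f1N.
    by rewrite -[f1 _]subr0 -f10; exact: d4P.
  by rewrite /theta gf1// fg2.
(* If the image of [m] were on the ray of [v], it would be on the segment that comes from the cut
   ray, and by injectivity [m] would be on the cut ray, where [phi] vanishes. *)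
have offray m : M m -> `|m| < d5 -> phi m != 0 -> forall t : R, 0 <= t ->
    f1 (g2 m) <> t *: v.
  move=> Mm md pm t t0 mt; have [U1m Nm mE tm] := psiP m Mm md.
  have te : t <= e.
    rewrite leNgt; apply/negP => et; move: mE; rewrite mt normrZ ger0_norm//.
    rewrite /E !lt_min => /and3P[_ _]; rewrite ltr_pM2r// => te.
    by have := lt_trans et te; rewrite ltxx.
  have tte : 0 <= t <= e by rewrite t0.
  have [Ut ft] := ray t tte.
  have mE' : m = t *: u by apply: psi_inj => //; [exact: rayM|rewrite mt].
  move: pm; rewrite mE' (uM t _).2 ?eqxx//.
  by rewrite t0 (le_trans te).
have [[a [Ma ad pa]] [b [Mb bd pb]]] := phipm d5 d50.
have [_ Na naE tha] := psiP a Ma ad; have [_ Nb nbE thb] := psiP b Mb bd.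
have offa := offray a Ma ad (lt0r_neq0 pa).
have offb := offray b Mb bd (ltr0_neq0 pb).
set na := f1 (g2 a) in Na naE tha offa; set nb := f1 (g2 b) in Nb nbE thb offb.
have [c1 [c2 [c3 [c4]]]] := planes _ _ Na Nb.
move=> [[c1n c2n c3n c4n] inj inN [p1 [p2 [pE p1n p2n]]] [q1 [q2 [qE q1n q2n]]]].
pose gam := pl_plane c1 c2 c3 c4.
have gamZ (t y1 y2 : R) : 0 <= t -> gam (t * y1) (t * y2) = t *: gam y1 y2.
  exact: pl_planeZ.
have gam0 : gam 0 0 = 0 by have := gamZ 0 0 0 (lexx _); rewrite mul0r scale0r.
(* In the parameters of the PL plane, the image of the cut ray is contained in the ray of [w], and
   neither of the two points to be joined is on that ray. If the plane misses the direction [v],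
   then [w] comes from [third_ray]. *)
have [w1 [w2 [w0 wv pw qw]]] : exists w1 w2, [/\ ~ (w1 = 0 /\ w2 = 0),
    forall y1 y2 (t : R), 0 <= t -> gam y1 y2 = t *: v ->
      exists2 s, 0 <= s & y1 = s * w1 /\ y2 = s * w2,
    forall t, 0 <= t -> ~ (p1 = t * w1 /\ p2 = t * w2) &
    forall t, 0 <= t -> ~ (q1 = t * w1 /\ q2 = t * w2)].
  have [[w1 [w2 vE]]|nv] := pselect (exists w1 w2, v = gam w1 w2).
    exists w1, w2; split.
    - by move=> [w10 w20]; move: v0; rewrite vE w10 w20 gam0 eqxx.
    - by move=> y1 y2 t t0; rewrite vE -gamZ// => /inj[-> ->]; exists t.
    - move=> t t0 [e3 e4]; apply: (offa t t0).
      by rewrite pE -/gam e3 e4 gamZ// -vE.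
    - move=> t t0 [e3 e4]; apply: (offb t t0).
      by rewrite qE -/gam e3 e4 gamZ// -vE.
  have p0 : ~ (p1 = 0 /\ p2 = 0).
    move=> [e3 e4]; apply: (offa 0 (lexx _)).
    by rewrite pE -/gam e3 e4 gam0 scale0r.
  have q0 : ~ (q1 = 0 /\ q2 = 0).
    move=> [e3 e4]; apply: (offb 0 (lexx _)).
    by rewrite qE -/gam e3 e4 gam0 scale0r.
  have [w1 [w2 [w0 pw qw]]] := third_ray p0 q0.
  exists w1, w2; split=> // y1 y2 t t0 yE.
  have [t00|tn0] := eqVneq t 0.
    move: yE; rewrite t00 scale0r -gam0 => /inj[-> ->].
    by exists 0 => //; rewrite !mul0r.
  exfalso; apply: nv; exists (t^-1 * y1), (t^-1 * y2).
  by rewrite gamZ ?invr_ge0// yE scalerA mulVf// scale1r.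
have W0 : 0 < `|w1| + `|w2| + 1 by rewrite ltr_wpDl// addr_ge0.
(* The detour passes through [- eta * w], opposite to the forbidden ray; [eta] keeps both parameters
   of this point within [E]. *)
pose eta := E / (`|w1| + `|w2| + 1).
have eta0 : 0 < eta by rewrite divr_gt0.
have etaE i : `|i| <= `|w1| + `|w2| -> `|- eta * i| <= E.
  move=> iw; rewrite normrM normrN (gtr0_norm eta0) mulrAC ler_pdivrMr//.
  by rewrite ler_pM2l// (le_trans iw)// lerDl.
have z1E : `|- eta * w1| <= E by apply: etaE; rewrite lerDl.
have z2E : `|- eta * w2| <= E by apply: etaE; rewrite lerDr.
(* On the parameter segment from [r] to the opposite point, [phi] after [theta] has no zero. The
   factor [sg] serves to apply this to both signs, which then clash at the opposite point. *)
have key (sg r1 r2 : R) : `|r1| <= E -> `|r2| <= E ->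
    (forall t, 0 <= t -> ~ (r1 = t * w1 /\ r2 = t * w2)) ->
    0 < sg * phi (theta (gam r1 r2)) ->
    0 < sg * phi (theta (gam (- eta * w1) (- eta * w2))).
  move=> r1E r2E roff pos.
  pose y1 t := (1 - t) * r1 + t * (- eta * w1).
  pose y2 t := (1 - t) * r2 + t * (- eta * w2).
  pose h t := sg * phi (theta (gam (y1 t) (y2 t))).
  suff : 0 < h 1 by rewrite /h /y1 /y2 subrr !mul0r !add0r !mul1r.
  have conv (t i j : R) : 0 <= t <= 1 -> `|i| <= E -> `|j| <= E ->
      `|(1 - t) * i + t * j| <= E.
    move=> /andP[t0 t1] iE jE; rewrite (le_trans (ler_normD _ _))// !normrM.
    rewrite (ger0_norm t0) ger0_norm ?subr_ge0//.
    rewrite (@le_trans _ _ ((1 - t) * E + t * E))//.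
      by rewrite lerD// ler_wpM2l// subr_ge0.
    by rewrite -mulrDl subrK mul1r.
  have yN t : 0 <= t <= 1 -> N (gam (y1 t) (y2 t)) /\ `|gam (y1 t) (y2 t)| < E0.
    move=> t01.
    have y1E : `|y1 t| <= E by exact: conv.
    have y2E : `|y2 t| <= E by exact: conv.
    have E12 : E < 2^-1.
      rewrite (@le_lt_trans _ _ (2^-1 / 2))//; first by rewrite !ge_min lexx orbT.
      by rewrite ltr_pdivrMr// ltr_pMr ?ltr1n// invr_gt0.
    split; first by apply: inN; exact: le_lt_trans E12.
    rewrite (le_lt_trans (pl_plane_norm _ _ _ _ _ _))//.
    rewrite (@le_lt_trans _ _ (E + E))// ?lerD//.
    rewrite (@le_lt_trans _ _ (E0 / 2))//.
      by rewrite [leRHS]splitr lerD// !ge_min lexx.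
    by rewrite ltr_pdivrMr// ltr_pMr ?ltr1n.
  apply: no_sign_change; last by rewrite /h /y1 /y2 subr0 !mul1r !mul0r !addr0.
    move=> t eps t01 eps0; have [Nt tE0] := yN t t01.
    have [U2t Mt _] := thetaP _ Nt tE0.
    have sg0 : 0 < `|sg| + 1 by rewrite ltr_wpDl.
    have : nbhs (theta (gam (y1 t) (y2 t)))
        (phi @^-1` ball (phi (theta (gam (y1 t) (y2 t)))) (eps / (`|sg| + 1))).
      by apply: phic; apply: nbhsx_ballx; rewrite divr_gt0.
    move=> /nbhs_ballP[d6 /= d60 d6P].
    have [d7 d70 d7P] := piecewise_linear_continuous f2PL U2t d60.
    have [d8 d80 d8P] := piecewise_linear_continuous g1PL Nt d70.
    have E8 : 0 < (E *+ 2 + E *+ 2) *+ 2.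
      by rewrite pmulrn_rgt0// addr_gt0// pmulrn_rgt0.
    exists (d8 / ((E *+ 2 + E *+ 2) *+ 2)); first exact: divr_gt0.
    move=> t' t'01 tt'; have [Nt' t'E0] := yN t' t'01.
    have [U2t' Mt' _] := thetaP _ Nt' t'E0.
    have step : `|gam (y1 t') (y2 t') - gam (y1 t) (y2 t)| < d8.
      rewrite (le_lt_trans (pl_plane_lip _ _ _ _ _ _ _ _))//.
      rewrite (@le_lt_trans _ _ (`|t' - t| * ((E *+ 2 + E *+ 2) *+ 2)))//; last first.
        by rewrite -ltr_pdivlMr.
      rewrite mulrnAr ler_wMn2r// mulrDr lerD//.
        have -> : y1 t' - y1 t = (t' - t) * (- eta * w1 - r1) by rewrite /y1; ring.
        rewrite normrM ler_wpM2l// mulr2n (le_trans (ler_normB _ _))// lerD//.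
      have -> : y2 t' - y2 t = (t' - t) * (- eta * w2 - r2) by rewrite /y2; ring.
      by rewrite normrM ler_wpM2l// mulr2n (le_trans (ler_normB _ _))// lerD.
    have := d6P (theta (gam (y1 t') (y2 t'))).
    rewrite -!ball_normE/= !(distrC _ (_ (gam (y1 t') (y2 t')))) => h6.
    rewrite /h -mulrBr normrM (@le_lt_trans _ _ (`|phi (theta (gam (y1 t') (y2 t'))) -
       phi (theta (gam (y1 t) (y2 t)))| * (`|sg| + 1)))//.
      by rewrite mulrC ler_wpM2l// lerDl.
    rewrite -ltr_pdivlMr// distrC; apply: h6; apply: d7P => //.
    exact: d8P.
  move=> t t01; have [Nt tE0] := yN t t01.
  have [U2t Mt _] := thetaP _ Nt tE0.
  have sgn0 : sg != 0 by apply: contraTneq pos => ->; rewrite mul0r ltxx.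
  rewrite mulf_neq0//; apply/eqP => /(phi0 _ Mt)[tau tau0 /(theta_ray _ _ Nt tE0 tau0)[_]].
  move=> /(wv _ _ _ tau0)[s s0 [y1s y2s]].
  (* A hit at the end of the segment gives [(s + eta) * w = 0], so w is zero. A hit before the end
     makes the starting point a nonnegative multiple of [w]. *)
  have [t1|tn1] := eqVneq t 1.
    apply: w0; move: y1s y2s; rewrite /y1 /y2 t1 subrr !mul0r !add0r !mul1r => y1s y2s.
    have se : s + eta != 0 by rewrite gt_eqF// ltr_wpDl.
    split; apply: (mulfI se); rewrite mulr0 mulrDl -?y1s -?y2s mulNr addrC subrr//.
  have t1 : 0 < 1 - t by rewrite subr_gt0 lt_neqAle tn1; case/andP: t01.
  have t0 : 0 <= t by case/andP: t01.
  apply: (roff ((s + t * eta) / (1 - t))).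
    by rewrite divr_ge0// ?(ltW t1)// addr_ge0// mulr_ge0// ltW.
  have t1n : 1 - t != 0 by rewrite gt_eqF.
  split; apply: (mulfI t1n).
    rewrite (_ : _ * (_ / _ * _) = s * w1 + t * eta * w1); last by field.
    by rewrite -y1s /y1; ring.
  rewrite (_ : _ * (_ / _ * _) = s * w2 + t * eta * w2); last by field.
  by rewrite -y2s /y2; ring.
have nE (y : 'rV[R]_l) (i : R) : `|y| < E -> `|i| <= `|y| -> `|i| <= E.
  by move=> yE iy; rewrite (le_trans iy)// ltW.
have := key 1 p1 p2 (nE _ _ naE p1n) (nE _ _ naE p2n) pw.
have := key (-1) q1 q2 (nE _ _ nbE q1n) (nE _ _ nbE q2n) qw.
rewrite /gam -pE -qE tha thb => /(_ _)/wrap[|hb /(_ _)/wrap[|ha]].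
- by rewrite mulN1r oppr_gt0.
- by rewrite mul1r.
by move: ha hb; rewrite mul1r mulN1r oppr_gt0 => ha /(lt_trans ha); rewrite ltxx.
Qed.
End Invariance.

(** * Cut rays in the boundary models *)

Section Models.
Context {R : realType}.

Lemma lipschitz_continuous n (phi : 'rV[R]_n -> R) (K : R) :
  (forall x y, `|phi x - phi y| <= K * `|x - y|) -> continuous phi.
Proof.
move=> phiK x A /nbhs_ballP[e /= e0 eA].
have K0 : 0 < `|K| + 1 by rewrite ltr_wpDl.
apply/nbhs_ballP; exists (e / (`|K| + 1)) => /=; first exact: divr_gt0.
move=> y; rewrite -ball_normE/= => xy; apply: eA; rewrite -ball_normE/=.
rewrite (le_lt_trans (phiK _ _))// (@le_lt_trans _ _ ((`|K| + 1) * `|x - y|))//.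
  by rewrite ler_wpM2r// (le_trans (ler_norm K))// lerDl.
by rewrite mulrC -ltr_pdivlMr.
Qed.

Lemma norm_row_mx_lt m n (x : 'rV[R]_m) (y : 'rV[R]_n) (e : R) : 0 < e ->
  (`|row_mx x y| < e) = (`|x| < e) && (`|y| < e).
Proof.
move=> e0; apply/idP/andP => [h|[xe ye]].
  split; apply: rV_norm_lt => // j; apply: le_lt_trans h.
    by rewrite -(row_mxEl x y) rV_coord_le.
  by rewrite -(row_mxEr x y) rV_coord_le.
apply: rV_norm_lt => // j; case: (split_ordP j) => i ->.
  by rewrite row_mxEl (le_lt_trans (rV_coord_le _ _)).
by rewrite row_mxEr (le_lt_trans (rV_coord_le _ _)).
Qed.

Lemma norm_rV1_lt (x : 'rV[R]_1) (e : R) : 0 < e -> (`|x| < e) = (`|x 0 0| < e).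
Proof.
move=> e0; apply/idP/idP => [|xe]; first exact: le_lt_trans (rV_coord_le _ _).
by apply: rV_norm_lt => // j; rewrite ord1.
Qed.

Lemma norm_delta n (i : 'I_n) : `|delta_mx 0 i : 'rV[R]_n| <= 1.
Proof. by apply: rV_norm_le => // j; rewrite mxE; case: (_ && _); rewrite ?normr1 ?normr0. Qed.

Lemma norm_rV1_cst (a : R) : `|const_mx a : 'rV[R]_1| <= `|a|.
Proof. by apply: rV_norm_le => // j; rewrite mxE. Qed.

Lemma norm_row_mx_le m n (x : 'rV[R]_m) (y : 'rV[R]_n) (e : R) : 0 <= e ->
  `|x| <= e -> `|y| <= e -> `|row_mx x y| <= e.
Proof.
move=> e0 xe ye; apply: rV_norm_le => // j; case: (split_ordP j) => i ->.
  by rewrite row_mxEl (le_trans (rV_coord_le _ _)).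
by rewrite row_mxEr (le_trans (rV_coord_le _ _)).
Qed.

Lemma small_radius (d : R) : 0 < d -> exists2 e : R, 0 < e & e < 1 /\ e < d.
Proof.
move=> d0; exists (Num.min 1 d / 2); first by rewrite divr_gt0// lt_min ltr01.
suff : Num.min 1 d / 2 < Num.min 1 d by rewrite lt_min => /andP.
by rewrite ltr_pdivrMr// ltr_pMr ?ltr1n// lt_min ltr01.
Qed.

(** The cut ray is the inner normal, with the coordinate along the boundary changing sign across it.
    The factor [2^-1] keeps the ray in the half-open model up to parameter 1. *)
Lemma half_disk_has_cut_ray : has_cut_ray (@half_disk R).
Proof.
exists (row_mx 0 (const_mx 2^-1)), (fun x : 'rV[R]_(1 + 1) => x 0 (lshift 1 0)); split.
- apply/eqP => /rowP/(_ (rshift 1 0)); rewrite row_mxEr !mxE => h; lra.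
- exact: coord_continuous.
- move=> t /andP[t0 t1]; rewrite scale_row_mx row_mxEl; split; last by rewrite !mxE mulr0.
  split=> /=; rewrite ?row_mxKl ?row_mxKr /open_segment /half_open_segment/= !mxE; lra.
- move=> m [_ /= /andP[m0 m1]] m00; exists (2 * (rsubmx m) 0 0); first by rewrite mulr_ge0.
  rewrite -[LHS]hsubmxK scale_row_mx; congr row_mx; apply/rowP => i; rewrite ord1 !mxE ?m00 ?mulr0//.
  by field.
- move=> d /small_radius[e e0 [e1 ed]]; split.
    exists (row_mx (const_mx e) 0); split.
    + split; rewrite ?row_mxKl ?row_mxKr /open_segment /half_open_segment/= !mxE; lra.
    + rewrite norm_row_mx_lt ?(lt_trans e0)// normr0 (lt_trans e0)// andbT.
      by rewrite (le_lt_trans (norm_rV1_cst _))// gtr0_norm.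
    + by rewrite row_mxEl mxE.
  exists (row_mx (const_mx (- e)) 0); split.
  + split; rewrite ?row_mxKl ?row_mxKr /open_segment /half_open_segment/= !mxE; lra.
  + rewrite norm_row_mx_lt ?(lt_trans e0)// normr0 (lt_trans e0)// andbT.
    by rewrite (le_lt_trans (norm_rV1_cst _))// normrN gtr0_norm.
  + by rewrite row_mxEl mxE oppr_lt0.
Qed.

Lemma YP (x : 'rV[R]_3) : Y x <-> exists i t, 0 <= t < 1 /\ x = t *: delta_mx 0 i.
Proof.
split=> [[t [_ [t01 [i _ <-] ->]]]|[i [t [t01 ->]]]]; first by exists i, t.
by exists t, (delta_mx 0 i); split=> //; exists i.
Qed.

(** The cut ray is the axis over the center of the tripod. As at most one leg coordinate is nonzero,
    [phi] vanishes only there; it is positive over one leg and negative over the other two. *)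
Lemma Y_half_has_cut_ray : has_cut_ray (@Y_times_half_open R).
Proof.
pose o (i : 'I_3) := lshift 1 i.
pose phi (x : 'rV[R]_(3 + 1)) := x 0 (o 0) - x 0 (o 1) - x 0 (o 2).
have Mdelta (i : 'I_3) (e : R) : 0 <= e < 1 ->
    Y_times_half_open (row_mx (e *: delta_mx 0 i) 0).
  move=> e01; split; rewrite ?row_mxKl ?row_mxKr; first by apply/YP; exists i, e.
  by rewrite /half_open_segment/= mxE lexx ltr01.
have nrm (i : 'I_3) (e d : R) : 0 < e -> e < d ->
    `|row_mx (e *: delta_mx 0 i : 'rV[R]_3) (0 : 'rV[R]_1)| < d.
  move=> e0 ed; rewrite norm_row_mx_lt ?(lt_trans e0)// normr0 (lt_trans e0)// andbT.
  rewrite normrZ gtr0_norm// (le_lt_trans _ ed)// ler_piMr// ?norm_delta//.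
  exact: ltW.
exists (row_mx 0 (const_mx 2^-1)), phi; split.
- apply/eqP => /rowP/(_ (rshift 3 0)); rewrite row_mxEr !mxE => h; lra.
- apply: (@lipschitz_continuous _ _ 3) => x y.
  have := rV_coord_le (x - y) (o 0); have := rV_coord_le (x - y) (o 1).
  have := rV_coord_le (x - y) (o 2); rewrite !mxE /phi.
  set N := `|x - y|; rewrite !ler_norml => /andP[? ?] /andP[? ?] /andP[? ?].
  by apply/andP; split; lra.
- move=> t /andP[t0 t1]; rewrite scale_row_mx scaler0 /phi; split; last first.
    by rewrite !row_mxEl !mxE !subr0.
  split; rewrite ?row_mxKl ?row_mxKr.
    by apply/YP; exists 0, 0; rewrite scale0r lexx ltr01.
  by rewrite /half_open_segment/= !mxE; lra.
- move=> m [/YP[i [t [/andP[t0 t1] ml]]] /andP[m0 m1]] phim.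
  exists (2 * (rsubmx m) 0 0); first by rewrite mulr_ge0.
  have t00 : t = 0.
    move: phim; have oE j : m 0 (o j) = t * (i == j)%:R.
      by rewrite -[m]hsubmxK row_mxEl ml !mxE/= eq_sym.
    rewrite /phi !oE; case: i {ml oE} => [[|[|[|//]]] ?]/=; lra.
  rewrite -[LHS]hsubmxK scale_row_mx ml t00 scale0r scaler0; congr row_mx.
  by apply/rowP => j; rewrite ord1 !mxE; field.
- move=> d /small_radius[e e0 [e1 ed]]; split.
    exists (row_mx (e *: delta_mx 0 0) 0); split; [|exact: nrm|].
      by apply: Mdelta; rewrite ltW.
    by rewrite /phi !row_mxEl !mxE/=; lra.
  exists (row_mx (e *: delta_mx 0 1) 0); split; [|exact: nrm|].
    by apply: Mdelta; rewrite ltW.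
  by rewrite /phi !row_mxEl !mxE/=; lra.
Qed.

(** The cut ray is the radius along which the quarter-plane is attached. Off this radius, [phi] is
    positive on the quarter-plane and negative on the disk: there, it is minus a function that
    vanishes on the radius only. *)
Lemma disk_with_quarter_plane_has_cut_ray : has_cut_ray (@disk_with_quarter_plane R).
Proof.
pose xa (x : 'rV[R]_(1 + 1 + 1)) := x 0 (lshift 1 (lshift 1 0)).
pose xb (x : 'rV[R]_(1 + 1 + 1)) := x 0 (lshift 1 (rshift 1 0)).
pose xc (x : 'rV[R]_(1 + 1 + 1)) := x 0 (rshift (1 + 1) 0).
pose phi x := xc x - `|xb x| - Num.max (- xa x) 0.
pose pt a b c : 'rV[R]_(1 + 1 + 1) := row_mx (row_mx (const_mx a) (const_mx b)) (const_mx c).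
have ptE x : x = pt (xa x) (xb x) (xc x).
  rewrite /pt -[LHS]hsubmxK -[lsubmx x]hsubmxK; congr (row_mx (row_mx _ _) _);
  by apply/rowP => i; rewrite ord1 !mxE.
have Mpt a b c : disk_with_quarter_plane (pt a b c) <->
   [/\ -1 < a < 1, -1 < b < 1 & c = 0] \/ [/\ 0 <= a < 1, b = 0 & 0 <= c < 1].
  rewrite /disk_with_quarter_plane /prod_set /open_disk /prod_set /origin.
  rewrite /open_segment /half_open_segment /= !row_mxKl !row_mxKr !mxE.
  split=> [[[[? ?] /rowP/(_ 0) c0]|[[? /rowP/(_ 0) b0] ?]]|[[? ? ->]|[? -> ?]]].
  - by left; move: c0; rewrite !mxE.
  - by right; move: b0; rewrite !mxE.
  - by left; split=> //; apply/rowP => i; rewrite !mxE.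
  - by right; split=> //; split=> //; apply/rowP => i; rewrite !mxE.
have pta a b c : xa (pt a b c) = a by rewrite /xa !row_mxEl mxE.
have ptb a b c : xb (pt a b c) = b by rewrite /xb row_mxEl row_mxEr mxE.
have ptc a b c : xc (pt a b c) = c by rewrite /xc row_mxEr mxE.
have nrm a c (d : R) : 0 < d -> `|a| < d -> `|c| < d -> `|pt a 0 c| < d.
  move=> d0 ad cd; rewrite /pt !norm_row_mx_lt// !norm_rV1_lt// !mxE normr0.
  by rewrite ad d0 cd.
exists (pt 2^-1 0 0), phi; split.
- by apply/eqP => /(congr1 xa); rewrite pta /xa mxE => h; lra.
- apply: (@lipschitz_continuous _ _ 3) => x y.
  have ha := rV_coord_le (x - y) (lshift 1 (lshift 1 0)).
  have hb := rV_coord_le (x - y) (lshift 1 (rshift 1 0)).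
  have hc := rV_coord_le (x - y) (rshift (1 + 1) 0).
  rewrite !mxE -!/(xa _) in ha; rewrite !mxE -!/(xb _) in hb.
  rewrite !mxE -!/(xc _) in hc.
  have {}ha : `|Num.max (- xa x) 0 - Num.max (- xa y) 0| <= `|x - y|.
    by rewrite (le_trans (max0_lip _ _))// -opprD normrN.
  have {}hb := le_trans (ler_dist_dist _ _) hb.
  move: ha hb hc; rewrite /phi; set N := `|x - y|; rewrite !ler_norml.
  move=> /andP[? ?] /andP[? ?] /andP[? ?].
  by apply/andP; split; lra.
- move=> t /andP[t0 t1].
  have -> : t *: pt 2^-1 0 0 = pt (t / 2) 0 0.
    by rewrite /pt !scale_row_mx; congr (row_mx (row_mx _ _) _); apply/rowP => i; rewrite !mxE ?mulr0.
  split; first by apply/Mpt; left; split; lra.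
  rewrite /phi pta ptb ptc normr0 max_r ?subrr//.
  by rewrite oppr_le0 divr_ge0.
- move=> m; rewrite (ptE m) => /Mpt; rewrite /phi pta ptb ptc.
  move: (xa m) (xb m) (xc m) => a b c [[a1 b1 ->]|[/andP[a0 a1] -> c1]].
    rewrite sub0r => h; exists (2 * a).
      move: h (normr_ge0 b); case: (leP (- a) 0) => h1 h2 h3; lra.
    have -> : b = 0.
      apply/eqP; rewrite -normr_eq0; apply/eqP.
      move: h (normr_ge0 b); case: (leP (- a) 0) => h1 h2 h3; lra.
    rewrite /pt !scale_row_mx; congr (row_mx (row_mx _ _) _); apply/rowP => i; rewrite !mxE ?mulr0//.
    by field.
  rewrite normr0 subr0 max_r ?oppr_le0// subr0 => ->; exists (2 * a); first lra.
  rewrite /pt !scale_row_mx; congr (row_mx (row_mx _ _) _); apply/rowP => i; rewrite !mxE ?mulr0//.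
  by field.
- move=> d /small_radius[e e0 [e1 ed]]; have d0 := lt_trans e0 ed; split.
    exists (pt 0 0 e); split.
    + by apply/Mpt; right; split; lra.
    + by apply: nrm => //; rewrite ?normr0// gtr0_norm.
    + by rewrite /phi pta ptb ptc normr0 oppr0 maxxx; lra.
  exists (pt (- e) 0 0); split.
  + by apply/Mpt; left; split; lra.
  + by apply: nrm => //; rewrite ?normr0// normrN gtr0_norm.
  + by rewrite /phi pta ptb ptc normr0 opprK max_l ?(ltW e0)//; lra.
Qed.

End Models.

(** * Common planes in the interior models *)

Section InteriorModels.
Context {R : realType}.

Lemma max0_inj (x y : R) :
  Num.max x 0 = Num.max y 0 -> Num.max (- x) 0 = Num.max (- y) 0 -> x = y.
Proof.
by case: (leP x 0); case: (leP y 0); case: (leP (- x) 0); case: (leP (- y) 0) => *; lra.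
Qed.

Lemma pl_plane_opp n (c : 'rV[R]_n) (y : R) :
  Num.max y 0 *: c + Num.max (- y) 0 *: (- c) = y *: c.
Proof.
rewrite scalerN -scalerBl; congr (_ *: _).
by case: (leP y 0); case: (leP (- y) 0) => *; lra.
Qed.

Lemma open_diskP (x : 'rV[R]_(1 + 1)) : open_disk x <-> `|x| < 1.
Proof.
rewrite -{2}[x]hsubmxK norm_row_mx_lt// !norm_rV1_lt// !ltr_norml.
by split=> [[? ?]|/andP[? ?]] //; apply/andP.
Qed.

Lemma open_disk_has_common_planes : has_common_planes (@open_disk R).
Proof.
move=> n n' Nn Nn'.
pose c1 : 'rV[R]_(1 + 1) := row_mx (const_mx 1) 0.
pose c2 : 'rV[R]_(1 + 1) := row_mx 0 (const_mx 1).
have gE x y : pl_plane c1 (- c1) c2 (- c2) x y = row_mx (const_mx x) (const_mx y).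
  rewrite /pl_plane !pl_plane_opp !scale_row_mx add_row_mx !scaler0 addr0 add0r.
  by congr row_mx; apply/rowP => i; rewrite !mxE mulr1.
have c11 : `|c1| <= 1.
  by apply: norm_row_mx_le; rewrite ?normr0// (le_trans (norm_rV1_cst _))// normr1.
have c21 : `|c2| <= 1.
  by apply: norm_row_mx_le; rewrite ?normr0// (le_trans (norm_rV1_cst _))// normr1.
have pt (m : 'rV[R]_(1 + 1)) : exists x y,
    [/\ m = pl_plane c1 (- c1) c2 (- c2) x y, `|x| <= `|m| & `|y| <= `|m|].
  exists (m 0 (lshift 1 0)), (m 0 (rshift 1 0)); split; rewrite ?rV_coord_le//.
  by rewrite gE -[LHS]hsubmxK; congr row_mx; apply/rowP => i; rewrite ord1 !mxE.
exists c1, (- c1), c2, (- c2); split=> //; first by rewrite !normrN.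
  move=> x y x' y'; rewrite !gE => /eq_row_mx[/rowP/(_ 0) h /rowP/(_ 0) h'].
  by move: h h'; rewrite !mxE.
move=> x y xh yh; apply/open_diskP; rewrite gE norm_row_mx_lt// !norm_rV1_lt// !mxE.
by rewrite (lt_trans xh) ?(lt_trans yh)// invf_lt1// ltr1n.
Qed.

Lemma Y_times_openP (x : 'rV[R]_(3 + 1)) : Y_times_open x <->
  `|x| < 1 /\ exists i t, 0 <= t /\ lsubmx x = t *: delta_mx 0 i.
Proof.
rewrite -{2}[x]hsubmxK norm_row_mx_lt// norm_rV1_lt// ltr_norml.
split=> [[/YP[i [t [/andP[t0 t1] xl]]] xr]|[/andP[xl1 xr] [i [t [t0 xl]]]]].
  split; last by exists i, t.
  rewrite -/(is_true _) xr andbT xl normrZ ger0_norm// (le_lt_trans _ t1)//.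
  by rewrite ler_piMr// norm_delta.
split=> //; apply/YP; exists i, t; split=> //; rewrite t0/=.
have := le_lt_trans (rV_coord_le _ i) xl1.
by rewrite xl !mxE !eqxx mulr1 ger0_norm.
Qed.

(** Two legs of the tripod times the interval form a plane; when both points lie over the same leg,
    any second leg completes it. *)
Lemma Y_times_open_has_common_planes : has_common_planes (@Y_times_open R).
Proof.
move=> n n' /Y_times_openP[n1 [i [t [t0 nl]]]] /Y_times_openP[n'1 [j [t' [t'0 n'l]]]].
have [j' [ij' n'j']] : exists j', i != j' /\ (j = i \/ j = j').
  have [->|ij] := eqVneq i j; last by exists j; split=> //; right.
  have [j' jj'] : exists j', j != j'.
    by case: j {n'l} => [[|m] h]; [exists 1|exists 0].
  by exists j'; split=> //; left.
pose c1 : 'rV[R]_(3 + 1) := row_mx (delta_mx 0 i) 0.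
pose c2 : 'rV[R]_(3 + 1) := row_mx (delta_mx 0 j') 0.
pose c3 : 'rV[R]_(3 + 1) := row_mx 0 (const_mx 1).
have gE x y : pl_plane c1 c2 c3 (- c3) x y =
    row_mx (Num.max x 0 *: delta_mx 0 i + Num.max (- x) 0 *: delta_mx 0 j') (const_mx y).
  rewrite /pl_plane pl_plane_opp !scale_row_mx !add_row_mx !scaler0 !addr0 add0r.
  by congr row_mx; apply/rowP => l; rewrite !mxE mulr1.
have c11 : `|c1| <= 1 by apply: norm_row_mx_le; rewrite ?normr0 ?norm_delta.
have c21 : `|c2| <= 1 by apply: norm_row_mx_le; rewrite ?normr0 ?norm_delta.
have c31 : `|c3| <= 1.
  by apply: norm_row_mx_le; rewrite ?normr0// (le_trans (norm_rV1_cst _))// normr1.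
have rE (m : 'rV[R]_(3 + 1)) : rsubmx m = const_mx (m 0 (rshift 3 0)).
  by apply/rowP => l; rewrite ord1 !mxE.
have le_t (m : 'rV[R]_(3 + 1)) l (r : R) : 0 <= r -> lsubmx m = r *: delta_mx 0 l ->
    `|r| <= `|m|.
  move=> r0 ml; have := rV_coord_le m (lshift 1 l); rewrite -{1}[m]hsubmxK row_mxEl ml.
  by rewrite !mxE !eqxx mulr1.
have pti (m : 'rV[R]_(3 + 1)) (r : R) : 0 <= r -> lsubmx m = r *: delta_mx 0 i -> exists x y,
    [/\ m = pl_plane c1 c2 c3 (- c3) x y, `|x| <= `|m| & `|y| <= `|m|].
  move=> r0 ml; exists r, (m 0 (rshift 3 0)); split; rewrite ?rV_coord_le ?(le_t m i)//.
  rewrite gE max_l// max_r ?oppr_le0// scale0r addr0.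
  by rewrite -[LHS]hsubmxK ml rE.
have ptj (m : 'rV[R]_(3 + 1)) (r : R) : 0 <= r -> lsubmx m = r *: delta_mx 0 j' -> exists x y,
    [/\ m = pl_plane c1 c2 c3 (- c3) x y, `|x| <= `|m| & `|y| <= `|m|].
  move=> r0 ml; exists (- r), (m 0 (rshift 3 0)); split; rewrite ?rV_coord_le ?normrN ?(le_t m j')//.
  rewrite gE opprK max_r ?oppr_le0// max_l// scale0r add0r.
  by rewrite -[LHS]hsubmxK ml rE.
exists c1, c2, c3, (- c3); split.
- by rewrite normrN.
- move=> x y x' y'; rewrite !gE => /eq_row_mx[h /rowP/(_ 0)]; rewrite !mxE => ->.
  split=> //; apply: max0_inj.
    by move/rowP/(_ i): h; rewrite !mxE !eqxx (negPf ij') !mulr1 !mulr0 !addr0.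
  by move/rowP/(_ j'): h; rewrite !mxE !eqxx eq_sym (negPf ij') !mulr1 !mulr0 !add0r.
- move=> x y xh yh; apply/Y_times_openP; split.
    rewrite (le_lt_trans (pl_plane_norm _ _ _ _ _ _))// ?normrN//.
    by rewrite [ltRHS]splitr !div1r ltrD.
  rewrite gE row_mxKl; have [x0|x0] := leP x 0.
    exists j', (Num.max (- x) 0); rewrite scale0r add0r; split=> //.
    by rewrite le_max lexx orbT.
  exists i, x; rewrite max_r ?oppr_le0 ?(ltW x0)// scale0r addr0; split=> //.
- exact: pti nl.
- by case: n'j' n'l => ->; [exact: pti|exact: ptj].
Qed.

(** The edges of the standard simplex lie in the hyperplane where the coordinates sum to 1, so it is
    the l1 norm that bounds the open cone. *)
Lemma cone_tetrahedronP (x : 'rV[R]_4) : cone_tetrahedron x <->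
  \sum_i `|x 0 i| < 1 /\ exists i j a b,
    [/\ i != j, 0 <= a, 0 <= b & x = a *: delta_mx 0 i + b *: delta_mx 0 j].
Proof.
have sumE i j (a b : R) : i != j -> 0 <= a -> 0 <= b ->
    \sum_l `|(a *: delta_mx 0 i + b *: delta_mx 0 j : 'rV[R]_4) 0 l| = a + b.
  move=> ij a0 b0.
  rewrite (bigD1 i)//= (bigD1 j) 1?eq_sym//= big1 => [|l /andP[li lj]].
    rewrite !mxE !eqxx (negPf ij) eq_sym (negPf ij) !mulr1 !mulr0 !addr0 add0r.
    by rewrite !ger0_norm.
  by rewrite !mxE (negPf li) (negPf lj) !andbF !mulr0 addr0 normr0.
split=> [[t [_ [/andP[t0 t1] [i [j [s [/andP[s0 s1] ->]]]] ->]]]|].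
  have s0' : 0 <= 1 - s by rewrite subr_ge0.
  have [<-|ij] := eqVneq i j.
    have [j' ij'] : exists j', i != j'.
      by case: i => [[|m] h]; [exists 1|exists 0].
    have -> : t *: ((1 - s) *: delta_mx 0 i + s *: delta_mx 0 i) =
        t *: delta_mx 0 i + 0 *: delta_mx 0 j' :> 'rV[R]_4.
      by rewrite -scalerDl subrK scale1r scale0r addr0.
    by rewrite sumE// addr0; split=> //; exists i, j', t, 0.
  rewrite scalerDr !scalerA sumE ?mulr_ge0//; split.
    by rewrite -mulrDr subrK mulr1.
  by exists i, j, (t * (1 - s)), (t * s); rewrite !mulr_ge0.
move=> [+ [i [j [a [b [ij a0 b0 xE]]]]]]; rewrite xE sumE// => ab1.
have ab0 : 0 <= a + b by rewrite addr_ge0.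
have [ab|abn] := eqVneq (a + b) 0.
  exists 0, (delta_mx 0 i); split; rewrite ?lexx ?ltr01//.
    exists i, i, 0; rewrite lexx ler01; split=> //.
    by rewrite subr0 scale1r scale0r addr0.
  have -> : a = 0 by lra.
  have -> : b = 0 by lra.
  by rewrite !scale0r addr0.
exists (a + b), ((1 - b / (a + b)) *: delta_mx 0 i + (b / (a + b)) *: delta_mx 0 j); split.
- by rewrite ab0.
- exists i, j, (b / (a + b)); split=> //; rewrite divr_ge0//=.
  by rewrite ler_pdivrMr ?lt_neqAle ?abn 1?eq_sym ?abn ?ab0// mul1r lerDr.
- by rewrite scalerDr !scalerA; congr (_ *: _ + _ *: _); field.
Qed.

(** The edge ij joins the two sides of the bipartition {a, b}, {c, d}. In [pl_plane] these sides are
    the pairs of opposite half-axes, so the crossing edges are the quadrants. *)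
Definition crossing (a b c d i j : 'I_4) :=
  ((i \in [:: a; b]) && (j \in [:: c; d])) || ((j \in [:: a; b]) && (i \in [:: c; d])).

(* Two edges of K4 lie on a common 4-cycle a, c, b, d. *)
Lemma two_edges_in_4cycle (i j k l : 'I_4) : i != j -> k != l ->
  exists a b c d, [/\ uniq [:: a; b; c; d], crossing a b c d i j & crossing a b c d k l].
Proof.
pose o0 : 'I_4 := @Ordinal 4 0 isT; pose o1 : 'I_4 := @Ordinal 4 1 isT.
pose o2 : 'I_4 := @Ordinal 4 2 isT; pose o3 : 'I_4 := @Ordinal 4 3 isT.
case: i => [[|[|[|[|//]]]] ?]; case: j => [[|[|[|[|//]]]] ?] //;
case: k => [[|[|[|[|//]]]] ?]; case: l => [[|[|[|[|//]]]] ?] //= _ _;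
(* A 4-cycle of K4 omits a perfect matching, and two edges lie in at most two of the three
   matchings. *)
first [ by exists o0, o1, o2, o3 | by exists o0, o2, o1, o3 | by exists o0, o3, o1, o2 ].
Qed.

Lemma cone_tetrahedron_has_common_planes : has_common_planes (@cone_tetrahedron R).
Proof.
move=> n n' /cone_tetrahedronP[n1 [i [j [a1 [b1 [ij a10 b10 nE]]]]]].
move=> /cone_tetrahedronP[n'1 [k [l [a2 [b2 [kl a20 b20 n'E]]]]]].
have [a [b [c [d [un cij ckl]]]]] := two_edges_in_4cycle ij kl.
have maxp (r : R) : 0 <= r -> Num.max r 0 = r by move=> ?; rewrite max_l.
have maxn (r : R) : 0 <= r -> Num.max (- r) 0 = 0.
  by move=> ?; rewrite max_r// oppr_le0.
move: un; rewrite /= !inE !negb_or => /and4P[/and3P[ab ac ad] /andP[bc bd] cd _].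
pose D i : 'rV[R]_4 := delta_mx 0 i.
pose g := pl_plane (D a) (D b) (D c) (D d).
have gE x y : [/\ g x y 0 a = Num.max x 0, g x y 0 b = Num.max (- x) 0,
    g x y 0 c = Num.max y 0 & g x y 0 d = Num.max (- y) 0].
  rewrite /g /pl_plane /D !mxE !eqxx (negPf ab) (negPf ac) (negPf ad) (negPf bc) (negPf bd) (negPf cd).
  have neqC (u v : 'I_4) : u != v -> (v == u) = false by rewrite eq_sym => /negPf.
  rewrite (neqC _ _ ab) (neqC _ _ ac) (neqC _ _ ad) (neqC _ _ bc) (neqC _ _ bd) (neqC _ _ cd).
  by rewrite /= !mulr1 !mulr0 !addr0 !add0r.
have pt (m : 'rV[R]_4) (p q : 'I_4) (r1 r2 : R) : p != q -> 0 <= r1 -> 0 <= r2 ->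
    m = r1 *: D p + r2 *: D q -> crossing a b c d p q ->
    exists x y, [/\ m = g x y, `|x| <= `|m| & `|y| <= `|m|].
  move=> pq r10 r20 mE; wlog pq' : p q r1 r2 pq r10 r20 mE / (p \in [:: a; b]) && (q \in [:: c; d]).
    move=> wl /orP[h|h].
      by apply: (wl p q r1 r2) => //; rewrite /crossing h.
    apply: (wl q p r2 r1) => //; first by rewrite eq_sym.
      by rewrite mE addrC.
    by rewrite /crossing h.
  move=> _.
  have r1m : `|r1| <= `|m|.
    have := rV_coord_le m p; rewrite {1}mE !mxE !eqxx eq_sym.
    by rewrite eq_sym (negPf pq) mulr1 mulr0 addr0.
  have r2m : `|r2| <= `|m|.
    have := rV_coord_le m q; rewrite {1}mE !mxE !eqxx.
    by rewrite [q == p]eq_sym (negPf pq) mulr1 mulr0 add0r.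
  move: pq'; rewrite !inE => /andP[/orP[]/eqP pE /orP[]/eqP qE].
  - exists r1, r2; split=> //.
    by rewrite /g /pl_plane !maxn// !maxp// !scale0r !addr0 mE pE qE.
  - exists r1, (- r2); split; rewrite ?normrN//.
    by rewrite /g /pl_plane opprK !maxn// !maxp// !scale0r addr0 add0r mE pE qE.
  - exists (- r1), r2; split; rewrite ?normrN//.
    by rewrite /g /pl_plane opprK !maxn// !maxp// !scale0r addr0 add0r mE pE qE.
  - exists (- r1), (- r2); split; rewrite ?normrN//.
    by rewrite /g /pl_plane !opprK !maxn// !maxp// !scale0r !add0r mE pE qE.
exists (D a), (D b), (D c), (D d); split.
- by rewrite !norm_delta.
- move=> x y x' y'; rewrite -!/(g _ _) => e.
  have [e1 e2 e3 e4] := gE x y; have [e1' e2' e3' e4'] := gE x' y'.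
  by split; apply: max0_inj; rewrite -?e1 -?e2 -?e3 -?e4 e ?e1' ?e2' ?e3' ?e4'.
- move=> x y xh yh; rewrite -/(g _ _); apply/cone_tetrahedronP.
  have [p [q [pq gpq]]] : exists p q, p != q /\ g x y = `|x| *: D p + `|y| *: D q.
    rewrite /g /pl_plane; have [x0|x0] := leP x 0; have [y0|y0] := leP y 0.
    + exists b, d; split=> //; rewrite !max_l ?oppr_ge0// !scale0r !add0r.
      by rewrite !ler0_norm.
    + exists b, c; split=> //; rewrite max_l ?oppr_ge0// max_r ?oppr_le0 ?(ltW y0)//.
      by rewrite !scale0r !add0r addr0 ler0_norm// gtr0_norm.
    + exists a, d; split=> //; rewrite max_r ?oppr_le0 ?(ltW x0)// max_l ?oppr_ge0//.
      by rewrite !scale0r !add0r addr0 gtr0_norm// ler0_norm.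
    + exists a, c; split=> //; rewrite !max_r ?oppr_le0 ?(ltW x0) ?(ltW y0)//.
      by rewrite !scale0r !addr0 !gtr0_norm.
  split; last by exists p, q, `|x|, `|y|.
  rewrite gpq (bigD1 p)//= (bigD1 q) 1?eq_sym//= big1 => [|r /andP[rp rq]].
    rewrite !mxE !eqxx (negPf pq) eq_sym (negPf pq) !mulr1 !mulr0 !addr0 add0r !normr_id.
    by rewrite [ltRHS]splitr !div1r ltrD.
  by rewrite !mxE (negPf rp) (negPf rq) !andbF !mulr0 addr0 normr0.
- exact: pt nE cij.
- exact: pt n'E ckl.
Qed.

End InteriorModels.

(** * Criteria for an affine map to be a chart onto a model *)

Section ModelCharts.
Context {R : realType}.

Lemma half_diskP (x : 'rV[R]_(1 + 1)) : half_disk x <-> `|x| < 1 /\ 0 <= rsubmx x 0 0.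
Proof.
rewrite -{2}[x]hsubmxK norm_row_mx_lt// !norm_rV1_lt// !ltr_norml.
split=> [[xl /andP[x0 x1]]|[/andP[xl /andP[_ xr]] x0]].
  by split=> //; apply/andP; split=> //; rewrite x1 andbT (lt_le_trans _ x0)// ltrN10.
by split=> //; apply/andP.
Qed.

Lemma Y_times_half_openP (x : 'rV[R]_(3 + 1)) : Y_times_half_open x <->
  Y_times_open x /\ 0 <= rsubmx x 0 0.
Proof.
split=> [[xl /andP[x0 x1]]|[[xl /andP[_ x1]] x0]].
  by split=> //; split=> //; rewrite /open_segment/= x1 andbT (lt_le_trans _ x0)// ltrN10.
by split=> //; apply/andP.
Qed.

Variables (k n : nat) (s : seq 'M[R]_(k, n)) (x : 'rV[R]_n) (d1 d2 : 'rV[R]_n -> R).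
(** Two half-spaces suffice to delimit each chart: on the strips, [d1] localizes along the graph and
    [d2] within the lollipop. *)
Let near y := [/\ polytopes s y, 0 <= d1 y & 0 <= d2 y].
Hypothesis (sx : polytopes s x).
Hypothesis (d1A : affine_fun setT d1) (d2A : affine_fun setT d2).
Hypothesis (d1x : 0 < d1 x) (d2x : 0 < d2 x).

Lemma modelled_on_chart_near l (f : 'rV[R]_n -> 'rV[R]_l) (C B : set 'rV[R]_l) :
  affine_map setT f -> f x = 0 ->
  (forall y z, near y -> near z -> f y = f z -> y = z) ->
  (forall y, near y -> C (f y)) ->
  (exists2 r : R, 0 < r & forall c, C c -> `|c| < r -> exists2 y, near y & f y = c) ->
  (forall c (t : R), C c -> 0 < t -> C (t *: c)) ->
  open B -> (exists K : R, forall b, B b -> `|b| <= K) -> B 0 ->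
  modelled_on (polytopes s) (C `&` B) x.
Proof.
move=> fA fx finj fC [r r0 rC] CZ Bo BK B0.
pose D := [set y | 0 <= d1 y] `&` [set y | 0 <= d2 y].
apply: (@modelled_on_chart R k n l s x D f) => //.
- have h (d : 'rV[R]_n -> R) : affine_fun setT d -> closed [set y | 0 <= d y].
    move=> /affine_fun_continuous dc.
    apply: (@preimage_closed _ _ d [set t | 0 <= t]); last exact: closed_ge.
    by move=> y _; exact: dc.
  by apply: closedI; exact: h.
- have h (d : 'rV[R]_n -> R) : affine_fun setT d -> 0 < d x -> nbhs x [set y | 0 <= d y].
    move=> /affine_fun_continuous dc dx0.
    have : nbhs x (d @^-1` ball (d x) (d x)) by apply: dc; exact: nbhsx_ballx.
    apply: filterS => y; rewrite /preimage -ball_normE/= => /ltr_normlP[_ h].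
    by apply: ltW; lra.
  by apply: filterI; exact: h.
- by move=> y z sy [y1 y2] sz [z1 z2]; exact: finj.
- by move=> y sy [y1 y2]; exact: fC.
- by exists r => // c Cc cr; have [y [sy y1 y2] fy] := rC c Cc cr; exists y.
Qed.

Lemma ball_model l : [/\ open [set y : 'rV[R]_l | `|y| < 1],
  exists K : R, forall b : 'rV[R]_l, `|b| < 1 -> `|b| <= K & `|0 : 'rV[R]_l| < 1].
Proof.
split; [|by exists 1 => b /ltW|by rewrite normr0].
suff -> : [set y : 'rV[R]_l | `|y| < 1] = ball 0 1 by exact: ball_open.
by rewrite -ball_normE; apply/seteqP; split=> y /=; rewrite sub0r normrN.
Qed.

Lemma affine_map_row_mx a b (f : 'rV[R]_n -> 'rV[R]_a) (g : 'rV[R]_n -> 'rV[R]_b) :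
  affine_map setT f -> affine_map setT g -> affine_map setT (fun y => row_mx (f y) (g y)).
Proof.
move=> /affine_mapP fA /affine_mapP gA; apply/affine_mapP => j.
case: (split_ordP j) => i ->.
  by apply: eq_affine_fun (fA i) => y _; rewrite row_mxEl.
by apply: eq_affine_fun (gA i) => y _; rewrite row_mxEr.
Qed.

Lemma affine_map_rV l (phi : 'I_l -> 'rV[R]_n -> R) :
  (forall i, affine_fun setT (phi i)) -> affine_map setT (fun y => \row_i phi i y).
Proof.
by move=> h; apply/affine_mapP => j; apply: eq_affine_fun (h j) => y _; rewrite mxE.
Qed.

Section Planar.
Variables (phi psi : 'rV[R]_n -> R).
Hypothesis (phiA : affine_fun setT phi) (psiA : affine_fun setT psi).
Hypothesis (phix : phi x = 0) (psix : psi x = 0).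
Hypothesis (inj : forall y z, near y -> near z -> phi y = phi z -> psi y = psi z -> y = z).

Let f y : 'rV[R]_(1 + 1) := row_mx (\row_(i < 1) phi y) (\row_(i < 1) psi y).

Let fA : affine_map setT f.
Proof. by apply: affine_map_row_mx; apply: affine_map_rV. Qed.

Let fx : f x = 0.
Proof.
by rewrite /f phix psix -[RHS]row_mx0; congr row_mx; apply/rowP => i; rewrite !mxE.
Qed.

Let finj y z : near y -> near z -> f y = f z -> y = z.
Proof.
move=> ny nz /eq_row_mx[/rowP/(_ 0) + /rowP/(_ 0)]; rewrite !mxE.
exact: inj.
Qed.

Let fE y (c : 'rV[R]_(1 + 1)) :
  phi y = c 0 (lshift 1 0) -> psi y = c 0 (rshift 1 0) -> f y = c.
Proof.
move=> h h'; rewrite -[RHS]hsubmxK /f h h'.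
by congr row_mx; apply/rowP => i; rewrite ord1 !mxE.
Qed.

Lemma modelled_on_open_disk :
  (exists2 r : R, 0 < r & forall a b, `|a| < r -> `|b| < r ->
     exists2 y, near y & phi y = a /\ psi y = b) ->
  modelled_on (polytopes s) open_disk x.
Proof.
move=> [r r0 surj]; have [Bo BK B0] := ball_model (1 + 1).
have -> : open_disk = setT `&` [set y : 'rV[R]_(1 + 1) | `|y| < 1].
  by apply/seteqP; split=> [y /open_diskP|y [_ /open_diskP]].
apply: (modelled_on_chart_near fA fx) => //.
exists r => // c _ cr.
have [||y ny [h h']] := surj (c 0 (lshift 1 0)) (c 0 (rshift 1 0)).
- exact: le_lt_trans (rV_coord_le _ _) cr.
- exact: le_lt_trans (rV_coord_le _ _) cr.
by exists y => //; exact: fE.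
Qed.

Lemma modelled_on_half_disk : (forall y, near y -> 0 <= psi y) ->
  (exists2 r : R, 0 < r & forall a b, `|a| < r -> 0 <= b < r ->
     exists2 y, near y & phi y = a /\ psi y = b) ->
  modelled_on (polytopes s) half_disk x.
Proof.
move=> psi0 [r r0 surj]; have [Bo BK B0] := ball_model (1 + 1).
have -> : half_disk =
    [set y : 'rV[R]_(1 + 1) | 0 <= rsubmx y 0 0] `&` [set y | `|y| < 1].
  by apply/seteqP; split=> [y /half_diskP[]|y [h0 h1]] //; apply/half_diskP.
apply: (modelled_on_chart_near fA fx) => //.
- by move=> y /psi0; rewrite /= row_mxKr mxE.
- exists r => // c; rewrite /= mxE => c0 cr.
  have [||y ny [h h']] := surj (c 0 (lshift 1 0)) (c 0 (rshift 1 0)).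
  + exact: le_lt_trans (rV_coord_le _ _) cr.
  + rewrite c0 -(ger0_norm c0); exact: le_lt_trans (rV_coord_le _ _) cr.
  by exists y => //; exact: fE.
- by move=> c t /=; rewrite !mxE => c0 t0; rewrite mulr_ge0// ltW.
Qed.

End Planar.

Section Tripod.
Variables (phi : 'I_3 -> 'rV[R]_n -> R) (psi : 'rV[R]_n -> R).
Hypothesis (phiA : forall i, affine_fun setT (phi i)) (psiA : affine_fun setT psi).
Hypothesis (phix : forall i, phi i x = 0) (psix : psi x = 0).
Hypothesis (inj : forall y z, near y -> near z -> (forall i, phi i y = phi i z) ->
  psi y = psi z -> y = z).
Hypothesis (leg : forall y, near y -> exists i t, 0 <= t /\
  forall j, phi j y = t * (j == i)%:R).

Let f y : 'rV[R]_(3 + 1) := row_mx (\row_i phi i y) (\row_(i < 1) psi y).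

Let fA : affine_map setT f.
Proof. by apply: affine_map_row_mx; apply: affine_map_rV. Qed.

Let fx : f x = 0.
Proof.
rewrite /f psix -[RHS]row_mx0; congr row_mx; apply/rowP => i; rewrite !mxE//.
Qed.

Let finj y z : near y -> near z -> f y = f z -> y = z.
Proof.
move=> ny nz /eq_row_mx[/rowP h /rowP/(_ 0)]; rewrite !mxE; apply: inj => // i.
by have := h i; rewrite !mxE.
Qed.

Let C := [set c : 'rV[R]_(3 + 1) | exists i t, 0 <= t /\ lsubmx c = t *: delta_mx 0 i].

Let fC y : near y -> C (f y).
Proof.
move=> /leg[i [t [t0 h]]]; exists i, t; split=> //; rewrite row_mxKl.
by apply/rowP => j; rewrite !mxE h.
Qed.

Let CZ c (t : R) : C c -> 0 < t -> C (t *: c).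
Proof.
move=> [i [r [r0 h]]] t0; exists i, (t * r); split; first by rewrite mulr_ge0// ltW.
by rewrite linearZ/= h scalerA.
Qed.

Let fE y (c : 'rV[R]_(3 + 1)) i (t : R) : lsubmx c = t *: delta_mx 0 i ->
  (forall j, phi j y = t * (j == i)%:R) -> psi y = c 0 (rshift 3 0) -> f y = c.
Proof.
move=> cl h h'; rewrite -[RHS]hsubmxK cl /f h'; congr row_mx; apply/rowP => j.
  by rewrite !mxE h.
by rewrite ord1 !mxE.
Qed.

Let leg_lt (c : 'rV[R]_(3 + 1)) i (t r : R) : 0 <= t ->
  lsubmx c = t *: delta_mx 0 i -> `|c| < r -> 0 <= t < r.
Proof.
move=> t0 cl cr; rewrite t0 -(ger0_norm t0).
have := le_lt_trans (rV_coord_le c (lshift 1 i)) cr.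
by rewrite -{1}[c]hsubmxK row_mxEl cl !mxE !eqxx mulr1.
Qed.

Lemma modelled_on_Y_times_open :
  (exists2 r : R, 0 < r & forall i t b, 0 <= t < r -> `|b| < r ->
     exists2 y, near y & (forall j, phi j y = t * (j == i)%:R) /\ psi y = b) ->
  modelled_on (polytopes s) Y_times_open x.
Proof.
move=> [r r0 surj]; have [Bo BK B0] := ball_model (3 + 1).
have -> : Y_times_open = C `&` [set y | `|y| < 1].
  by apply/seteqP; split=> [y /Y_times_openP[]|y [? ?]] //; apply/Y_times_openP.
apply: (modelled_on_chart_near fA fx) => //.
exists r => // c [i [t [t0 cl]]] cr.
have [||y ny [h h']] := surj i t (c 0 (rshift 3 0)).
- exact: leg_lt cl cr.
- exact: le_lt_trans (rV_coord_le _ _) cr.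
by exists y => //; exact: (fE cl h h').
Qed.

Lemma modelled_on_Y_times_half_open : (forall y, near y -> 0 <= psi y) ->
  (exists2 r : R, 0 < r & forall i t b, 0 <= t < r -> 0 <= b < r ->
     exists2 y, near y & (forall j, phi j y = t * (j == i)%:R) /\ psi y = b) ->
  modelled_on (polytopes s) Y_times_half_open x.
Proof.
move=> psi0 [r r0 surj]; have [Bo BK B0] := ball_model (3 + 1).
have -> : Y_times_half_open =
    (C `&` [set c | 0 <= rsubmx c 0 0]) `&` [set y | `|y| < 1].
  apply/seteqP; split=> [y /Y_times_half_openP[/Y_times_openP[]]|y [[? ?] ?]] //.
  by apply/Y_times_half_openP; split=> //; apply/Y_times_openP.
apply: (modelled_on_chart_near fA fx) => //.
- move=> y ny; split; first exact: fC.
  by rewrite /= row_mxKr mxE; exact: psi0.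
- exists r => // c [[i [t [t0 cl]]]]; rewrite /= mxE => c0 cr.
  have [||y ny [h h']] := surj i t (c 0 (rshift 3 0)).
  + exact: leg_lt cl cr.
  + rewrite c0 -(ger0_norm c0); exact: le_lt_trans (rV_coord_le _ _) cr.
  by exists y => //; exact: (fE cl h h').
- move=> c t [Cc c0] t0; split; first exact: CZ.
  by move: c0; rewrite /= !mxE => c0; rewrite mulr_ge0// ltW.
Qed.

End Tripod.

Section Tetrahedron.
Variable (phi : 'I_4 -> 'rV[R]_n -> R).
Hypothesis (phiA : forall i, affine_fun setT (phi i)).
Hypothesis (phix : forall i, phi i x = 0).
Hypothesis (inj : forall y z, near y -> near z -> (forall i, phi i y = phi i z) -> y = z).

Lemma modelled_on_cone_tetrahedron :
  (forall y, near y -> exists i j a b, [/\ i != j, 0 <= a, 0 <= b &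
     forall l, phi l y = a * (l == i)%:R + b * (l == j)%:R]) ->
  (exists2 r : R, 0 < r & forall i j a b, i != j -> 0 <= a < r -> 0 <= b < r ->
     exists2 y, near y & forall l, phi l y = a * (l == i)%:R + b * (l == j)%:R) ->
  modelled_on (polytopes s) cone_tetrahedron x.
Proof.
move=> edge [r r0 surj].
pose C := [set c : 'rV[R]_4 | exists i j a b,
    [/\ i != j, 0 <= a, 0 <= b & c = a *: delta_mx 0 i + b *: delta_mx 0 j]].
(* For this model the bounded set [B] is the open l1 ball, whereas the other charts use that of the
   sup norm. *)
pose N1 (c : 'rV[R]_4) := \sum_i `|c 0 i|.
have N1_lip (c c' : 'rV[R]_4) : `|N1 c - N1 c'| <= 4 * `|c - c'|.
  rewrite /N1 -sumrB (le_trans (ler_norm_sum _ _ _))//.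
  have -> : 4 * `|c - c'| = \sum_(i < 4) `|c - c'|.
    by rewrite sumr_const card_ord mulr_natl.
  apply: ler_sum => i _; rewrite (le_trans (ler_dist_dist _ _))//.
  by rewrite (le_trans _ (rV_coord_le _ i))// !mxE.
have -> : cone_tetrahedron = C `&` [set c | N1 c < 1].
  by apply/seteqP; split=> [y /cone_tetrahedronP[]|y [? ?]] //; apply/cone_tetrahedronP.
apply: (@modelled_on_chart_near _ (fun y => \row_i phi i y)).
- exact: affine_map_rV.
- by apply/rowP => i; rewrite !mxE.
- by move=> y z ny nz /rowP h; apply: inj => // i; have := h i; rewrite !mxE.
- move=> y /edge[i [j [a [b [ij a0 b0 h]]]]]; exists i, j, a, b; split=> //.
  by apply/rowP => l; rewrite !mxE h.
- exists r => // c [i [j [a [b [ij a0 b0 cE]]]]] cr.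
  have [||y ny h] := surj i j a b ij.
  + rewrite a0 -(ger0_norm a0); apply: le_lt_trans cr.
    have := rV_coord_le c i; rewrite {1}cE !mxE !eqxx (negPf ij).
    by rewrite mulr1 mulr0 addr0.
  + rewrite b0 -(ger0_norm b0); apply: le_lt_trans cr.
    have := rV_coord_le c j; rewrite {1}cE !mxE !eqxx [j == i]eq_sym (negPf ij).
    by rewrite mulr1 mulr0 add0r.
  exists y => //; apply/rowP => l; by rewrite cE !mxE h.
- move=> c t [i [j [a [b [ij a0 b0 cE]]]]] t0; exists i, j, (t * a), (t * b).
  by rewrite cE scalerDr !scalerA; split=> //; rewrite mulr_ge0// ltW.
- have N1c : continuous N1 by exact: lipschitz_continuous N1_lip.
  rewrite (_ : [set c | N1 c < 1] = N1 @^-1` [set t | t < 1])//.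
  by apply: open_comp; [move=> c _; exact: N1c|exact: open_lt].
- exists 1 => c /ltW c1; apply: rV_norm_le => // j; apply: le_trans c1.
  by rewrite /N1 (bigD1 j)//= lerDl sumr_ge0.
- by rewrite /= /N1 big1// => i _; rewrite mxE normr0.
Qed.

End Tetrahedron.
End ModelCharts.

(** * Ambient coordinates of the strips *)

Section Strips.
Context {R : realType}.

(** Edges are divided into thirds. The vertex hats of the two ends of an edge have disjoint
    supports, the end thirds, whereas its two edge hats overlap in the middle third and together are
    positive on the whole open edge. *)
Definition vertex_hat (t : R) : R := Num.max (3^-1 - t) 0.
Definition edge_hat (t : R) : R := Num.max (Num.min t (2 / 3 - t)) 0.
Definition arc_depth (s : R) : R := Num.min s (1 - s).
Definition edge_depth (t : R) : R := Num.min (Num.min t (1 - t)) 3^-1.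

Variables (V E : finType).
Local Notation H := (E * bool)%type.
Variables (vtx : H -> V) (nu : H -> H).

Definition flip (h : H) : H := (h.1, ~~ h.2).

Lemma flipK : involutive flip.
Proof. by case=> e b; rewrite /flip/= negbK. Qed.

Lemma flip_neq h : (flip h == h) = false.
Proof. by apply/eqP => /(congr1 snd)/=; case: (h.2). Qed.

(* The circles over the three half-edges at a vertex form a theta graph, each being
   the union of two of its three arcs; an arc is labelled by the half-edge whose
   circle misses it. *)
Definition arc_label (h : H) (b : bool) : H := if b then nu h else nu (nu h).

(** Five kinds of coordinates: a hat for each vertex ([U] below); a hat for each half-edge ([L]);
    the distance from q, on the arcs ([S], at [true]) and on the whisker ([W], at [false]); a depth
    for each arc of a theta graph ([T]); a depth for each arc over an edge ([X], indexed by the edge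
    and the arc). *)
Local Notation index := (V + (H + (bool + (H + H))))%type.
Local Notation kind := (option bool).

(* The point at distance t from the vertex of h along h and s from q along kappa: the
   whisker (None) or one of the two arcs from q to p (Some b). *)
Definition strip_coord (h : H) (kappa : kind) (t s : R) (i : index) : R :=
  match i with
  | inl v => vertex_hat t *+ (v == vtx h) + vertex_hat (1 - t) *+ (v == vtx (flip h))
  | inr (inl h') => edge_hat t *+ (h' == h) + edge_hat (1 - t) *+ (h' == flip h)
  | inr (inr (inl b)) => s *+ (isSome kappa == b)
  | inr (inr (inr (inl j))) => if kappa is Some b then
      Num.min (arc_depth s) (vertex_hat t) *+ (j == arc_label h b) +
      Num.min (arc_depth s) (vertex_hat (1 - t)) *+ (j == arc_label (flip h) b) else 0
  | inr (inr (inr (inr h'))) => if kappa is Some b then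
      Num.min (arc_depth s) (edge_depth t) *+ (h' == (h.1, b)) else 0
  end.

Definition strip h kappa t s : 'rV[R]_#|{: index}| :=
  \row_i strip_coord h kappa t s (enum_val i).

Definition ambient_coord (i : index) (y : 'rV[R]_#|{: index}|) : R := y 0 (enum_rank i).

Lemma ambient_coord_strip i h kappa t s :
  ambient_coord i (strip h kappa t s) = strip_coord h kappa t s i.
Proof. by rewrite /ambient_coord mxE enum_rankK. Qed.

Lemma strip_eq h kappa t s h' kappa' t' s' :
  (forall i, strip_coord h kappa t s i = strip_coord h' kappa' t' s' i) ->
  strip h kappa t s = strip h' kappa' t' s'.
Proof. by move=> e; apply/rowP => i; rewrite !mxE. Qed.

Lemma ambient_coord_affine i (A : set 'rV[R]_#|{: index}|) : affine_fun A (ambient_coord i).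
Proof. exact: affine_fun_coord. Qed.

(** Every edge is parametrized from both of its ends, so charts are needed only for [t <= 2^-1]. *)
Lemma strip_flip h kappa t s : strip (flip h) kappa (1 - t) s = strip h kappa t s.
Proof.
have tE : 1 - (1 - t) = t by rewrite opprB addrC subrK.
have rhoE : edge_depth (1 - t) = edge_depth t by rewrite /edge_depth tE (minC (1 - t)).
apply: strip_eq => -[v|[h'|[b|[j|h']]]] //=; rewrite ?flipK ?tE ?rhoE//.
- exact: addrC.
- exact: addrC.
- by case: kappa => // b; exact: addrC.
Qed.

Ltac minmax := repeat match goal with
  | |- context [Num.min ?a ?b] => case: (leP a b) => ?
  | |- context [Num.max ?a ?b] => case: (leP a b) => ?
  end; intros; try lra.

Lemma vertex_hat_small t : t <= 3^-1 -> vertex_hat t = 3^-1 - t.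
Proof. rewrite /vertex_hat; minmax. Qed.
Lemma vertex_hat_large t : 3^-1 <= t -> vertex_hat t = 0.
Proof. rewrite /vertex_hat; minmax. Qed.
Lemma edge_hat_small t : 0 <= t <= 3^-1 -> edge_hat t = t.
Proof. move=> /andP[? ?]; rewrite /edge_hat; minmax. Qed.
Lemma edge_hat_large t : 2 / 3 <= t -> edge_hat t = 0.
Proof. rewrite /edge_hat; minmax. Qed.
Lemma edge_hat0 : edge_hat 0 = 0.
Proof. rewrite /edge_hat; minmax. Qed.
Lemma edge_hat_gt0 t : (0 < edge_hat t) = (0 < t < 2 / 3).
Proof. by apply/idP/andP => [|[]]; rewrite /edge_hat; minmax; split; lra. Qed.
(** In the first third only [edge_hat t = t] contributes. In the middle third the slopes are -1 and
    1, and the weight 2 restores the slope 1, so [t] is an affine function of two ambient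
    coordinates. *)
Lemma edge_hat_sum t : 0 <= t <= 2 / 3 -> edge_hat t + 2 * edge_hat (1 - t) = t.
Proof. move=> /andP[? ?]; rewrite /edge_hat; minmax. Qed.
Lemma edge_hat_ge0 t : 0 <= edge_hat t.
Proof. by rewrite /edge_hat le_max lexx orbT. Qed.
Lemma vertex_hat_ge0 t : 0 <= vertex_hat t.
Proof. by rewrite /vertex_hat le_max lexx orbT. Qed.
Lemma arc_depth_ge0 s : 0 <= s <= 1 -> 0 <= arc_depth s.
Proof. by move=> /andP[s0 s1]; rewrite /arc_depth le_min s0 subr_ge0. Qed.
Lemma edge_depth_ge t : 0 <= t <= 2 / 3 -> edge_hat t <= edge_depth t.
Proof. move=> /andP[? ?]; rewrite /edge_hat /edge_depth; minmax. Qed.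
Lemma edge_hat_le t : edge_hat t <= 3^-1.
Proof. rewrite /edge_hat; minmax. Qed.
Lemma edge_hat_near t t' c : `|t' - t| <= c -> edge_hat t - c <= edge_hat t'.
Proof. rewrite ler_norml /edge_hat => /andP[? ?]; minmax. Qed.
Lemma arc_depth_near t t' c : `|t' - t| <= c -> arc_depth t - c <= arc_depth t'.
Proof. rewrite ler_norml /arc_depth => /andP[? ?]; minmax. Qed.
Lemma edge_depth_near t t' c : `|t' - t| <= c -> edge_depth t - c <= edge_depth t'.
Proof. rewrite ler_norml /edge_depth => /andP[? ?].
case: (leP t (1 - t)) => ?; case: (leP t' (1 - t')) => ?; minmax. Qed.

End Strips.

(** * Six sectors on the boundary of the positive octant *)

Section Fan.
Context {R : realType}.

(** With the half-edges at a vertex numbered cyclically along [nu], this is [arc_label]: the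
    half-edge whose circle lacks the arc [b] of circle [i]. *)
Definition missing (i : 'I_3) (b : bool) : 'I_3 := if b then i + 1 else i + 2.

(** The boundary of the positive octant of R^3 is cut into six sectors by the axes and by the
    diagonals of the three quadrants. Sector (i, b) lies between the axis of [i], with parameter
    [t], and the diagonal of the quadrant where coordinate [missing i b] vanishes, with parameter
    [sg]. *)
Definition fan (i : 'I_3) (b : bool) (t sg : R) (l : 'I_3) : R :=
  t *+ (l == i) + sg *+ (l != missing i b).

Lemma forall_I3 (P : 'I_3 -> Prop) : P 0 -> P 1 -> P 2 -> forall i, P i.
Proof.
move=> P0 P1 P2 [[|[|[|//]]] h].
- by rewrite (_ : Ordinal h = 0)//; exact: val_inj.
- by rewrite (_ : Ordinal h = 1)//; exact: val_inj.
- by rewrite (_ : Ordinal h = 2)//; exact: val_inj.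
Qed.

(** Sectors share at most an axis ([sg = 0]), a diagonal ([t = 0]) or the apex. These are the places
    where the corresponding strips are glued. *)
Lemma fan_inj i b t sg i' b' t' sg' :
  0 <= t -> 0 <= sg -> 0 <= t' -> 0 <= sg' -> (forall l, fan i b t sg l = fan i' b' t' sg' l) ->
  [/\ t = t', sg = sg' & [\/ i = i' /\ b = b', i = i' /\ sg = 0,
    t = 0 /\ missing i b = missing i' b' | t = 0 /\ sg = 0]].
Proof.
move=> t0 s0 t'0 s'0 h; have := h 0; have := h 1; have := h 2; clear h.
move: i i'; apply: forall_I3; apply: forall_I3; case: b; case: b';
rewrite /fan /missing /= ?mulr0n ?mulr1n => h2 h1 h0;
(split; [lra | lra | first [by apply: Or41 | by apply: Or42; split; [|lra]
  | by apply: Or43; split; [lra|apply: val_inj] | by apply: Or44; split; lra]]).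
Qed.

Lemma fan_ge0 i b (t sg : R) l : 0 <= t -> 0 <= sg -> 0 <= fan i b t sg l.
Proof. by move=> t0 s0; rewrite /fan addr_ge0// mulrn_wge0. Qed.

Lemma fan_missing i b (t sg : R) : fan i b t sg (missing i b) = 0.
Proof.
rewrite /fan eqxx mulr0n addr0 (_ : (missing i b == i) = false) ?mulr0n//.
by case: b; move: i; apply: forall_I3.
Qed.

(* Both sides have minimum 0, so they cannot differ by a nonzero constant. *)
Lemma fan_eq_of_diff i b t sg i' b' t' sg' :
  0 <= t -> 0 <= sg -> 0 <= t' -> 0 <= sg' ->
  (forall l, fan i b t sg l - fan i b t sg 2 = fan i' b' t' sg' l - fan i' b' t' sg' 2) ->
  forall l, fan i b t sg l = fan i' b' t' sg' l.
Proof.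
move=> t0 s0 t'0 s'0 h.
have m := h (missing i b); have m' := h (missing i' b').
rewrite fan_missing in m; rewrite fan_missing in m'.
have p := fan_ge0 i' b' (missing i b) t'0 s'0.
have p' := fan_ge0 i b (missing i' b') t0 s0.
by move=> l; have := h l; lra.
Qed.

(** In the quadrant opposite to [m], the larger of the two remaining coordinates selects [i]; the
    smaller one is [sg], and their difference is [t]. *)
Lemma fan_onto (q : 'I_3 -> R) (m : 'I_3) (r : R) :
  (forall l, 0 <= q l < r) -> q m = 0 ->
  exists i b t sg, [/\ 0 <= t < r, 0 <= sg < r & forall l, fan i b t sg l = q l].
Proof.
move=> qr qm.
have main (i : 'I_3) (b : bool) (p : 'I_3) : missing i b = m -> i != m -> p != m -> p != i ->
    q p <= q i -> exists i b t sg, [/\ 0 <= t < r, 0 <= sg < r & forall l, fan i b t sg l = q l].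
  move=> mE im pm pi pq; exists i, b, (q i - q p), (q p).
  have /andP[qi0 qir] := qr i; have /andP[qp0 qpr] := qr p.
  split; [by apply/andP; split; lra|by apply/andP; split; lra|].
  move=> l; rewrite /fan mE.
  have [->|li] := eqVneq l i; first by rewrite im /= !mulr1n subrK.
  have [->|lm] := eqVneq l m; first by rewrite /= !mulr0n addr0.
  suff -> : l = p by rewrite /= mulr0n mulr1n add0r.
  move: l i p m {qm mE qi0 qir qp0 qpr pq} im pm pi li lm.
  by do 4 (apply: forall_I3) => //=; move=> *; apply: val_inj.
have [h|h] := leP (q (m + 1)) (q (m + 2)).
  apply: (main (m + 2) true (m + 1)) => //; move: (m); apply: forall_I3 => //=;
  exact: val_inj.
apply: (main (m + 1) false (m + 2)); last exact: ltW.
all: by move: (m); apply: forall_I3 => //=; exact: val_inj.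
Qed.

Lemma fan_of_pair (l l' : 'I_3) (a b r : R) : l != l' -> 0 <= a < r -> 0 <= b < r ->
  exists i bb t sg, [/\ 0 <= t < r, 0 <= sg < r &
    forall p, fan i bb t sg p = a * (p == l)%:R + b * (p == l')%:R].
Proof.
move=> ll ab bb; have r0 : 0 < r by case/andP: ab => a0; exact: le_lt_trans.
have [q0 [m qm]] : (forall p, 0 <= a * (p == l)%:R + b * (p == l')%:R < r) /\
    exists m, a * (m == l)%:R + b * (m == l')%:R = 0.
  move: l l' ll; apply: forall_I3; apply: forall_I3 => //= _;
  (split; [by apply: forall_I3; rewrite /= ?mulr1 ?mulr0 ?addr0 ?add0r ?lexx|]);
  first [by exists 0; rewrite /= !mulr0 addr0 | by exists 1; rewrite /= !mulr0 addr0
        | by exists 2; rewrite /= !mulr0 addr0].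
exact: (fan_onto q0 qm).
Qed.

(** Subtracting the minimum from (a, b, 0) lands on the boundary of the octant. The spread of these
    three numbers may approach twice [r], which accounts for the doubled bound. *)
Lemma fan_of_differences (a b r : R) : `|a| < r -> `|b| < r ->
  exists i bb t sg, [/\ 0 <= t < r *+ 2, 0 <= sg < r *+ 2,
    fan i bb t sg 0 - fan i bb t sg 2 = a & fan i bb t sg 1 - fan i bb t sg 2 = b].
Proof.
rewrite !ltr_norml mulr2n => /andP[a1 a2] /andP[b1 b2].
have [mn [m1 m2 m3 [mE [m4 m5 m6]]]] : exists mn, [/\ mn <= a, mn <= b, mn <= 0 &
    [\/ mn = a, mn = b | mn = 0] /\ [/\ a - mn < r + r, b - mn < r + r & 0 - mn < r + r]].
  have [ab|ab] := leP a b; [have [a0|a0] := leP a 0|have [b0|b0] := leP b 0].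
  - by exists a; split; [lra|lra|lra|split; [by constructor 1|split; lra]].
  - by exists 0; split; [lra|lra|lra|split; [by constructor 3|split; lra]].
  - by exists b; split; [lra|lra|lra|split; [by constructor 2|split; lra]].
  - by exists 0; split; [lra|lra|lra|split; [by constructor 3|split; lra]].
pose q' (l : 'I_3) := (if l == 0 then a else if l == 1 then b else 0) - mn.
have q'0 l : 0 <= q' l < r + r.
  by rewrite /q' subr_ge0; move: l; apply: forall_I3 => /=; apply/andP.
have [m q'm] : exists m, q' m = 0.
  rewrite /q'; case: mE => ->.
  - by exists 0; rewrite subrr.
  - by exists 1; rewrite subrr.
  - by exists 2; rewrite subrr.
have [i [bb [t [sg [tb sb qE]]]]] := fan_onto q'0 q'm.
by exists i, bb, t, sg; split=> //; rewrite !qE /q' /=; lra.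
Qed.

End Fan.

(** * Localization and gluing of strips *)

Section StripGluing.
Context {R : realType}.
Variables (V E : finType).
Local Notation H := (E * bool)%type.
Variables (vtx : H -> V) (nu : H -> H).
Local Notation index := (V + (H + (bool + (H + H))))%type.
Local Notation strip := (@strip R V E vtx nu).
Local Notation ambient_coord := (@ambient_coord R V E).
Local Notation arc_label := (arc_label nu).
Local Notation U v := (ambient_coord (inl v)).
Local Notation L h := (ambient_coord (inr (inl h))).
Local Notation S := (ambient_coord (inr (inr (inl true)))).
Local Notation W := (ambient_coord (inr (inr (inl false)))).
Local Notation T j := (ambient_coord (inr (inr (inr (inl j))))).
Local Notation X h := (ambient_coord (inr (inr (inr (inr h))))).

Definition strips : set 'rV[R]_#|{: index}| :=
  [set y | exists h kappa t s, [/\ 0 <= t <= 1, 0 <= s <= 1 & y = strip h kappa t s]].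

(** Positivity of one affine coordinate singles out the strips at [v]; a strip whose far end is at
    [v] is turned around by [strip_flip]. *)
Lemma near_vertex y v : strips y -> 0 < U v y -> exists h kappa t s,
  [/\ vtx h = v, 0 <= t < 3^-1, 0 <= s <= 1 & y = strip h kappa t s].
Proof.
move=> [h [kappa [t [s [/andP[t0 t1] s01 ->]]]]]; rewrite ambient_coord_strip /= => u0.
have [/andP[/eqP vh t3]|n1] := boolP ((v == vtx h) && (t < 3^-1)).
  by exists h, kappa, t, s; rewrite t0.
have [/andP[/eqP vh t3]|n2] := boolP ((v == vtx (flip h)) && (1 - t < 3^-1)).
  exists (flip h), kappa, (1 - t), s; rewrite strip_flip; split=> //.
  by rewrite t3 subr_ge0 t1.
have z (v' : V) (r : R) : ~~ ((v == v') && (r < 3^-1)) -> vertex_hat r *+ (v == v') = 0.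
  by rewrite negb_and -leNgt => /orP[/negPf->//|/vertex_hat_large->]; rewrite mul0rn.
by move: u0; rewrite (z _ _ n1) (z _ _ n2) addr0 ltxx.
Qed.

Lemma near_edge y h : strips y -> 0 < L h y -> exists kappa t s,
  [/\ 0 < t < 2 / 3, 0 <= s <= 1 & y = strip h kappa t s].
Proof.
move=> [h' [kappa [t [s [/andP[t0 t1] s01 ->]]]]]; rewrite ambient_coord_strip /= => u0.
have [/andP[/eqP vh t3]|n1] := boolP ((h == h') && (0 < edge_hat t)).
  by exists kappa, t, s; rewrite -edge_hat_gt0 t3 vh.
have [/andP[/eqP vh t3]|n2] := boolP ((h == flip h') && (0 < edge_hat (1 - t))).
  by exists kappa, (1 - t), s; rewrite -edge_hat_gt0 t3 vh strip_flip.
have z (h'' : H) (r : R) : ~~ ((h == h'') && (0 < edge_hat r)) -> edge_hat r *+ (h == h'') = 0.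
  rewrite negb_and -leNgt => /orP[/negPf->//|r0].
  by rewrite (@le_anti _ _ (edge_hat r) 0) ?mul0rn// r0 edge_hat_ge0.
by move: u0; rewrite (z _ _ n1) (z _ _ n2) addr0 ltxx.
Qed.

Lemma strip_U h kappa t s : 0 <= t <= 3^-1 -> U (vtx h) (strip h kappa t s) = 3^-1 - t.
Proof.
move=> /andP[t0 t3]; rewrite ambient_coord_strip /= eqxx mulr1n vertex_hat_small//.
by rewrite vertex_hat_large ?mul0rn ?addr0//; lra.
Qed.

Lemma strip_L h kappa t s h' : 0 <= t <= 3^-1 -> L h' (strip h kappa t s) = t *+ (h' == h).
Proof.
move=> /andP[t0 t3]; rewrite ambient_coord_strip /= edge_hat_small ?t0//.
by rewrite edge_hat_large ?mul0rn ?addr0//; lra.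
Qed.

Lemma strip_T h b t s j : 0 <= t <= 3^-1 -> 0 <= s <= 1 ->
  T j (strip h (Some b) t s) = Num.min (arc_depth s) (3^-1 - t) *+ (j == arc_label h b).
Proof.
move=> /andP[t0 t3] s01; rewrite ambient_coord_strip /= vertex_hat_small//.
rewrite [vertex_hat (1 - t)]vertex_hat_large; last lra.
by rewrite (min_r (arc_depth_ge0 s01)) mul0rn addr0.
Qed.

Lemma strip_T_None h t s j : T j (strip h None t s) = 0.
Proof. by rewrite ambient_coord_strip. Qed.

Lemma strip_t h kappa t s : 0 <= t <= 2 / 3 ->
  L h (strip h kappa t s) + 2 * L (flip h) (strip h kappa t s) = t.
Proof.
move=> t01; rewrite !ambient_coord_strip /= !eqxx flip_neq eq_sym flip_neq.
by rewrite !mulr0n addr0 add0r !mulr1n edge_hat_sum.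
Qed.

Lemma strip_Lh h kappa t s : L h (strip h kappa t s) = edge_hat t.
Proof. by rewrite ambient_coord_strip /= eqxx eq_sym flip_neq mulr0n addr0. Qed.

Lemma strip_S h b t s : S (strip h (Some b) t s) = s.
Proof. by rewrite ambient_coord_strip. Qed.
Lemma strip_S_None h t s : S (strip h None t s) = 0.
Proof. by rewrite ambient_coord_strip. Qed.
Lemma strip_W h b t s : W (strip h (Some b) t s) = 0.
Proof. by rewrite ambient_coord_strip. Qed.
Lemma strip_W_None h t s : W (strip h None t s) = s.
Proof. by rewrite ambient_coord_strip. Qed.

Lemma strip_X h b b' t s :
  X (h.1, b') (strip h (Some b) t s) = Num.min (arc_depth s) (edge_depth t) *+ (b' == b).
Proof. by rewrite ambient_coord_strip /= xpair_eqE eqxx. Qed.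
Lemma strip_X_None h b' t s : X (h.1, b') (strip h None t s) = 0.
Proof. by rewrite ambient_coord_strip. Qed.

Lemma edge_depth_ge0 (t : R) : 0 <= t <= 1 -> 0 <= edge_depth t.
Proof. by move=> /andP[t0 t1]; rewrite /edge_depth !le_min t0 subr_ge0 t1 invr_ge0 ler0n. Qed.

Lemma arc_depth0 : arc_depth 0 = 0 :> R.
Proof. by rewrite /arc_depth subr0 min_l. Qed.
Lemma arc_depth1 : arc_depth 1 = 0 :> R.
Proof. by rewrite /arc_depth subrr min_r. Qed.

(** At [t = 0] every coordinate of a whisker that depends on [h] vanishes, except for the hat of the
    vertex. The gluings below likewise hold because the distinguishing coordinates vanish. *)
Lemma glue_vertex_None h h' s : vtx h = vtx h' -> strip h None 0 s = strip h' None 0 s.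
Proof.
move=> vh; apply: strip_eq => -[v|[h''|[b|[j|h'']]]] //=.
  by rewrite subr0 vh !(@vertex_hat_large _ 1) ?mul0rn//; lra.
by rewrite subr0 !edge_hat0 !(@edge_hat_large _ 1) ?mul0rn//; lra.
Qed.

Lemma glue_vertex_Some h h' b b' s : vtx h = vtx h' ->
  arc_label h b = arc_label h' b' -> 0 <= s <= 1 ->
  strip h (Some b) 0 s = strip h' (Some b') 0 s.
Proof.
move=> vh ab s01; apply: strip_eq => -[v|[h''|[b''|[j|h'']]]] //=; rewrite ?subr0.
- by rewrite vh !(@vertex_hat_large _ 1) ?mul0rn//; lra.
- by rewrite !edge_hat0 !(@edge_hat_large _ 1) ?mul0rn//; lra.
- rewrite ab !(@vertex_hat_large _ 1); last lra.
  by rewrite (min_r (arc_depth_ge0 s01)) !mul0rn.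
- have -> : edge_depth 0 = 0 :> R by rewrite /edge_depth subr0 (min_l ler01) min_l ?invr_ge0.
  by rewrite (min_r (arc_depth_ge0 s01)) !mul0rn.
Qed.

Lemma glue_seam h kappa kappa' t : 0 <= t <= 1 -> strip h kappa t 0 = strip h kappa' t 0.
Proof.
move=> t01; apply: strip_eq => -[v|[h''|[b|[j|h'']]]] //=; rewrite ?mul0rn//.
  by case: kappa kappa' => [b|] [b'|]; rewrite ?arc_depth0 ?(min_l (vertex_hat_ge0 _)) ?mul0rn ?addr0.
by case: kappa kappa' => [b|] [b'|]; rewrite ?arc_depth0 ?(min_l (edge_depth_ge0 t01)) ?mul0rn.
Qed.

Lemma glue_arcs h b b' t : 0 <= t <= 1 -> strip h (Some b) t 1 = strip h (Some b') t 1.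
Proof.
move=> t01; apply: strip_eq => -[v|[h''|[b''|[j|h'']]]] //=.
  by rewrite arc_depth1 !(min_l (vertex_hat_ge0 _)) !mul0rn.
by rewrite arc_depth1 (min_l (edge_depth_ge0 t01)) !mul0rn.
Qed.

End StripGluing.

(** * Charts over the open edges *)

Section EdgeCharts.
Context {R : realType}.
Variables (V E : finType).
Local Notation H := (E * bool)%type.
Variables (vtx : H -> V) (nu : H -> H).
Local Notation index := (V + (H + (bool + (H + H))))%type.
Local Notation strip := (@strip R V E vtx nu).
Local Notation ambient_coord := (@ambient_coord R V E).
Local Notation L h := (ambient_coord (inr (inl h))).
Local Notation S := (ambient_coord (inr (inr (inl true)))).
Local Notation W := (ambient_coord (inr (inr (inl false)))).
Local Notation X h := (ambient_coord (inr (inr (inr (inr h))))).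

Variables (k : nat) (s : seq 'M[R]_(k, #|{: index}|)).
Hypothesis sE : polytopes s = strips vtx nu.

Lemma polytopes_strip h kappa t r : 0 <= t <= 1 -> 0 <= r <= 1 ->
  polytopes s (strip h kappa t r).
Proof. by move=> t01 r01; rewrite sE; exists h, kappa, t, r. Qed.

Variables (h0 : H) (t0 : R).
Hypothesis t0P : 0 < t0 <= 2^-1.

Let d1 y := L h0 y - edge_hat t0 / 2.
(** By [edge_hat_sum], this is the parameter along the edge wherever [L h0] is positive, so that it
    serves as a chart coordinate even at the corners of the hats. *)
Let tt y := L h0 y + 2 * L (flip h0) y.

Let d1A : affine_fun setT d1.
Proof. by apply: affine_funB; [exact: ambient_coord_affine|exact: affine_fun_cst]. Qed.

Let ttA : affine_fun setT (fun y => tt y - t0).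
Proof.
apply: affine_funB; last exact: affine_fun_cst.
by apply: affine_funD; [|apply: affine_funZ]; exact: ambient_coord_affine.
Qed.

Let hat0 : 0 < edge_hat t0.
Proof. by rewrite edge_hat_gt0; case/andP: t0P => -> h /=; lra. Qed.

Let d1x kappa r : 0 < d1 (strip h0 kappa t0 r).
Proof. by rewrite /d1 strip_Lh; have := hat0; lra. Qed.

Let t023 : 0 <= t0 <= 2 / 3.
Proof. by case/andP: t0P => a b; apply/andP; split; lra. Qed.

Let t01 : 0 <= t0 <= 1.
Proof. by case/andP: t0P => a b; apply/andP; split; lra. Qed.

Let ttx kappa r : tt (strip h0 kappa t0 r) - t0 = 0.
Proof. by rewrite /tt strip_t// subrr. Qed.

Let near1 y : polytopes s y -> 0 <= d1 y -> exists kappa t r,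
  [/\ 0 < t < 2 / 3, 0 <= r <= 1, y = strip h0 kappa t r, tt y = t &
      edge_hat t0 / 2 <= edge_hat t].
Proof.
rewrite sE => sy dy.
have Ly : 0 < L h0 y by have := hat0; move: dy; rewrite /d1; lra.
have [kappa [t [r [tb rb yE]]]] := near_edge sy Ly.
exists kappa, t, r; split=> //.
  by rewrite yE /tt strip_t//; case/andP: tb => a b; rewrite !ltW.
by move: dy; rewrite /d1 yE strip_Lh subr_ge0.
Qed.

Let surj1 a kappa r : `|a| < edge_hat t0 / 2 -> 0 <= r <= 1 ->
  let y := strip h0 kappa (t0 + a) r in
  [/\ polytopes s y, 0 <= d1 y, tt y - t0 = a & 0 < t0 + a < 2 / 3].
Proof.
move=> ar rb y.
have near : `|t0 + a - t0| <= `|a| by rewrite addrAC subrr add0r.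
have := edge_hat_near near => hat.
have tb : 0 < t0 + a < 2 / 3 by rewrite -edge_hat_gt0; have := hat0; lra.
have tb' : 0 <= t0 + a <= 2 / 3 by case/andP: tb => p q; rewrite !ltW.
split=> //; first by apply: polytopes_strip => //; case/andP: tb => p q; apply/andP; split; lra.
  by rewrite /d1 strip_Lh; lra.
by rewrite /tt strip_t// addrAC subrr add0r.
Qed.

Lemma edge_chart_whisker_end : modelled_on (polytopes s) half_disk (strip h0 None t0 1).
Proof.
pose d2 y := W y - 2^-1.
have d2A : affine_fun setT d2.
  by apply: affine_funB; [exact: ambient_coord_affine|exact: affine_fun_cst].
have psiA : affine_fun setT (fun y => 1 - W y).
  by apply: affine_funB; [exact: affine_fun_cst|exact: ambient_coord_affine].
have near2 y : polytopes s y -> 0 <= d1 y -> 0 <= d2 y -> exists t r,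
    [/\ 0 <= r <= 1, y = strip h0 None t r, tt y = t & W y = r].
  move=> sy dy d2y; have [[b|] [t [r [tb rb yE ty _]]]] := near1 sy dy.
    by move: d2y; rewrite /d2 yE strip_W; lra.
  by exists t, r; rewrite {3}yE strip_W_None.
apply: (@modelled_on_half_disk _ _ _ _ _ d1 d2 _ d1A d2A _ _ (fun y => tt y - t0)
  (fun y => 1 - W y)) => //.
- by apply: polytopes_strip; rewrite // ler01 lexx.
- by rewrite /d2 strip_W_None; lra.
- by rewrite strip_W_None subrr.
- move=> y z [sy dy d2y] [sz dz d2z].
  have [t [r [_ yE -> ->]]] := near2 y sy dy d2y.
  have [t' [r' [_ zE -> ->]]] := near2 z sz dz d2z => e1 e2.
  by rewrite yE zE; congr strip; lra.
- move=> y [sy dy d2y]; have [t [r [/andP[r0 r1] _ _ ->]]] := near2 y sy dy d2y.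
  by rewrite subr_ge0.
- exists (Num.min (edge_hat t0 / 2) 2^-1); first by rewrite lt_min divr_gt0//= invr_gt0.
  move=> a b; rewrite !lt_min => /andP[ar _] /and3P[b0 _ b2].
  have bb : 0 <= 1 - b <= 1 by apply/andP; split; lra.
  have [sy dy ty _] := surj1 None ar bb.
  exists (strip h0 None (t0 + a) (1 - b)); split=> //; rewrite ?/d2 strip_W_None; lra.
Qed.

Lemma edge_chart_whisker r0 : 0 < r0 < 1 ->
  modelled_on (polytopes s) open_disk (strip h0 None t0 r0).
Proof.
move=> /andP[r00 r01].
pose d2 y := W y - r0 / 2.
have d2A : affine_fun setT d2.
  by apply: affine_funB; [exact: ambient_coord_affine|exact: affine_fun_cst].
have psiA : affine_fun setT (fun y => W y - r0).
  by apply: affine_funB; [exact: ambient_coord_affine|exact: affine_fun_cst].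
have near2 y : polytopes s y -> 0 <= d1 y -> 0 <= d2 y -> exists t r,
    [/\ 0 <= r <= 1, y = strip h0 None t r, tt y = t & W y = r].
  move=> sy dy d2y; have [[b|] [t [r [tb rb yE ty _]]]] := near1 sy dy.
    by move: d2y; rewrite /d2 yE strip_W; lra.
  by exists t, r; rewrite {3}yE strip_W_None.
apply: (@modelled_on_open_disk _ _ _ _ _ d1 d2 _ d1A d2A _ _ (fun y => tt y - t0)
  (fun y => W y - r0)) => //.
- by apply: polytopes_strip; rewrite // !ltW.
- by rewrite /d2 strip_W_None; lra.
- by rewrite strip_W_None subrr.
- move=> y z [sy dy d2y] [sz dz d2z].
  have [t [r [_ yE -> ->]]] := near2 y sy dy d2y.
  have [t' [r' [_ zE -> ->]]] := near2 z sz dz d2z => e1 e2.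
  by rewrite yE zE; congr strip; lra.
- exists (Num.min (edge_hat t0 / 2) (Num.min (r0 / 2) (1 - r0))).
    by rewrite !lt_min divr_gt0//= divr_gt0//= subr_gt0.
  move=> a b; rewrite !lt_min => /andP[ar _] /and3P[_ + +].
  rewrite !ltr_norml => /andP[b1 b2] /andP[b3 b4].
  have bb : 0 <= r0 + b <= 1 by apply/andP; split; lra.
  have [sy dy ty _] := surj1 None ar bb.
  exists (strip h0 None (t0 + a) (r0 + b)); split=> //; rewrite ?/d2 strip_W_None; lra.
Qed.

(** [X] at this arc is positive on no other strip, so [d2] singles the arc out. Both depths are at
    least twice [c] at the center and drop by at most the distance moved, so moving by [c] preserves
    [d2 >= 0]. *)
Lemma edge_chart_arc b0 r0 : 0 < r0 < 1 ->
  modelled_on (polytopes s) open_disk (strip h0 (Some b0) t0 r0).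
Proof.
move=> /andP[r00 r01].
pose c := Num.min (arc_depth r0) (edge_depth t0) / 2.
have depth0 : 0 < edge_depth t0 by have := hat0; have := edge_depth_ge t023; lra.
have arc0 : 0 < arc_depth r0 by rewrite /arc_depth lt_min r00; lra.
have c0 : 0 < c by rewrite divr_gt0// lt_min arc0.
have c2 : c *+ 2 <= arc_depth r0 /\ c *+ 2 <= edge_depth t0.
  by rewrite -mulr_natr mulfVK//; split; rewrite ge_min lexx ?orbT.
pose d2 y := X (h0.1, b0) y - c.
have d2A : affine_fun setT d2.
  by apply: affine_funB; [exact: ambient_coord_affine|exact: affine_fun_cst].
have psiA : affine_fun setT (fun y => S y - r0).
  by apply: affine_funB; [exact: ambient_coord_affine|exact: affine_fun_cst].
have near2 y : polytopes s y -> 0 <= d1 y -> 0 <= d2 y -> exists t r,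
    [/\ 0 <= r <= 1, y = strip h0 (Some b0) t r, tt y = t & S y = r].
  move=> sy dy d2y; have [[b|] [t [r [tb rb yE ty _]]]] := near1 sy dy; last first.
    by move: d2y; rewrite /d2 yE strip_X_None; lra.
  have bE : b0 = b.
    by apply/eqP/contraT => /negPf bb; move: d2y; rewrite /d2 yE strip_X bb mulr0n; lra.
  by exists t, r; rewrite {3}yE strip_S bE.
apply: (@modelled_on_open_disk _ _ _ _ _ d1 d2 _ d1A d2A _ _ (fun y => tt y - t0)
  (fun y => S y - r0)) => //.
- by apply: polytopes_strip; rewrite // !ltW.
- rewrite /d2 strip_X eqxx mulr1n subr_gt0; move: c2; rewrite mulr2n => -[c2 c2'].
  by rewrite lt_min; apply/andP; split; lra.
- by rewrite strip_S subrr.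
- move=> y z [sy dy d2y] [sz dz d2z].
  have [t [r [_ yE -> ->]]] := near2 y sy dy d2y.
  have [t' [r' [_ zE -> ->]]] := near2 z sz dz d2z => e1 e2.
  by rewrite yE zE; congr strip; lra.
- exists (Num.min (edge_hat t0 / 2) (Num.min c (Num.min (r0 / 2) (1 - r0)))).
    by rewrite !lt_min divr_gt0//= c0 divr_gt0//= subr_gt0.
  move=> a b; rewrite !lt_min => /and3P[ar ac _] /and4P[_ bc + +].
  rewrite !ltr_norml => /andP[b1 b2] /andP[b3 b4].
  have bb : 0 <= r0 + b <= 1 by apply/andP; split; lra.
  have [sy dy ty tb] := surj1 (Some b0) ar bb.
  exists (strip h0 (Some b0) (t0 + a) (r0 + b)); last by rewrite strip_S; split; lra.
  split=> //; rewrite /d2 strip_X eqxx mulr1n subr_ge0 le_min.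
  have h1 : `|r0 + b - r0| <= c by rewrite addrAC subrr add0r ltW.
  have h2 : `|t0 + a - t0| <= c by rewrite addrAC subrr add0r ltW.
  have := arc_depth_near h1; have := edge_depth_near h2.
  by move: c2; rewrite mulr2n => -[? ?] ? ?; apply/andP; split; lra.
Qed.

(** At p the difference of the two [X] coordinates unfolds the two arcs into a line. Within [c] of p
    the depth is exactly [1 - r], because the depth along the edge is no smaller than [c] there. *)
Lemma edge_chart_arcs b0 : modelled_on (polytopes s) open_disk (strip h0 (Some b0) t0 1).
Proof.
pose c := edge_hat t0 / 2; have c0 : 0 < c by rewrite divr_gt0.
have c6 : c <= 3^-1 / 2 by have := edge_hat_le t0; rewrite /c; lra.
pose d2 y := S y - (1 - c).
have d2A : affine_fun setT d2.
  by apply: affine_funB; [exact: ambient_coord_affine|exact: affine_fun_cst].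
have psiA : affine_fun setT (fun y => X (h0.1, true) y - X (h0.1, false) y).
  by apply: affine_funB; exact: ambient_coord_affine.
have depth t r : 0 <= t <= 2 / 3 -> c <= edge_hat t -> 1 - c <= r <= 1 ->
    Num.min (arc_depth r) (edge_depth t) = 1 - r.
  move=> tb tc /andP[r0 r1]; have := edge_depth_ge tb => he.
  by rewrite /arc_depth [Num.min r _]min_r ?min_l//; lra.
have near2 y : polytopes s y -> 0 <= d1 y -> 0 <= d2 y -> exists b t r,
    [/\ 0 <= t <= 1, r <= 1, y = strip h0 (Some b) t r, tt y = t &
        X (h0.1, true) y - X (h0.1, false) y = if b then 1 - r else r - 1].
  move=> sy dy d2y.
  have [[b|] [t [r [/andP[tb1 tb2] /andP[rb1 rb2] yE ty tc]]]] := near1 sy dy; last first.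
    by move: d2y; rewrite /d2 yE strip_S_None; lra.
  exists b, t, r; split=> //; first by apply/andP; split; lra.
  rewrite yE !strip_X depth//; last 2 first.
  - by apply/andP; split; lra.
  - by move: d2y; rewrite /d2 yE strip_S rb2 andbT; lra.
  by case: (b); rewrite /= ?mulr1n ?mulr0n; lra.
apply: (@modelled_on_open_disk _ _ _ _ _ d1 d2 _ d1A d2A _ _ (fun y => tt y - t0)
  (fun y => X (h0.1, true) y - X (h0.1, false) y)) => //.
- by apply: polytopes_strip; rewrite // ler01 lexx.
- by rewrite /d2 strip_S; lra.
- by rewrite !strip_X arc_depth1 min_l ?mul0rn ?subrr// edge_depth_ge0.
- move=> y z [sy dy d2y] [sz dz d2z].
  have [b [t [r [tb r1 yE -> ->]]]] := near2 y sy dy d2y.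
  have [b' [t' [r' [_ r'1 zE -> ->]]]] := near2 z sz dz d2z => e1 e2.
  have -> : y = strip h0 (Some b') t r.
    rewrite yE; have [r1'|r1'] := eqVneq r 1; first by rewrite r1'; exact: glue_arcs.
    have rr : r < 1 by rewrite lt_neqAle r1'.
    by move: e2; case: (b); case: (b') => // e2; exfalso; lra.
  by rewrite zE; congr strip; [lra|move: e2; case: (b); case: (b') => e2; lra].
- exists c => // a b ar; rewrite ltr_norml => /andP[b1 b2].
  have bb : 0 <= 1 - `|b| <= 1.
    by rewrite subr_ge0 gerBl normr_ge0 andbT ler_norml; apply/andP; split; lra.
  pose be := 0 <= b.
  have [sy dy ty /andP[tb1 tb2]] := surj1 (Some be) ar bb.
  have bc : `|b| <= c by rewrite ler_norml; apply/andP; split; lra.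
  exists (strip h0 (Some be) (t0 + a) (1 - `|b|)).
    by split=> //; rewrite /d2 strip_S; lra.
  split=> //; rewrite !strip_X depth//; last 3 first.
  - by apply/andP; split; lra.
  - by move: dy; rewrite /d1 strip_Lh subr_ge0.
  - by rewrite gerBl normr_ge0 andbT lerD2l lerN2.
  rewrite /be; have [b0'|b0'] := leP 0 b; rewrite /= ?mulr1n ?mulr0n.
    by rewrite ger0_norm//; lra.
  by rewrite ltr0_norm//; lra.
Qed.

(** The three legs at q are the whisker, measured by [W], and the two arcs, measured by [X]. Within
    [c] of q each of these equals the distance from q on its own leg and vanishes on the others. *)
Lemma edge_chart_seam kappa : modelled_on (polytopes s) Y_times_open (strip h0 kappa t0 0).
Proof.
pose c := edge_hat t0 / 2; have c0 : 0 < c by rewrite divr_gt0.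
have c6 : c <= 3^-1 / 2 by have := edge_hat_le t0; rewrite /c; lra.
pose d2 y := c - (S y + W y).
have d2A : affine_fun setT d2.
  apply: affine_funB; first exact: affine_fun_cst.
  by apply: affine_funD; exact: ambient_coord_affine.
pose kd (i : 'I_3) : option bool := if i == 0 then None else Some (i == 1).
pose phi (i : 'I_3) y := if kd i is Some b then X (h0.1, b) y else W y.
have phiA i : affine_fun setT (phi i).
  by rewrite /phi; case: (kd i) => *; exact: ambient_coord_affine.
have kdI i : exists b, kd b = i.
  by case: i => [[]|]; [exists 1|exists 2|exists 0].
have depth t r : 0 <= t <= 2 / 3 -> c <= edge_hat t -> 0 <= r <= c ->
    Num.min (arc_depth r) (edge_depth t) = r.
  move=> tb tc /andP[r0 r1]; have := edge_depth_ge tb => he.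
  by rewrite /arc_depth [Num.min r _]min_l ?min_l//; lra.
have phiE i j t r : 0 <= t <= 2 / 3 -> c <= edge_hat t -> 0 <= r <= c ->
    phi j (strip h0 (kd i) t r) = r * (j == i)%:R.
  move=> tb tc rb; rewrite mulr_natr.
  move: i j; apply: forall_I3; apply: forall_I3; rewrite /phi /kd /=
    ?strip_X ?strip_X_None ?strip_W ?strip_W_None ?depth //=.
have near2 y : polytopes s y -> 0 <= d1 y -> 0 <= d2 y -> exists i t r,
    [/\ 0 <= t <= 1, 0 <= r, y = strip h0 (kd i) t r, tt y = t &
        forall j, phi j y = r * (j == i)%:R].
  move=> sy dy d2y; have [ka [t [r [/andP[tb1 tb2] /andP[rb1 rb2] yE ty tc]]]] := near1 sy dy.
  have [i iE] := kdI ka; exists i, t, r; rewrite iE; split=> //.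
    by apply/andP; split; lra.
  move=> j; rewrite yE -iE phiE//; first by apply/andP; split; lra.
  rewrite rb1; move: d2y; rewrite /d2 yE.
  by case: (ka) => [b|]; rewrite ?strip_S ?strip_S_None ?strip_W ?strip_W_None /=; lra.
have seamE i i' t : 0 <= t <= 1 -> strip h0 (kd i) t 0 = strip h0 (kd i') t 0.
  exact: glue_seam.
have [i0 i0E] := kdI kappa.
apply: (@modelled_on_Y_times_open _ _ _ _ _ d1 d2 _ d1A d2A _ _ phi (fun y => tt y - t0)) => //.
- by apply: polytopes_strip; rewrite // ler01 lexx.
- by rewrite /d2; case: (kappa) => [b|];
    rewrite ?strip_S ?strip_S_None ?strip_W ?strip_W_None /=; lra.
- by move=> i; rewrite -i0E phiE ?mul0r// ?lexx ?(ltW c0)//; have := hat0; rewrite /c; lra.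
- move=> y z [sy dy d2y] [sz dz d2z].
  have [i [t [r [tb r1 yE -> pE]]]] := near2 y sy dy d2y.
  have [i' [t' [r' [_ r'1 zE -> p'E]]]] := near2 z sz dz d2z => e1 e2.
  have tt' : t = t' by lra.
  have := e1 i; rewrite pE p'E eqxx mulr1 => ri.
  have := e1 i'; rewrite pE p'E eqxx mulr1 => ri'.
  rewrite yE zE -tt'; have [ii|ni] := eqVneq i i'.
    by rewrite -ii; congr strip; move: ri; rewrite ii eqxx mulr1.
  move: ri ri'; rewrite (negPf ni) eq_sym (negPf ni) !mulr0 => -> <-.
  exact: seamE.
- move=> y [sy dy d2y]; have [i [t [r [_ r0 _ _ pE]]]] := near2 y sy dy d2y.
  by exists i, r.
- exists c => // i r a /andP[r0 rc] ac.
  have rb : 0 <= r <= 1 by apply/andP; split; lra.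
  have [sy dy ty /andP[tb1 tb2]] := surj1 (kd i) ac rb.
  exists (strip h0 (kd i) (t0 + a) r).
    split=> //; rewrite /d2; case: (kd i) => [b|];
      rewrite ?strip_S ?strip_S_None ?strip_W ?strip_W_None /=; lra.
  split=> // j; apply: phiE.
  - by apply/andP; split; lra.
  - by move: dy; rewrite /d1 strip_Lh subr_ge0.
  - by rewrite r0 ltW.
Qed.

End EdgeCharts.

(** * Charts over the vertices *)

Section VertexCharts.
Context {R : realType}.
Variables (V E : finType).
Local Notation H := (E * bool)%type.
Variables (vtx : H -> V) (nu : H -> H).
Local Notation index := (V + (H + (bool + (H + H))))%type.
Local Notation strip := (@strip R V E vtx nu).
Local Notation ambient_coord := (@ambient_coord R V E).
Local Notation U v := (ambient_coord (inl v)).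
Local Notation L h := (ambient_coord (inr (inl h))).
Local Notation S := (ambient_coord (inr (inr (inl true)))).
Local Notation W := (ambient_coord (inr (inr (inl false)))).
Local Notation T j := (ambient_coord (inr (inr (inr (inl j))))).

Variables (k : nat) (s : seq 'M[R]_(k, #|{: index}|)).
Hypothesis sE : polytopes s = strips vtx nu.

Variables (v : V) (hh : 'I_3 -> H).
Hypotheses (hh_inj : injective hh) (hh_vtx : forall i, vtx (hh i) = v).
Hypothesis hh_onto : forall h, vtx h = v -> exists i, h = hh i.
Hypothesis hh_nu : forall i, nu (hh i) = hh (i + 1).

Let label i b : arc_label nu (hh i) b = hh (missing i b).
Proof.
rewrite /arc_label /missing; case: b; rewrite !hh_nu//; congr hh.
by move: i; apply: forall_I3; exact: val_inj.
Qed.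

Let d1 y := U v y - 3^-1 / 2.

Let d1A : affine_fun setT d1.
Proof. by apply: affine_funB; [exact: ambient_coord_affine|exact: affine_fun_cst]. Qed.

Let d1_strip i kappa t r : 0 <= t <= 3^-1 / 2 -> 0 <= d1 (strip (hh i) kappa t r).
Proof.
move=> /andP[t0 t1]; rewrite /d1 -(hh_vtx i) strip_U; first lra.
by apply/andP; split; lra.
Qed.

Let d1x i kappa r : 0 < d1 (strip (hh i) kappa 0 r).
Proof. by rewrite /d1 -(hh_vtx i) strip_U ?lexx ?invr_ge0 ?ler0n//; lra. Qed.

Let in_polytopes i kappa t r : 0 <= t <= 3^-1 / 2 -> 0 <= r <= 1 ->
  polytopes s (strip (hh i) kappa t r).
Proof.
move=> /andP[t0 t1] r01; apply: polytopes_strip => //.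
by apply/andP; split; lra.
Qed.

Let L_strip i kappa t r j : 0 <= t <= 3^-1 / 2 ->
  L (hh j) (strip (hh i) kappa t r) = t *+ (j == i).
Proof.
move=> /andP[t0 t1]; rewrite strip_L ?(inj_eq hh_inj)//.
by apply/andP; split; lra.
Qed.

Let near1 y : polytopes s y -> 0 <= d1 y -> exists i kappa t r,
  [/\ 0 <= t <= 3^-1 / 2, 0 <= r <= 1 & y = strip (hh i) kappa t r].
Proof.
rewrite sE => sy dy; have Uy : 0 < U v y by move: dy; rewrite /d1; lra.
have [h [kappa [t [r [/hh_onto[i ->] /andP[t0 t1] r01 yE]]]]] := near_vertex sy Uy.
exists i, kappa, t, r; split=> //; rewrite t0/=.
move: dy; rewrite /d1 yE -(hh_vtx i) strip_U; first lra.
by apply/andP; split; lra.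
Qed.

Let legs_inj (t t' : R) (i i' : 'I_3) : (forall j, t *+ (j == i) = t' *+ (j == i')) ->
  t = t' /\ (i = i' \/ t = 0).
Proof.
move=> h; have := h i; have := h i'; rewrite !eqxx !mulr1n.
have [->|ni] := eqVneq i i'; first by rewrite ?eqxx ?mulr1n => ->; split=> //; left.
by rewrite !mulr0n => <- ->; split=> //; right.
Qed.

Let mulrb' (t : R) (b : bool) : t *+ b = t * b%:R.
Proof. by rewrite mulr_natr. Qed.

Let whisker_eq i i' t r : i = i' \/ t = 0 -> strip (hh i) None t r = strip (hh i') None t r.
Proof.
by move=> [->//|->]; apply: glue_vertex_None; rewrite !hh_vtx.
Qed.

Let LA i : affine_fun setT (L (hh i)).
Proof. exact: ambient_coord_affine. Qed.

(** The whisker strips of the three half-edges are the legs, measured by [L], and the whisker is the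
    product direction. *)
Lemma vertex_chart_whisker_end i0 :
  modelled_on (polytopes s) Y_times_half_open (strip (hh i0) None 0 1).
Proof.
pose d2 y := W y - 2^-1.
have d2A : affine_fun setT d2.
  by apply: affine_funB; [exact: ambient_coord_affine|exact: affine_fun_cst].
have psiA : affine_fun setT (fun y => 1 - W y).
  by apply: affine_funB; [exact: affine_fun_cst|exact: ambient_coord_affine].
have near2 y : polytopes s y -> 0 <= d1 y -> 0 <= d2 y -> exists i t r,
    [/\ 0 <= t <= 3^-1 / 2, 0 <= r <= 1, y = strip (hh i) None t r & W y = r].
  move=> sy dy d2y; have [i [[b|] [t [r [tb rb yE]]]]] := near1 sy dy.
    by move: d2y; rewrite /d2 yE strip_W; lra.
  by exists i, t, r; rewrite {2}yE strip_W_None.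
have c6 : 0 <= (0 : R) <= 3^-1 / 2 by rewrite lexx divr_ge0.
apply: (@modelled_on_Y_times_half_open _ _ _ _ _ d1 d2 _ d1A d2A _ _
  (fun j => L (hh j)) (fun y => 1 - W y)) => //.
- by apply: in_polytopes; rewrite // ler01 lexx.
- by rewrite /d2 strip_W_None; lra.
- by move=> j; rewrite L_strip// mul0rn.
- by rewrite strip_W_None subrr.
- move=> y z [sy dy d2y] [sz dz d2z].
  have [i [t [r [tb _ yE ->]]]] := near2 y sy dy d2y.
  have [i' [t' [r' [tb' _ zE ->]]]] := near2 z sz dz d2z => e1 e2.
  have [|tt ii] := @legs_inj t t' i i'.
    by move=> j; have := e1 j; rewrite yE zE !L_strip.
  by rewrite yE zE -tt (whisker_eq _ ii); congr strip; lra.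
- move=> y [sy dy d2y]; have [i [t [r [tb _ yE _]]]] := near2 y sy dy d2y.
  exists i, t; split=> [|j]; first by case/andP: tb.
  by rewrite yE L_strip// mulrb'.
- move=> y [sy dy d2y]; have [i [t [r [_ /andP[r0 r1] _ ->]]]] := near2 y sy dy d2y.
  by rewrite subr_ge0.
- exists (3^-1 / 2) => [|i t b /andP[t0 tr] /andP[b0 br]]; first by rewrite !divr_gt0.
  have tb : 0 <= t <= 3^-1 / 2 by rewrite t0 ltW.
  exists (strip (hh i) None t (1 - b)).
    split; [apply: in_polytopes => //; apply/andP; split; lra|exact: d1_strip|].
    by rewrite /d2 strip_W_None; lra.
  split=> [j|]; first by rewrite L_strip// mulrb'.
  by rewrite strip_W_None; lra.
Qed.

Lemma vertex_chart_whisker i0 r0 : 0 < r0 < 1 ->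
  modelled_on (polytopes s) Y_times_open (strip (hh i0) None 0 r0).
Proof.
move=> /andP[r00 r01].
pose d2 y := W y - r0 / 2.
have d2A : affine_fun setT d2.
  by apply: affine_funB; [exact: ambient_coord_affine|exact: affine_fun_cst].
have psiA : affine_fun setT (fun y => W y - r0).
  by apply: affine_funB; [exact: ambient_coord_affine|exact: affine_fun_cst].
have near2 y : polytopes s y -> 0 <= d1 y -> 0 <= d2 y -> exists i t r,
    [/\ 0 <= t <= 3^-1 / 2, 0 <= r <= 1, y = strip (hh i) None t r & W y = r].
  move=> sy dy d2y; have [i [[b|] [t [r [tb rb yE]]]]] := near1 sy dy.
    by move: d2y; rewrite /d2 yE strip_W; lra.
  by exists i, t, r; rewrite {2}yE strip_W_None.
have c6 : 0 <= (0 : R) <= 3^-1 / 2 by rewrite lexx divr_ge0.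
apply: (@modelled_on_Y_times_open _ _ _ _ _ d1 d2 _ d1A d2A _ _
  (fun j => L (hh j)) (fun y => W y - r0)) => //.
- by apply: in_polytopes; rewrite // !ltW.
- by rewrite /d2 strip_W_None; lra.
- by move=> j; rewrite L_strip// mul0rn.
- by rewrite strip_W_None subrr.
- move=> y z [sy dy d2y] [sz dz d2z].
  have [i [t [r [tb _ yE ->]]]] := near2 y sy dy d2y.
  have [i' [t' [r' [tb' _ zE ->]]]] := near2 z sz dz d2z => e1 e2.
  have [|tt ii] := @legs_inj t t' i i'.
    by move=> j; have := e1 j; rewrite yE zE !L_strip.
  by rewrite yE zE -tt (whisker_eq _ ii); congr strip; lra.
- move=> y [sy dy d2y]; have [i [t [r [tb _ yE _]]]] := near2 y sy dy d2y.
  exists i, t; split=> [|j]; first by case/andP: tb.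
  by rewrite yE L_strip// mulrb'.
- exists (Num.min (3^-1 / 2) (Num.min (r0 / 2) (1 - r0))).
    by rewrite !lt_min !divr_gt0//= subr_gt0.
  move=> i t b /andP[t0]; rewrite !lt_min => /andP[tr _] /and3P[_ + +].
  rewrite !ltr_norml => /andP[b1 b2] /andP[b3 b4].
  have tb : 0 <= t <= 3^-1 / 2 by rewrite t0 ltW.
  exists (strip (hh i) None t (r0 + b)).
    split; [apply: in_polytopes => //; apply/andP; split; lra|exact: d1_strip|].
    by rewrite /d2 strip_W_None; lra.
  split=> [j|]; first by rewrite L_strip// mulrb'.
  by rewrite strip_W_None; lra.
Qed.

(** Inverse to [missing] for fixed [b]: the half-edge at which the arc labelled [m] is arc [b]. *)
Let other (m : 'I_3) (b : bool) : 'I_3 := if b then m + 2 else m + 1.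

Let missing_other m b : missing (other m b) b = m.
Proof. by case: b; move: m; apply: forall_I3; exact: val_inj. Qed.

Let other_missing i b : other (missing i b) b = i.
Proof. by case: b; move: i; apply: forall_I3; exact: val_inj. Qed.

Let signed_inj (b b' : bool) (t t' : R) : 0 <= t -> 0 <= t' ->
  (if b then - t else t) = (if b' then - t' else t') -> t = t' /\ (b = b' \/ t = 0).
Proof.
case: b; case: b' => t0 t'0 e; (split; [lra|first [by left|right; lra]]).
Qed.

(** The arc labelled [m] belongs to the circles of [m + 1] and [m + 2]. The difference of their [L]
    coordinates unfolds the two strips into a disk, and [T] keeps away from the other arcs. *)
Lemma vertex_chart_arc i0 b0 r0 : 0 < r0 < 1 ->
  modelled_on (polytopes s) open_disk (strip (hh i0) (Some b0) 0 r0).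
Proof.
move=> /andP[r00 r01].
pose m := missing i0 b0.
pose c := Num.min (arc_depth r0) 3^-1 / 2.
have arc0 : 0 < arc_depth r0 by rewrite /arc_depth lt_min r00; lra.
have c0 : 0 < c by rewrite divr_gt0// lt_min arc0 /= invr_gt0 ltr0n.
have [c2 c3] : c *+ 2 <= arc_depth r0 /\ c *+ 2 <= 3^-1.
  by rewrite -mulr_natr mulfVK//; split; rewrite ge_min lexx ?orbT.
rewrite mulr2n in c2; rewrite mulr2n in c3.
pose d2 y := T (hh m) y - c.
have d2A : affine_fun setT d2.
  by apply: affine_funB; [exact: ambient_coord_affine|exact: affine_fun_cst].
have psiA : affine_fun setT (fun y => S y - r0).
  by apply: affine_funB; [exact: ambient_coord_affine|exact: affine_fun_cst].
pose phi y := L (hh (m + 1)) y - L (hh (m + 2)) y.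
have phiA : affine_fun setT phi by exact: affine_funB.
have T_strip i b t r j : 0 <= t <= 3^-1 / 2 -> 0 <= r <= 1 ->
    T (hh j) (strip (hh i) (Some b) t r) =
    Num.min (arc_depth r) (3^-1 - t) *+ (j == missing i b).
  move=> /andP[t0 t1] rb; rewrite strip_T// ?label ?(inj_eq hh_inj)//.
  by apply/andP; split; lra.
have phi_strip kappa b t r : 0 <= t <= 3^-1 / 2 ->
    phi (strip (hh (other m b)) kappa t r) = if b then - t else t.
  move=> tb; rewrite /phi !L_strip// /other.
  by case: b; move: (m); apply: forall_I3; rewrite /= ?mulr1n ?mulr0n ?subr0 ?sub0r.
have near2 y : polytopes s y -> 0 <= d1 y -> 0 <= d2 y -> exists b t r,
    [/\ 0 <= t <= 3^-1 / 2, 0 <= r <= 1, y = strip (hh (other m b)) (Some b) t r,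
        phi y = if b then - t else t & S y = r].
  move=> sy dy d2y; have [i [[b|] [t [r [tb rb yE]]]]] := near1 sy dy; last first.
    by move: d2y; rewrite /d2 yE strip_T_None; lra.
  have mE : m = missing i b.
    by apply/eqP/contraT => /negPf mb; move: d2y; rewrite /d2 yE T_strip// mb mulr0n; lra.
  have iE : i = other m b by rewrite mE other_missing.
  rewrite iE in yE; exists b, t, r; split=> //; first by rewrite yE phi_strip.
  by rewrite yE strip_S.
have i0E : i0 = other m b0 by rewrite other_missing.
have c6 : 0 <= (0 : R) <= 3^-1 / 2 by rewrite lexx divr_ge0.
apply: (@modelled_on_open_disk _ _ _ _ _ d1 d2 _ d1A d2A _ _ phi (fun y => S y - r0)) => //.
- by apply: in_polytopes; rewrite // !ltW.
- rewrite /d2 T_strip//; last by rewrite !ltW.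
  rewrite eqxx mulr1n subr_gt0 lt_min.
  by apply/andP; split; lra.
- by rewrite i0E phi_strip//; case: (b0); rewrite ?oppr0.
- by rewrite strip_S subrr.
- move=> y z [sy dy d2y] [sz dz d2z].
  have [b [t [r [/andP[t0 _] rb yE -> ->]]]] := near2 y sy dy d2y.
  have [b' [t' [r' [/andP[t'0 _] _ zE -> ->]]]] := near2 z sz dz d2z => e1 e2.
  have [tt bb] := signed_inj t0 t'0 e1; have rr : r = r' by exact: addIr e2.
  rewrite yE zE -tt -rr; case: bb => [->//|->].
  apply: glue_vertex_Some => //; first by rewrite !hh_vtx.
  by rewrite !label !missing_other.
- exists (Num.min c (Num.min (r0 / 2) (1 - r0))).
    by rewrite !lt_min c0 divr_gt0//= subr_gt0.
  move=> a b; rewrite !lt_min => /and3P[ac _ _] /and3P[bc + +].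
  rewrite !ltr_norml => /andP[b1 b2] /andP[b3 b4].
  have tb : 0 <= `|a| <= 3^-1 / 2 by rewrite normr_ge0 (le_trans (ltW ac))//; lra.
  have rb : 0 <= r0 + b <= 1 by apply/andP; split; lra.
  exists (strip (hh (other m (a < 0))) (Some (a < 0)) `|a| (r0 + b)).
    split; [exact: in_polytopes|exact: d1_strip|].
    rewrite /d2 T_strip// missing_other eqxx mulr1n subr_ge0 le_min.
    have h1 : `|r0 + b - r0| <= c by rewrite addrAC subrr add0r ltW.
    by have := arc_depth_near h1 => ?; apply/andP; split; lra.
  rewrite phi_strip// strip_S; split; last lra.
  by case: ltP => a0; [rewrite ltr0_norm ?opprK|rewrite ger0_norm].
Qed.

(** The arc labelled j counts in the two coordinates other than j, so that the strips of the arcs at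
    [v] are sent to the sectors of the fan. *)
Let q l y := L (hh l) y + (T (hh (l + 1)) y + T (hh (l + 2)) y).

Let qA l : affine_fun setT (q l).
Proof. by apply: affine_funD => //; apply: affine_funD; exact: ambient_coord_affine. Qed.

Let q_strip i b t r sg l : 0 <= t <= 3^-1 / 2 -> 0 <= r <= 1 ->
  Num.min (arc_depth r) (3^-1 - t) = sg -> q l (strip (hh i) (Some b) t r) = fan i b t sg l.
Proof.
move=> tb rb sgE; rewrite /q L_strip// /fan.
have tb' : 0 <= t <= 3^-1 by case/andP: tb => t0 t1; apply/andP; split; lra.
rewrite !strip_T// !label !(inj_eq hh_inj) sgE; congr (_ + _).
move: l i; apply: forall_I3; apply: forall_I3; case: b;
  by rewrite /missing /= ?mulr0n ?mulr1n ?addr0 ?add0r.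
Qed.

Let q_None i t r l : 0 <= t <= 3^-1 / 2 -> q l (strip (hh i) None t r) = t *+ (l == i).
Proof. by move=> tb; rewrite /q L_strip// !strip_T_None !addr0. Qed.

(** Around p the six strips fill the boundary of an octant, with [sg = 1 - r]. The two differences
    of the [q] project it along (1, 1, 1) onto a plane, bijectively since the minimum of the
    coordinates is 0. *)
Lemma vertex_chart_arcs i0 b0 :
  modelled_on (polytopes s) open_disk (strip (hh i0) (Some b0) 0 1).
Proof.
pose d2 y := S y - (1 - 3^-1 / 2).
have d2A : affine_fun setT d2.
  by apply: affine_funB; [exact: ambient_coord_affine|exact: affine_fun_cst].
have depth t r : 0 <= t <= 3^-1 / 2 -> 1 - 3^-1 / 2 <= r <= 1 ->
    Num.min (arc_depth r) (3^-1 - t) = 1 - r.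
  move=> /andP[t0 t1] /andP[r0 r1].
  by rewrite /arc_depth [Num.min r _]min_r ?min_l//; lra.
have near2 y : polytopes s y -> 0 <= d1 y -> 0 <= d2 y -> exists i b t r,
    [/\ 0 <= t <= 3^-1 / 2, 0 <= r <= 1, y = strip (hh i) (Some b) t r &
        forall l, q l y = fan i b t (1 - r) l].
  move=> sy dy d2y; have [i [[b|] [t [r [tb rb yE]]]]] := near1 sy dy; last first.
    by move: d2y; rewrite /d2 yE strip_S_None; lra.
  case/andP: (rb) => r0 r1; exists i, b, t, r; split=> // l; rewrite yE.
  apply: q_strip => //; apply: depth => //.
  by rewrite r1 andbT; move: d2y; rewrite /d2 yE strip_S; lra.
have c6 : 0 <= (0 : R) <= 3^-1 / 2 by rewrite lexx divr_ge0.
have fan0 i b l : fan i b 0 0 l = 0 :> R by rewrite /fan !mul0rn addr0.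
have qx l : q l (strip (hh i0) (Some b0) 0 1) = 0.
  have e : Num.min (arc_depth 1) (3^-1 - 0) = 0 :> R.
    by rewrite depth ?subrr//; apply/andP; split; lra.
  by rewrite (@q_strip _ _ _ _ _ _ c6 _ e) ?fan0// ler01 lexx.
apply: (@modelled_on_open_disk _ _ _ _ _ d1 d2 _ d1A d2A _ _
  (fun y => q 0 y - q 2 y) (fun y => q 1 y - q 2 y)) => //.
- by apply: in_polytopes; rewrite // ler01 lexx.
- by rewrite /d2 strip_S; lra.
- exact: affine_funB.
- exact: affine_funB.
- by rewrite !qx subrr.
- by rewrite !qx subrr.
- move=> y z [sy dy d2y] [sz dz d2z] e1 e2.
  have [i [b [t [r [/andP[t0 t6] rb yE yq]]]]] := near2 y sy dy d2y.
  have [i' [b' [t' [r' [/andP[t'0 _] rb' zE zq]]]]] := near2 z sz dz d2z.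
  case/andP: (rb) (rb') => r0 r1 /andP[r'0 r'1].
  have rr0 : 0 <= 1 - r by rewrite subr_ge0.
  have rr0' : 0 <= 1 - r' by rewrite subr_ge0.
  have qq : forall l, fan i b t (1 - r) l = fan i' b' t' (1 - r') l.
    apply: fan_eq_of_diff => //; rewrite !yq !zq in e1 e2.
    by apply: forall_I3; [exact: e1|exact: e2|rewrite !subrr].
  have [tt rr hc] := fan_inj t0 rr0 t'0 rr0' qq.
  have {}rr : r = r' by lra.
  have t01 : 0 <= t <= 1 by apply/andP; split; lra.
  rewrite yE zE -tt -rr; case: hc => [[-> ->]//|[-> r00]|[t00 mm]|[t00 r00]].
  + have -> : r = 1 by lra.
    exact: glue_arcs.
  + rewrite t00; apply: glue_vertex_Some; rewrite ?hh_vtx ?label ?mm//.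
  + have -> : r = 1 by lra.
    rewrite t00.
    (* Both points are p over the vertex. Any two circles share an arc, so p can be reached through
       that arc on either side. *)
    have [bi [bi' bb]] : exists bi bi', missing i bi = missing i' bi'.
      move: (i) (i'); apply: forall_I3; apply: forall_I3;
      first [by exists true, true; apply: val_inj | by exists true, false; apply: val_inj
            | by exists false, true; apply: val_inj].
    have l01 : 0 <= (0 : R) <= 1 by rewrite lexx ler01.
    rewrite (glue_arcs _ _ _ _ bi l01) [RHS](glue_arcs _ _ _ _ bi' l01).
    by apply: glue_vertex_Some; rewrite ?hh_vtx ?label ?bb ?ler01 ?lexx.
(* Half the size of the chart, to compensate for the doubling in [fan_of_differences]. *)
- exists (3^-1 / 2 / 2); first by rewrite !divr_gt0.
  move=> a b ar br; have [i [bb [t [sg [tb sb e1 e2]]]]] := fan_of_differences ar br.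
  have r2 : (3^-1 / 2 / 2) *+ 2 = 3^-1 / 2 :> R by rewrite -mulr_natr mulfVK.
  rewrite r2 in tb; rewrite r2 in sb.
  have tb' : 0 <= t <= 3^-1 / 2 by case/andP: tb => -> /ltW.
  have rb : 0 <= 1 - sg <= 1 by case/andP: sb => *; apply/andP; split; lra.
  exists (strip (hh i) (Some bb) t (1 - sg)).
    split; [exact: in_polytopes|exact: d1_strip|].
    by rewrite /d2 strip_S; case/andP: sb => *; lra.
  have qq l : q l (strip (hh i) (Some bb) t (1 - sg)) = fan i bb t sg l.
    apply: q_strip => //; rewrite depth//; first lra.
    by case/andP: sb => *; apply/andP; split; lra.
  by rewrite !qq.
Qed.

(** The index other than [i] and [missing i b]. *)
Let third (i : 'I_3) (b : bool) : 'I_3 := if b then i + 2 else i + 1.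

(** [W] and the three [q] are the coordinates of R^4. The whisker strip of [l] fills the quadrant of
    coordinates 0 and [lift 0 l], while the two strips at an arc fill the quadrant of two [q], cut
    along its diagonal. *)
Lemma vertex_chart_seam i0 kappa0 :
  modelled_on (polytopes s) cone_tetrahedron (strip (hh i0) kappa0 0 0).
Proof.
pose d2 y := 3^-1 / 2 - (S y + W y).
have d2A : affine_fun setT d2.
  apply: affine_funB; first exact: affine_fun_cst.
  by apply: affine_funD; exact: ambient_coord_affine.
pose phi (i : 'I_4) y := if unlift 0 i is Some l then q l y else W y.
have phiA i : affine_fun setT (phi i).
  by rewrite /phi; case: (unlift 0 i) => [l|]; [exact: qA|exact: ambient_coord_affine].
have phi0 y : phi 0 y = W y by rewrite /phi unlift_none.
have phil l y : phi (lift 0 l) y = q l y by rewrite /phi liftK.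
have forall_I4 (P : 'I_4 -> Prop) : P 0 -> (forall l, P (lift 0 l)) -> forall i, P i.
  by move=> P0 Pl i; case: (unliftP 0 i) => [l ->|->].
have lift_eq (l l' : 'I_3) : (lift (0 : 'I_4) l == lift 0 l') = (l == l').
  exact: (inj_eq lift_inj).
have lift0 (l : 'I_3) : (lift (0 : 'I_4) l == 0) = false.
  by apply/eqP => /(congr1 val).
have depth t r : 0 <= t <= 3^-1 / 2 -> 0 <= r <= 3^-1 / 2 ->
    Num.min (arc_depth r) (3^-1 - t) = r.
  move=> /andP[t0 t1] /andP[r0 r1].
  by rewrite /arc_depth [Num.min r _]min_l ?min_l//; lra.
have near2 y : polytopes s y -> 0 <= d1 y -> 0 <= d2 y -> exists i b t r,
    [/\ 0 <= t <= 3^-1 / 2, 0 <= r <= 3^-1 / 2 &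
     (y = strip (hh i) None t r /\ W y = r /\ forall l, q l y = fan i b t 0 l) \/
     (y = strip (hh i) (Some b) t r /\ W y = 0 /\ forall l, q l y = fan i b t r l)].
  move=> sy dy d2y; have [i [[b|] [t [r [tb /andP[r0 r1] yE]]]]] := near1 sy dy.
    have rb : 0 <= r <= 3^-1 / 2.
      by rewrite r0; move: d2y; rewrite /d2 yE strip_S strip_W /=; lra.
    exists i, b, t, r; split=> //; right; rewrite {2}yE strip_W; split=> //; split=> // l.
    by rewrite yE; apply: q_strip; rewrite ?r0//; exact: depth.
  have rb : 0 <= r <= 3^-1 / 2.
    by rewrite r0; move: d2y; rewrite /d2 yE strip_S_None strip_W_None /=; lra.
  exists i, true, t, r; split=> //; left; rewrite {2}yE strip_W_None; split=> //; split=> // l.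
  by rewrite yE q_None// /fan mul0rn addr0.
(* A whisker point with [W] equal to 0 is on the seam, where it can be written as a point of an arc;
   this leaves a single form to compare. *)
have near3 y : polytopes s y -> 0 <= d1 y -> 0 <= d2 y -> W y = 0 -> exists i b t r,
    [/\ 0 <= t <= 3^-1 / 2, 0 <= r <= 3^-1 / 2,
     y = strip (hh i) (Some b) t r & forall l, q l y = fan i b t r l].
  move=> sy dy d2y; have [i [b [t [r [tb rb [[yE [-> qy]]|[yE [_ qy]]]]]]]] := near2 y sy dy d2y.
    move=> r0; exists i, b, t, 0; split=> //; first by rewrite lexx divr_ge0.
    rewrite yE r0; apply: glue_seam; case/andP: tb => t0 t1; apply/andP; split; lra.
  by move=> _; exists i, b, t, r.
have c6 : 0 <= (0 : R) <= 3^-1 / 2 by rewrite lexx divr_ge0.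
apply: (@modelled_on_cone_tetrahedron _ _ _ _ _ d1 d2 _ d1A d2A _ _ phi) => //.
- by apply: in_polytopes; rewrite // ler01 lexx.
- by rewrite /d2; case: (kappa0) => [b|];
    rewrite ?strip_S ?strip_S_None ?strip_W ?strip_W_None /=; lra.
- have -> : strip (hh i0) kappa0 0 0 = strip (hh i0) None 0 0.
    by apply: glue_seam; rewrite lexx ler01.
  by apply: forall_I4 => [|l]; rewrite ?phi0 ?phil ?strip_W_None// q_None// mul0rn.
- move=> y z [sy dy d2y] [sz dz d2z] e.
  have eW : W y = W z by rewrite -!phi0.
  have eq l : q l y = q l z by rewrite -!phil.
  have [W0|W0] := eqVneq (W y) 0.
    have [i [b [t [r [/andP[t0 t6] /andP[r0 r6] yE yq]]]]] := near3 y sy dy d2y W0.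
    rewrite eW in W0.
    have [i' [b' [t' [r' [/andP[t'0 t'6] /andP[r'0 r'6] zE zq]]]]] := near3 z sz dz d2z W0.
    have [| | | | |tt rr hc] := @fan_inj _ i b t r i' b' t' r' => //.
      by move=> l; rewrite -yq -zq.
    have t01 : 0 <= t <= 1 by apply/andP; split; lra.
    have l01 : 0 <= (0 : R) <= 1 by rewrite lexx ler01.
    rewrite yE zE -tt -rr; case: hc => [[-> ->]//|[-> ->]|[-> mm]|[-> ->]].
    + exact: glue_seam.
    + apply: glue_vertex_Some; rewrite ?hh_vtx ?label ?mm//.
      by apply/andP; split; lra.
    + rewrite (glue_seam _ _ _ _ None l01) [RHS](glue_seam _ _ _ _ None l01).
      by apply: glue_vertex_None; rewrite !hh_vtx.
  have [i [b [t [r [/andP[t0 t6] _ [[yE [yW yq]]|[_ [yW _]]]]]]]] := near2 y sy dy d2y; last first.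
    by move: W0; rewrite yW eqxx.
  rewrite eW in W0.
  have [i' [b' [t' [r' [/andP[t'0 _] _ [[zE [zW zq]]|[_ [zW _]]]]]]]] := near2 z sz dz d2z; last first.
    by move: W0; rewrite zW eqxx.
  have [|tt ii] := @legs_inj t t' i i'.
    by move=> l; have := eq l; rewrite yq zq /fan !mul0rn !addr0.
  by rewrite yE zE -tt (whisker_eq _ ii); congr strip; lra.
- move=> y [sy dy d2y].
  have [i [b [t [r [/andP[t0 t6] /andP[r0 r6] [[_ [yW yq]]|[_ [yW yq]]]]]]]] := near2 y sy dy d2y.
    exists 0, (lift 0 i), r, t; split=> //.
    apply: forall_I4 => [|l]; first by rewrite phi0 yW eqxx eq_sym lift0 mulr1 mulr0 addr0.
    by rewrite phil yq /fan mul0rn addr0 lift0 lift_eq mulr0 add0r mulrb'.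
  (* In its quadrant the sector has coordinates [t + r] along [i] and [r] along the third index. *)
  exists (lift 0 i), (lift 0 (third i b)), (t + r), r; split=> //.
  - rewrite lift_eq /third; case: (b); move: (i); by apply: forall_I3.
  - exact: addr_ge0.
  apply: forall_I4 => [|l].
    by rewrite phi0 yW ![0 == _]eq_sym !lift0 !mulr0 addr0.
  rewrite phil yq /fan !lift_eq /third /missing.
  by case: (b); move: (i) l; apply: forall_I3; apply: forall_I3; rewrite /= ?mulr0n ?mulr1n; ring.
- exists (3^-1 / 2); first by rewrite !divr_gt0.
  have none l (a b : R) : 0 <= a < 3^-1 / 2 -> 0 <= b < 3^-1 / 2 ->
      exists2 y, [/\ polytopes s y, 0 <= d1 y & 0 <= d2 y] &
        forall p, phi p y = a * (p == 0)%:R + b * (p == lift 0 l)%:R.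
    move=> /andP[a0 a6] /andP[b0 b6].
    have tb : 0 <= b <= 3^-1 / 2 by rewrite b0 ltW.
    have rb : 0 <= a <= 1 by apply/andP; split; lra.
    exists (strip (hh l) None b a).
      split; [exact: in_polytopes|exact: d1_strip|].
      by rewrite /d2 strip_S_None strip_W_None; lra.
    apply: forall_I4 => [|p].
      by rewrite phi0 strip_W_None eqxx eq_sym lift0 mulr1 mulr0 addr0.
    by rewrite phil q_None// lift0 lift_eq mulr0 add0r mulrb'.
  move=> i j a b; case: (unliftP 0 i) => [l ->|->]; case: (unliftP 0 j) => [l' ->|->].
  + rewrite lift_eq => ll ab bb.
    have [i1 [b' [t [sg [/andP[t0 t6] /andP[s0 s6] qE]]]]] := fan_of_pair ll ab bb.
    have tb : 0 <= t <= 3^-1 / 2 by rewrite t0 ltW.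
    have sb : 0 <= sg <= 3^-1 / 2 by rewrite s0 ltW.
    have rb : 0 <= sg <= 1 by apply/andP; split; lra.
    exists (strip (hh i1) (Some b') t sg).
      split; [exact: in_polytopes|exact: d1_strip|].
      by rewrite /d2 strip_S strip_W; lra.
    apply: forall_I4 => [|p].
      by rewrite phi0 strip_W ![0 == _]eq_sym !lift0 !mulr0 addr0.
    rewrite phil !lift_eq -qE; apply: q_strip => //; exact: depth.
  + by move=> _ ab bb; have [y ny yE] := none l b a bb ab; exists y => // p; rewrite yE addrC.
  + by move=> _ ab bb; exact: none.
  + by rewrite eqxx.
Qed.

End VertexCharts.

(** * Piecewise affine functions and triangulation of the strips *)

Section PiecewiseAffine.
Context {R : realType}.

(** Asking that every list can be refined, rather than that some list exists, makes closure
    immediate: refine for one function, then for the other, and for a maximum cut where the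
    difference changes sign. *)
Definition piecewise_affine n (g : 'rV[R]_n -> R) : Prop :=
  forall k (s : seq 'M[R]_(k, n)),
    exists2 s', refines s s' & forall P, P \in s' -> affine_fun (polytope P) g.

Lemma piecewise_affine_affine n (g : 'rV[R]_n -> R) :
  affine_fun setT g -> piecewise_affine g.
Proof.
by move=> gA k s; exists s => [|P _]; [exact: refines_refl|exact: affine_funS gA].
Qed.

Lemma piecewise_affine2 n (g h : 'rV[R]_n -> R) k (s : seq 'M[R]_(k, n)) :
  piecewise_affine g -> piecewise_affine h -> exists2 s', refines s s' &
    forall P, P \in s' -> affine_fun (polytope P) g /\ affine_fun (polytope P) h.
Proof.
move=> gA hA; have [s1 r1 g1] := gA k s; have [s2 r2 h2] := hA k s1.
exists s2; first exact: refines_trans r2.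
move=> Q Qs; split; last exact: h2.
by have [P Ps QP] := r2.1 Q Qs; exact: affine_funS QP (g1 P Ps).
Qed.

Lemma piecewise_affineD n (g h : 'rV[R]_n -> R) :
  piecewise_affine g -> piecewise_affine h -> piecewise_affine (fun x => g x + h x).
Proof.
move=> gA hA k s; have [s' r' gh] := piecewise_affine2 s gA hA.
by exists s' => // P /gh[gP hP]; exact: affine_funD.
Qed.

Lemma piecewise_affine_max n (g h : 'rV[R]_n -> R) :
  piecewise_affine g -> piecewise_affine h -> piecewise_affine (fun x => Num.max (g x) (h x)).
Proof.
move=> gA hA k s; have [s1 r1 gh] := piecewise_affine2 s gA hA.
have [|s2 r2 sg] := @polytopes_cut _ _ _ s1 (fun x => g x - h x).
  by move=> P /gh[gP hP]; exact: affine_funB.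
exists s2; first exact: refines_trans r2.
move=> Q Qs; have [P Ps QP] := r2.1 Q Qs; have [gP hP] := gh P Ps.
have [h0|h0] := sg Q Qs.
  apply: eq_affine_fun (affine_funS QP gP) => x /h0.
  by rewrite subr_ge0 => ?; rewrite max_l.
apply: eq_affine_fun (affine_funS QP hP) => x /h0.
by rewrite subr_le0 => ?; rewrite max_r.
Qed.

Lemma piecewise_affineN n (g : 'rV[R]_n -> R) :
  piecewise_affine g -> piecewise_affine (fun x => - g x).
Proof.
move=> gA k s; have [s' r' g'] := gA k s; exists s' => // P /g'; exact: affine_funN.
Qed.

Lemma piecewise_affine_min n (g h : 'rV[R]_n -> R) :
  piecewise_affine g -> piecewise_affine h -> piecewise_affine (fun x => Num.min (g x) (h x)).
Proof.
move=> gA hA; have := piecewise_affineN (piecewise_affine_max (piecewise_affineN gA)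
  (piecewise_affineN hA)).
by congr piecewise_affine; apply/funext => x; rewrite oppr_max !opprK.
Qed.

Lemma piecewise_affine_mulrb n (g : 'rV[R]_n -> R) (b : bool) :
  piecewise_affine g -> piecewise_affine (fun x => g x *+ b).
Proof.
case: b => // _; apply: piecewise_affine_affine.
by apply: eq_affine_fun (affine_fun_cst setT 0) => x _; rewrite mulr0n.
Qed.

Lemma piecewise_affine_family (I : eqType) (l : seq I) n (g : I -> 'rV[R]_n -> R) k
    (s : seq 'M[R]_(k, n)) : (forall i, piecewise_affine (g i)) ->
  exists2 s', refines s s' & forall i P, i \in l -> P \in s' -> affine_fun (polytope P) (g i).
Proof.
move=> gA; elim: l => [|i l [s1 r1 g1]]; first by exists s => //; exact: refines_refl.
have [s2 r2 g2] := gA i k s1; exists s2; first exact: refines_trans r2.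
move=> j Q; rewrite in_cons => /orP[/eqP->|jl] Qs; first exact: g2.
have [P Ps QP] := r2.1 Q Qs; exact: affine_funS QP (g1 j P jl Ps).
Qed.

Lemma piecewise_affine_map_refines n m (f : 'rV[R]_n -> 'rV[R]_m) k (s : seq 'M[R]_(k, n)) :
  (forall j, piecewise_affine (fun x => f x 0 j)) ->
  exists2 s', refines s s' & forall P, P \in s' -> affine_map (polytope P) f.
Proof.
move=> fA; have [s' r' f'] := piecewise_affine_family (enum 'I_m) s fA.
by exists s' => // P Ps; apply/affine_mapP => j; apply: f' => //; rewrite mem_enum.
Qed.

Lemma polytopes_map_rows n m (f : 'rV[R]_n -> 'rV[R]_m) k (s : seq 'M[R]_(k, n)) :
  (forall P, P \in s -> affine_map (polytope P) f) ->
  polytopes (map (map_rows f) s) = f @` polytopes s.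
Proof.
move=> fA; apply/seteqP; split=> [y [_ /mapP[P Ps ->]]|_ [x [P Ps Px] <-]].
  by rewrite (polytope_map_rows (fA _ Ps)) => -[x Px <-]; exists x => //; exists P.
exists (map_rows f P); first exact: map_f.
by rewrite (polytope_map_rows (fA _ Ps)); exists x.
Qed.

Lemma polytopes_flatten k n (I : eqType) (l : seq I) (s : I -> seq 'M[R]_(k, n)) y :
  polytopes (flatten (map s l)) y <-> exists2 i, i \in l & polytopes (s i) y.
Proof.
split=> [[P /flatten_mapP[i il Ps] Py]|[i il [P Ps Py]]]; first by exists i => //; exists P.
by exists P => //; apply/flatten_mapP; exists i.
Qed.

(** Two triangles along the antidiagonal; pieces with three vertices are what [polyhedron_of_dim 2]
    asks for. *)
Lemma square_polytopes : exists s : seq 'M[R]_(3, 2), forall p : 'rV[R]_2,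
  polytopes s p <-> 0 <= p 0 0 <= 1 /\ 0 <= p 0 1 <= 1.
Proof.
pose row3 (a b c : R) : 'rV[R]_3 := \row_i [:: a; b; c]`_i.
pose mat (a b c d e f : R) : 'M[R]_(3, 2) :=
  \matrix_(i, j) [:: [:: a; b]`_j; [:: c; d]`_j; [:: e; f]`_j]`_i.
have mulE x y z a b c d e f : row3 x y z *m mat a b c d e f =
    \row_j [:: x * a + y * c + z * e; x * b + y * d + z * f]`_j.
  apply/rowP => -[[|[|//]] jj]; rewrite !mxE !big_ord_recl big_ord0 !mxE /=; ring.
have simp x y z : 0 <= x -> 0 <= y -> 0 <= z -> x + y + z = 1 -> simplex (row3 x y z).
  move=> x0 y0 z0 e; split=> [i|].
    by rewrite mxE; case: i => [[|[|[|//]]] ?].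
  by rewrite !big_ord_recl big_ord0 !mxE /= addr0 addrA.
have simp' (w : 'rV[R]_3) : simplex w -> exists x y z,
    [/\ w = row3 x y z, 0 <= x, 0 <= y, 0 <= z & x + y + z = 1].
  move=> [w0 w1]; exists (w 0 0), (w 0 1), (w 0 2); split=> //.
    apply/rowP; apply: forall_I3; by rewrite mxE.
  rewrite -w1 !big_ord_recl big_ord0 addr0 addrA.
  by congr (w 0 _ + w 0 _ + w 0 _); exact: val_inj.
exists [:: mat 0 0 1 0 0 1; mat 1 1 1 0 0 1] => p; split.
  move=> [P]; rewrite !inE => /orP[]/eqP-> [w /simp'[x [y [z [-> x0 y0 z0 e]]]] <-];
    rewrite mulE !mxE /=; split; apply/andP; split; lra.
move=> [/andP[t0 t1] /andP[s0 s1]].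
have pE : p = \row_j [:: p 0 0; p 0 1]`_j.
  apply/rowP => j; rewrite mxE; case: j => [[|[|//]] jj] /=; congr (p 0 _); exact: val_inj.
have [ts|ts] := leP (p 0 0 + p 0 1) 1.
  exists (mat 0 0 1 0 0 1); first by rewrite inE eqxx.
  exists (row3 (1 - p 0 0 - p 0 1) (p 0 0) (p 0 1)); first by apply: simp; lra.
  rewrite mulE [RHS]pE; apply/rowP => -[[|[|//]] jj]; rewrite !mxE /=; ring.
exists (mat 1 1 1 0 0 1); first by rewrite !inE eqxx orbT.
exists (row3 (p 0 0 + p 0 1 - 1) (1 - p 0 1) (1 - p 0 0)); first by apply: simp; lra.
rewrite mulE [RHS]pE; apply/rowP => -[[|[|//]] jj]; rewrite !mxE /=; ring.
Qed.

Variables (V E : finType) (vtx : E * bool -> V) (nu : E * bool -> E * bool).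

Lemma strip_piecewise_affine n (t r : 'rV[R]_n -> R) h kappa j :
  affine_fun setT t -> affine_fun setT r ->
  piecewise_affine (fun x => strip vtx nu h kappa (t x) (r x) 0 j).
Proof.
move=> tA rA.
have cst (a : R) : piecewise_affine (fun _ : 'rV[R]_n => a).
  by apply: piecewise_affine_affine; exact: affine_fun_cst.
have sub1 (f : 'rV[R]_n -> R) (a : R) : affine_fun setT f -> affine_fun setT (fun x => a - f x).
  by move=> fA; apply: affine_funB => //; exact: affine_fun_cst.
have vhat f : affine_fun setT f -> piecewise_affine (fun x : 'rV[R]_n => vertex_hat (f x)).
  move=> fA; apply: piecewise_affine_max => //.
  by apply: piecewise_affine_affine; exact: sub1.
have ehat f : affine_fun setT f -> piecewise_affine (fun x : 'rV[R]_n => edge_hat (f x)).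
  move=> fA; apply: piecewise_affine_max => //.
  apply: piecewise_affine_min; apply: piecewise_affine_affine => //; exact: sub1.
have ad f : affine_fun setT f -> piecewise_affine (fun x : 'rV[R]_n => arc_depth (f x)).
  move=> fA; apply: piecewise_affine_min; apply: piecewise_affine_affine => //; exact: sub1.
have ed f : affine_fun setT f -> piecewise_affine (fun x : 'rV[R]_n => edge_depth (f x)).
  move=> fA; apply: piecewise_affine_min => //.
  apply: piecewise_affine_min; apply: piecewise_affine_affine => //; exact: sub1.
have tA' := sub1 t 1 tA.
suff h' : piecewise_affine (fun x => strip_coord vtx nu h kappa (t x) (r x) (enum_val j)).
  by move: h'; congr piecewise_affine; apply/funext => x; rewrite mxE.
case: (enum_val j) => [v|[h'|[b|[l|h']]]] /=.
- by apply: piecewise_affineD; apply: piecewise_affine_mulrb; exact: vhat.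
- by apply: piecewise_affineD; apply: piecewise_affine_mulrb; exact: ehat.
- by apply: piecewise_affine_mulrb; exact: piecewise_affine_affine.
- case: kappa => // b; apply: piecewise_affineD; apply: piecewise_affine_mulrb;
    apply: piecewise_affine_min; [exact: ad|exact: vhat|exact: ad|exact: vhat].
- case: kappa => // b; apply: piecewise_affine_mulrb.
  by apply: piecewise_affine_min; [exact: ad|exact: ed].
Qed.

Lemma strips_polytopes : exists s :
    seq 'M[R]_(3, #|{: V + (E * bool + (bool + (E * bool + E * bool)))}|),
  polytopes s = strips vtx nu.
Proof.
have [sq sqP] := square_polytopes.
pose f (i : (E * bool) * option bool) (p : 'rV[R]_2) := strip vtx nu i.1 i.2 (p 0 0) (p 0 1).
have /choice[s sP] i : exists s', refines sq s' /\
    forall P, P \in s' -> affine_map (polytope P) (f i).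
  have [|s' r' f'] := @piecewise_affine_map_refines _ _ (f i) _ sq; last by exists s'.
  by move=> j; apply: strip_piecewise_affine; exact: affine_fun_coord.
exists (flatten [seq map (map_rows (f i)) (s i) | i <- enum {: (E * bool) * option bool}]).
apply/seteqP; split=> y.
  move=> /polytopes_flatten[i _]; rewrite (polytopes_map_rows (sP i).2).
  rewrite (refines_polytopes (sP i).1) => -[p /sqP[p0 p1] <-].
  by exists i.1, i.2, (p 0 0), (p 0 1).
move=> [h [kappa [t [r [t01 r01 ->]]]]]; apply/polytopes_flatten.
exists (h, kappa); first exact: mem_enum.
rewrite (polytopes_map_rows (sP _).2) (refines_polytopes (sP _).1).
exists (\row_j [:: t; r]`_j); last by rewrite /f !mxE.
by apply/sqP; rewrite !mxE.
Qed.

End PiecewiseAffine.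

(** * PL maps defined through parametrizations *)

Section Parametrizations.
Context {R : realType}.

(** The map is well defined because [psi2] makes every identification that [psi1] makes. On an image
    polytope it preserves weights, so it is affine by [affine_map_of_rows] even where [psi1] is
    degenerate. *)
Lemma PL_map_of_parametrizations (I : finType) k l m n (s : I -> seq 'M[R]_(k, l))
    (psi1 : I -> 'rV[R]_l -> 'rV[R]_m) (psi2 : I -> 'rV[R]_l -> 'rV[R]_n)
    (A : set 'rV[R]_m) :
  (forall i P, P \in s i -> affine_map (polytope P) (psi1 i)) ->
  (forall i P, P \in s i -> affine_map (polytope P) (psi2 i)) ->
  (forall i j p q, polytopes (s i) p -> polytopes (s j) q ->
     psi1 i p = psi1 j q -> psi2 i p = psi2 j q) ->
  (forall y, A y <-> exists i p, polytopes (s i) p /\ y = psi1 i p) ->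
  exists2 f, piecewise_linear A f &
    forall i p, polytopes (s i) p -> f (psi1 i p) = psi2 i p.
Proof.
move=> a1 a2 fib AE.
(* The common value of [psi2] over the fibre of [y]; the value 0 outside [A] is arbitrary. *)
have /choice[f fE] y : exists z, forall i p, polytopes (s i) p -> psi1 i p = y -> psi2 i p = z.
  have [/AE[i [p [sp ->]]]|nA] := pselect (A y).
    by exists (psi2 i p) => j q sq; exact: fib.
  by exists 0 => i p sp yE; exfalso; apply: nA; apply/AE; exists i, p.
have fpsi i p : polytopes (s i) p -> f (psi1 i p) = psi2 i p.
  by move=> sp; rewrite -(fE _ i p sp erefl).
exists f => //.
pose S := flatten [seq map (map_rows (psi1 i)) (s i) | i <- enum I].
have SE : polytopes S = A.
  apply/seteqP; split=> y.
    move=> /polytopes_flatten[i _]; rewrite (polytopes_map_rows (a1 i)) => -[p sp <-].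
    by apply/AE; exists i, p.
  move=> /AE[i [p [sp ->]]]; apply/polytopes_flatten; exists i; first exact: mem_enum.
  by rewrite (polytopes_map_rows (a1 i)); exists p.
apply: (@piecewise_linear_finite _ _ _ _ S) => [|a Aa|Q]; rewrite ?SE//; first by exists 1.
move=> /flatten_mapP[i _ /mapP[P Ps ->]].
apply: (@affine_mapS _ _ _ _ (polytope (map_rows (psi1 i) P))); first by move=> y [].
apply: (@affine_map_of_rows _ _ _ _ _ (map_rows (psi2 i) P)) => w sw.
rewrite -(affine_map_polytope (a1 _ _ Ps) sw) -(affine_map_polytope (a2 _ _ Ps) sw).
by apply: fpsi; exists P => //; exists w.
Qed.

Lemma PL_homeomorphic_of_parametrizations (I : finType) k l m n (s : I -> seq 'M[R]_(k, l))
    (psi1 : I -> 'rV[R]_l -> 'rV[R]_m) (psi2 : I -> 'rV[R]_l -> 'rV[R]_n)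
    (A : set 'rV[R]_m) (B : set 'rV[R]_n) :
  (forall i P, P \in s i -> affine_map (polytope P) (psi1 i)) ->
  (forall i P, P \in s i -> affine_map (polytope P) (psi2 i)) ->
  (forall i j p q, polytopes (s i) p -> polytopes (s j) q ->
     psi1 i p = psi1 j q <-> psi2 i p = psi2 j q) ->
  (forall y, A y <-> exists i p, polytopes (s i) p /\ y = psi1 i p) ->
  (forall y, B y <-> exists i p, polytopes (s i) p /\ y = psi2 i p) ->
  PL_homeomorphic A B.
Proof.
move=> a1 a2 fib AE BE.
have [|f fPL fE] := PL_map_of_parametrizations a1 a2 _ AE.
  by move=> i j p q sp sq; exact: (fib _ _ _ _ sp sq).1.
have [|g gPL gE] := PL_map_of_parametrizations a2 a1 _ BE.
  by move=> i j p q sp sq; exact: (fib _ _ _ _ sp sq).2.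
exists f; split=> //; split.
  by move=> y /AE[i [p [sp ->]]]; apply/BE; exists i, p; rewrite fE.
exists g; split=> //.
- by move=> y /BE[i [p [sp ->]]]; apply/AE; exists i, p; rewrite gE.
- by move=> y; rewrite inE => /AE[i [p [sp ->]]]; rewrite fE ?gE.
- by move=> y; rewrite inE => /BE[i [p [sp ->]]]; rewrite gE ?fE.
Qed.

(** In dimension 1 a polytope is spanned by its least and its greatest vertex. This gives a common
    shape to the pieces of the local covers, whose [k] varies from point to point. *)
Lemma polytope_interval k (P : 'M[R]_(k, 1)) :
  exists s : seq 'M[R]_(2, 1), polytopes s = polytope P.
Proof.
case: k P => [|k] P.
  exists [::]; apply/seteqP; split=> [x [] //|x [w [_]]].
  by rewrite big_ord0 => /esym/eqP; rewrite oner_eq0.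
have [i _ iP] := @Order.TotalTheory.arg_minP _ _ _ (0 : 'I_k.+1) predT (fun i => P i 0) isT.
have [j _ jP] := @Order.TotalTheory.arg_maxP _ _ _ (0 : 'I_k.+1) predT (fun i => P i 0) isT.
pose Q : 'M[R]_(2, 1) := \matrix_(l, c) (if l == 0 then P i 0 else P j 0).
have Q0 : row 0 Q = row i P by apply/rowP => c; rewrite ord1 !mxE.
have Q1 : row 1 Q = row j P by apply/rowP => c; rewrite ord1 !mxE.
exists [:: Q]; apply/seteqP; split=> x.
  move=> [Q']; rewrite inE => /eqP->; apply: polytope_sub => l.
  have [->|l0] := eqVneq l 0; first by rewrite Q0; exact: polytope_row.
  suff -> : l = 1 by rewrite Q1; exact: polytope_row.
  by case: l l0 => [[|[|//]] h] // _; exact: val_inj.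
move=> Px; exists Q; first by rewrite inE.
apply: polytope_sub Px => l.
have il : P i 0 <= P l 0 by exact: iP.
have lj : P l 0 <= P j 0 by exact: jP.
have [ij|ij] := eqVneq (P i 0) (P j 0).
  suff -> : row l P = row 0 Q by exact: polytope_row.
  by rewrite Q0; apply/rowP => c; rewrite ord1 !mxE; apply/le_anti; rewrite il ij lj.
have d0 : 0 < P j 0 - P i 0.
  by rewrite subr_gt0 lt_neqAle ij (le_trans il).
pose t := (P l 0 - P i 0) / (P j 0 - P i 0).
have -> : row l P = (1 - t) *: row 0 Q + t *: row 1 Q.
  rewrite Q0 Q1; apply/rowP => c; rewrite ord1 !mxE /t; field.
  by rewrite gt_eqF.
apply: polytope_convex; [exact: polytope_row|exact: polytope_row|].
apply/andP; split; first by apply: divr_ge0; [rewrite subr_ge0|exact: ltW].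
by rewrite /t ler_pdivrMr// mul1r lerD2r.
Qed.

(** Compactness of the segment, by a supremum: a local cover at the supremum carries a list that
    nearly reaches it further, unless 1 is already within reach. *)
Lemma unit_segment_cover n (f : 'rV[R]_1 -> 'rV[R]_n) : piecewise_linear unit_segment f ->
  exists s : seq 'M[R]_(2, 1), polytopes s = unit_segment /\
    forall P, P \in s -> affine_map (polytope P) f.
Proof.
move=> fPL.
(* The pieces must cover the segment from 0 to [t] but may overshoot [t], so a list is prolonged by
   appending a local cover. *)
pose good (t : R) := 0 <= t <= 1 /\ exists s : seq 'M[R]_(2, 1), [/\ polytopes s `<=` unit_segment,
  forall x : 'rV[R]_1, 0 <= x 0 0 <= t -> polytopes s x &
    forall P, P \in s -> affine_map (polytope P) f].
have step (t : R) : 0 <= t <= 1 -> exists2 d : R, 0 < d & forall t', good t' -> t - d < t' ->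
    forall t'', 0 <= t'' <= 1 -> t'' < t + d -> good t''.
  move=> t01; have ut : unit_segment (const_mx t : 'rV[R]_1) by rewrite /unit_segment/= mxE.
  have [k [s [[sA /within_nbhsP[d d0 sd]] fs]]] := fPL _ ut.
  have /choice[I IE] (P : 'M[R]_(k, 1)) := polytope_interval P.
  exists d => // t' [t'01 [s' [s'u s't fs']]] tt' t'' t''01 t''t; split=> //.
  exists (s' ++ flatten (map I s)).
  have catE x : polytopes (s' ++ flatten (map I s)) x <->
      polytopes s' x \/ exists2 P, P \in s & polytope P x.
    split=> [[Q]|[[Q Qs Qx]|[P Ps]]].
    - rewrite mem_cat => /orP[Qs Qx|Qs Qx]; first by left; exists Q.
      have /polytopes_flatten[P Ps] : polytopes (flatten (map I s)) x by exists Q.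
      by rewrite IE => Px; right; exists P.
    - by exists Q => //; rewrite mem_cat Qs.
    - rewrite -IE => Px.
      have [Q Qs Qx] : polytopes (flatten (map I s)) x by apply/polytopes_flatten; exists P.
      by exists Q => //; rewrite mem_cat Qs orbT.
  split=> [x /catE[/s'u//|[P Ps]]|x /andP[x0 xt]|Q]; first exact: sA.
    apply/catE; have [xt'|xt'] := leP (x 0 0) t'.
      by left; apply: s't; rewrite x0.
    right; apply: sd; first by rewrite /unit_segment/= x0; case/andP: t''01 => *; lra.
    rewrite norm_rV1_lt// !mxE ltr_norml; apply/andP; split; lra.
  rewrite mem_cat => /orP[/fs'//|/flatten_mapP[P Ps QI]].
  apply: affine_mapS (fs P Ps); rewrite -IE => x Qx; by exists Q.
have good0 : good 0.
  split; first by rewrite lexx ler01.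
  (* A degenerate segment: both end points are 0. *)
  exists [:: 0 : 'M[R]_(2, 1)].
  have pE x : polytope (0 : 'M[R]_(2, 1)) x -> x = 0 by move=> [w _ <-]; rewrite mulmx0.
  split.
  - by move=> x [P]; rewrite inE => /eqP-> /pE->; rewrite /unit_segment/= mxE lexx ler01.
  - move=> x /andP[x0 x1]; exists 0; first by rewrite inE.
    have -> : x = row 0 (0 : 'M[R]_(2, 1)); last exact: polytope_row.
    by apply/rowP => j; rewrite ord1 !mxE; apply/le_anti; rewrite x0 x1.
  - by move=> P; rewrite inE => /eqP->; exists 0, (f 0) => x /pE->; rewrite mul0mx add0r.
have gub : has_ubound [set t | good t] by exists 1 => t [/andP[]].
have gsup : has_sup [set t | good t] by split; [exists 0|].
pose u := sup [set t | good t].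
have u0 : 0 <= u by exact: sup_upper_bound.
have u1 : u <= 1 by apply: ge_sup => [|t [/andP[]]]; first by exists 0.
have [|d d0 dP] := step u; first by rewrite u0.
have [t gt tu] : exists2 t, good t & u - d < t.
  exact: (sup_adherent d0 gsup).
have g1 : good 1.
  have [ud|ud] := ltP 1 (u + d).
    by apply: (dP t gt tu) => //; rewrite ler01 lexx.
  have : good (u + d / 2).
    apply: (dP t gt tu); first by apply/andP; split; lra.
    by rewrite ltrD2l ltr_pdivrMr// ltr_pMr// ltr1n.
  move=> /(sup_upper_bound gsup); rewrite -/u; lra.
have [_ [s [su s1 fs]]] := g1; exists s; split=> //.
by apply/seteqP; split=> // x; exact: s1.
Qed.

End Parametrizations.

(** * The three half-edges at a vertex in cyclic order *)

Section HalfEdges.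
Variable G : multigraph.
Local Notation H := (edge G * bool)%type.

Definition half_edge_vertex (h : H) : vertex G := if h.2 then (ends h.1).2 else (ends h.1).1.

Definition half_edges_at (v : vertex G) : seq H := enum [pred h | half_edge_vertex h == v].

(** The cyclic order at a vertex is that of [enum], closed up modulo 3. Under trivalence the list
    has three entries, so the default of [nth] is never returned. *)
Definition next_half_edge (h : H) : H :=
  nth h (half_edges_at (half_edge_vertex h))
    ((index h (half_edges_at (half_edge_vertex h))).+1 %% 3).

(** A loop gives two half-edges at its vertex, in agreement with its contribution 2 to the
    degree. *)
Lemma size_half_edges_at v : size (half_edges_at v) = degree v.
Proof.
rewrite -cardE /degree -!sum1_card.
rewrite (eq_bigl (fun h : H => half_edge_vertex h == v)) => [|h]; last by rewrite !inE.
rewrite big_mkcond -(pair_bigA _ (fun e b => if half_edge_vertex (e, b) == v then 1 else 0)%N)/=.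
under eq_bigr do rewrite big_bool /half_edge_vertex /=.
rewrite big_split/= addnC; congr (_ + _)%N; rewrite -big_mkcond; apply: eq_bigl => e;
by rewrite !inE.
Qed.

Lemma half_edges_at_vertex v : trivalent G -> exists hh : 'I_3 -> H,
  [/\ injective hh, forall i, half_edge_vertex (hh i) = v,
      forall h, half_edge_vertex h = v -> exists i, h = hh i &
      forall i, next_half_edge (hh i) = hh (i + 1)%R].
Proof.
move=> /(_ v); rewrite -size_half_edges_at.
have un : uniq (half_edges_at v) by exact: enum_uniq.
have mem h : (h \in half_edges_at v) = (half_edge_vertex h == v) by rewrite mem_enum inE.
rewrite /next_half_edge; set s := half_edges_at v in un mem *.
case sE: s => [//|x0 s'] s3; rewrite -sE in s3.
exists (fun i => nth x0 s i).
have vtxE (i : 'I_3) : half_edge_vertex (nth x0 s i) = v.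
  by apply/eqP; rewrite -mem mem_nth// s3.
split=> //.
- move=> i j /eqP; rewrite nth_uniq ?s3// => /eqP; exact: val_inj.
- move=> h /eqP; rewrite -mem => hs.
  have hi : (index h s < 3)%N by rewrite -s3 index_mem.
  by exists (Ordinal hi); rewrite /= nth_index.
- move=> i; rewrite vtxE -/s index_uniq ?s3//.
  rewrite (set_nth_default x0) ?s3 ?ltn_mod//; congr nth.
  by rewrite /= modnDmr addn1.
Qed.

End HalfEdges.

(** * Exclusivity of the two kinds of points *)

Section Boundary.
Context {R : realType}.

Lemma interior_not_boundary n (F : set 'rV[R]_n) x :
  F x -> interior_point F x -> ~ boundary_point F x.
Proof.
move=> Fx ix bx.
have [k [N [Nx planes]]] : exists k (N : set 'rV[R]_k), modelled_on F N x /\ has_common_planes N.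
  case: ix => h; do 2 eexists; split; try exact: h.
  - exact: open_disk_has_common_planes.
  - exact: Y_times_open_has_common_planes.
  - exact: cone_tetrahedron_has_common_planes.
have [l [M [Mx cut]]] : exists l (M : set 'rV[R]_l), modelled_on F M x /\ has_cut_ray M.
  case: bx => h; do 2 eexists; split; try exact: h.
  - exact: half_disk_has_cut_ray.
  - exact: Y_half_has_cut_ray.
  - exact: disk_with_quarter_plane_has_cut_ray.
exact: (cut_ray_not_common_planes Fx Mx Nx cut planes).
Qed.

Lemma polytopes_fake_surface n (s : seq 'M[R]_(3, n)) (P : 'M[R]_(3, n)) :
  affinely_independent P -> polytope P `<=` polytopes s ->
  (forall x, polytopes s x -> interior_point (polytopes s) x \/ boundary_point (polytopes s) x) ->
  fake_surface_with_boundary (polytopes s).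
Proof.
move=> iP Ps pts; split=> //; first exact: polytopes_compact.
split; last by exists P.
move=> a sa; exists s; split; first by move=> Q Qs x Qx; exists Q.
by apply/within_nbhsP; exists 1.
Qed.

End Boundary.

(** * The surface of a tetrahedron *)

Section EmptyBoundary.
Context {R : realType}.

Definition tetrahedron_faces : seq 'M[R]_(3, 4) :=
  [seq \matrix_(l, j) (j == lift i l)%:R | i <- enum 'I_4].

Lemma tetrahedron_facesP (x : 'rV[R]_4) : polytopes tetrahedron_faces x <->
  [/\ forall i, 0 <= x 0 i, \sum_i x 0 i = 1 & exists i, x 0 i = 0].
Proof.
have mulE (w : 'rV[R]_3) (i : 'I_4) : w *m (\matrix_(l, j) (j == lift i l)%:R : 'M[R]_(3, 4)) =
    \row_j if unlift i j is Some l then w 0 l else 0.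
  apply/rowP => j; rewrite !mxE; case: unliftP => [l ->|->].
    rewrite (bigD1 l)//= !mxE eqxx mulr1 big1 ?addr0// => l' ll'.
    by rewrite mxE (inj_eq lift_inj) eq_sym (negPf ll') mulr0.
  rewrite big1// => l _; rewrite mxE (_ : (i == lift i l) = false) ?mulr0//.
  by apply/negbTE; exact: (@neq_lift 4 i l).
split=> [[_ /mapP[i _ ->] [w [w0 w1] <-]]|[x0 x1 [i xi]]].
  rewrite mulE; split.
  - by move=> j; rewrite mxE; case: unliftP.
  - rewrite (bigD1 i)//= mxE unlift_none add0r -[RHS]w1.
    rewrite (reindex_onto (lift i) (fun j => odflt 0 (unlift i j)))/=.
      apply: eq_big => [l|l _]; last by rewrite mxE liftK.
      by rewrite liftK eqxx andbT eq_sym (@neq_lift 4 _ l).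
    by move=> j; case: unliftP => [l ->//|->]; rewrite eqxx.
  - by exists i; rewrite mxE unlift_none.
exists (\matrix_(l, j) (j == lift i l)%:R); first by apply: map_f; rewrite mem_enum.
exists (\row_l x 0 (lift i l)).
  split=> [l|]; first by rewrite mxE.
  rewrite -[RHS]x1 [RHS](bigD1 i)//= xi add0r.
  rewrite [RHS](reindex_onto (lift i) (fun j => odflt 0 (unlift i j)))/=.
    apply: eq_big => [l|l _]; last by rewrite mxE.
    by rewrite liftK eqxx andbT eq_sym (@neq_lift 4 _ l).
  by move=> j; case: unliftP => [l ->//|->]; rewrite eqxx.
rewrite mulE; apply/rowP => j; rewrite mxE; case: unliftP => [l ->|->] //.
by rewrite mxE.
Qed.

(* Near a point with x_p > 0, the three other coordinates have minimum 0, hence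
   are determined by their differences. *)
Lemma tetrahedron_faces_disk (x : 'rV[R]_4) : polytopes tetrahedron_faces x ->
  modelled_on (polytopes tetrahedron_faces) open_disk x.
Proof.
move=> sx; have /tetrahedron_facesP[x0 x1 [iz xz]] := sx.
have [p xp] : exists p, 0 < x 0 p.
  apply: contrapT => h; have : \sum_i x 0 i = 0.
    apply: big1 => i _; apply/le_anti; rewrite x0 andbT leNgt; apply/negP => xi.
    by apply: h; exists i.
  by rewrite x1 => /eqP; rewrite oner_eq0.
pose q (y : 'rV[R]_4) (l : 'I_3) := y 0 (lift p l).
have sumq (y : 'rV[R]_4) : \sum_i y 0 i = y 0 p + (q y 0 + q y 1 + q y 2).
  rewrite (bigD1 p)//=; congr (_ + _).
  rewrite (reindex_onto (lift p) (fun j => odflt 0 (unlift p j)))/=; last first.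
    by move=> j; case: unliftP => [l ->//|->]; rewrite eqxx.
  rewrite (eq_bigl predT) => [|l]; last by rewrite liftK eqxx andbT eq_sym (@neq_lift 4 _ l).
  rewrite !big_ord_recl big_ord0 addr0 addrA.
  by congr (_ + _ + _); rewrite /q; congr (y 0 (lift p _)); exact: val_inj.
have qA l : affine_fun setT (q^~ l) by exact: affine_fun_coord.
pose d (y : 'rV[R]_4) := y 0 p - x 0 p / 2.
have dA : affine_fun setT d.
  by apply: affine_funB; [exact: affine_fun_coord|exact: affine_fun_cst].
have dx : 0 < d x by rewrite /d; lra.
pose A0 := q x 0 - q x 2; pose B0 := q x 1 - q x 2.
have near1 y : polytopes tetrahedron_faces y -> 0 <= d y ->
    [/\ forall l, 0 <= q y l, exists l, q y l = 0 & y 0 p = 1 - (q y 0 + q y 1 + q y 2)].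
  move=> /tetrahedron_facesP[y0 y1 [i yi]] dy; split.
  - by move=> l; exact: y0.
  - move: yi; case: (unliftP p i) => [l ->|->] yi; first by exists l.
    by move: dy; rewrite /d yi; lra.
  - by rewrite -y1 sumq addrK.
have ext (y z : 'rV[R]_4) : y 0 p = z 0 p -> (forall l, q y l = q z l) -> y = z.
  by move=> ep el; apply/rowP => i; case: (unliftP p i) => [l ->|->] //; exact: el.
have mins (y z : 'I_3 -> R) : (forall l, 0 <= y l) -> (exists l, y l = 0) ->
    (forall l, 0 <= z l) -> (exists l, z l = 0) -> y 0 - y 2 = z 0 - z 2 ->
    y 1 - y 2 = z 1 - z 2 -> forall l, y l = z l.
  move=> y0 [l1 yl1] z0 [l2 zl2] e1 e2.
  have e l : y l - y 2 = z l - z 2 by move: l; apply: forall_I3 => //; rewrite !subrr.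
  have := e l1; have := e l2; have := y0 l2; have := z0 l1 => h1 h2 h3 h4 l.
  by have := e l; lra.
apply: (@modelled_on_open_disk _ _ _ _ _ d d sx dA dA dx dx
  (fun y => q y 0 - q y 2 - A0) (fun y => q y 1 - q y 2 - B0)).
- by apply: affine_funB; [exact: affine_funB|exact: affine_fun_cst].
- by apply: affine_funB; [exact: affine_funB|exact: affine_fun_cst].
- by rewrite subrr.
- by rewrite subrr.
- move=> y z [sy dy _] [sz dz _] e1 e2.
  have [y0 yz yp] := near1 y sy dy; have [z0 zz zp] := near1 z sz dz.
  have e := mins (q y) (q z) y0 yz z0 zz (addIr _ e1) (addIr _ e2).
  by apply: ext => //; rewrite yp zp !e.
(* Perturbing by less than r and subtracting a minimum that is at least -r adds at most 6 r to the
   sum of the three coordinates. This is a third of [x 0 p], so coordinate [p] stays above half of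
   it. *)
- exists (x 0 p / 2 / 9) => [|a b]; first by rewrite !divr_gt0.
  set r := x 0 p / 2 / 9.
  rewrite !ltr_norml => /andP[a1 a2] /andP[b1 b2].
  have [xq0 [lx xlx] xpE] := near1 x sx (ltW dx).
  (* The perturbed coordinates have the prescribed differences; subtracting their minimum brings the
     point back to a face. *)
  pose u l := q x l + (if l == 0 :> 'I_3 then a else if l == 1 then b else 0).
  pose mn := Num.min (u 0) (Num.min (u 1) (u 2)).
  have [mn0 mn1 mn2] : [/\ mn <= u 0, mn <= u 1 & mn <= u 2].
    by split; rewrite /mn !ge_min lexx ?orbT.
  have mnE : exists l, mn = u l.
    rewrite /mn; case: (leP (u 1) (u 2)) => _; case: leP => _;
    by [exists 0|exists 1|exists 2].
  have mnr : - r <= mn <= r.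
    have ux l : q x l - r <= u l <= q x l + r.
      have r0 : 0 < r by rewrite /r !divr_gt0.
      by rewrite /u; case: (l == 0); case: (l == 1); apply/andP; split; lra.
    have mnl l : mn <= u l by move: l; apply: forall_I3.
    have [l lE] := mnE; apply/andP; split.
      by rewrite lE; have /andP[h _] := ux l; have := xq0 l; lra.
    by have := mnl lx; have /andP[_ h] := ux lx; lra.
  pose y : 'rV[R]_4 := \row_i if unlift p i is Some l then u l - mn
    else 1 - ((u 0 - mn) + (u 1 - mn) + (u 2 - mn)).
  have qy l : q y l = u l - mn by rewrite /q mxE liftK.
  have yp : y 0 p = 1 - ((u 0 - mn) + (u 1 - mn) + (u 2 - mn)) by rewrite mxE unlift_none.
  have dy : 0 <= d y.
    rewrite /d yp /u /=; case/andP: mnr => m1 m2.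
    have rE : x 0 p = r * 18 by rewrite /r; field.
    by move: xpE; lra.
  exists y.
    split=> //; apply/tetrahedron_facesP; split.
    - move=> i; case: (unliftP p i) => [l ->|->].
        by rewrite -/(q y l) qy subr_ge0; move: l; apply: forall_I3.
      by move: dy; rewrite /d; lra.
    - by rewrite sumq yp !qy; lra.
    - by have [l lE] := mnE; exists (lift p l); rewrite -/(q y l) qy lE subrr.
  by rewrite !qy /A0 /B0 /u /=; split; lra.
Qed.

Lemma empty_fake_boundary : exists n (F : set 'rV[R]_n),
  fake_surface_with_boundary F /\ fake_boundary F = set0.
Proof.
exists 4, (polytopes tetrahedron_faces).
have pts x : polytopes tetrahedron_faces x -> interior_point (polytopes tetrahedron_faces) x.
  by move=> sx; constructor 1; exact: tetrahedron_faces_disk.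
split; last first.
  rewrite -subset0 => x [Fx bx]; exact: (interior_not_boundary Fx (pts x Fx) bx).
pose P : 'M[R]_(3, 4) := \matrix_(l, j) (j == lift 0 l)%:R.
apply: (@polytopes_fake_surface _ _ _ P).
- apply: inj_row_free => w; rewrite mul_mx_row -[RHS]row_mx0 => /eq_row_mx[wP _].
  apply/rowP => l; move/rowP: wP => /(_ (lift 0 l)); rewrite !mxE => <-.
  rewrite (bigD1 l)//= !mxE eqxx mulr1 big1 ?addr0// => l' ll'.
  by rewrite mxE (inj_eq lift_inj) eq_sym (negPf ll') mulr0.
- by move=> x Px; exists P => //; apply: map_f; rewrite mem_enum.
- by move=> x /pts; left.
Qed.

End EmptyBoundary.

(** * The strip surface of a trivalent graph and its boundary *)

Section StripSurface.
Context {R : realType}.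
Variable G : multigraph.
Hypothesis tG : trivalent G.
Local Notation H := (edge G * bool)%type.
Local Notation vtx := (@half_edge_vertex G).
Local Notation nu := (@next_half_edge G).
Local Notation strip := (@strip R (vertex G) (edge G) vtx nu).
Local Notation strips := (@strips R (vertex G) (edge G) vtx nu).
Local Notation ambient_coord := (@ambient_coord R (vertex G) (edge G)).
Local Notation L h := (ambient_coord (inr (inl h))).

Lemma strips_half y : strips y -> exists h kappa t r,
  [/\ 0 <= t <= 2^-1, 0 <= r <= 1 & y = strip h kappa t r].
Proof.
move=> [h [kappa [t [r [/andP[t0 t1] r01 ->]]]]]; have [t2|t2] := leP t 2^-1.
  by exists h, kappa, t, r; rewrite t0.
exists (flip h), kappa, (1 - t), r; rewrite strip_flip; split=> //.
by apply/andP; split; lra.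
Qed.

Lemma whisker_end_boundary h t : 0 <= t <= 1 -> boundary_point strips (strip h None t 1).
Proof.
have [s sE] := @strips_polytopes R (vertex G) (edge G) vtx nu.
wlog t2 : h t / t <= 2^-1.
  move=> wl /andP[t0 t1]; have [t2|t2] := leP t 2^-1; first by apply: wl; rewrite ?t0.
  rewrite -strip_flip; apply: wl; first lra.
  by apply/andP; split; lra.
move=> /andP[t0 t1]; rewrite -sE; have [->|tn0] := eqVneq t 0.
  have [hh [hh1 hh2 hh3 hh4]] := half_edges_at_vertex (vtx h) tG.
  have [i ->] := hh3 h erefl; constructor 2.
  exact: (vertex_chart_whisker_end sE hh1 hh2 hh3).
constructor 1; apply: (edge_chart_whisker_end sE).
by rewrite lt_neqAle eq_sym tn0 t0.
Qed.

Lemma strips_points y : strips y ->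
  (exists h t, 0 <= t <= 1 /\ y = strip h None t 1) \/ interior_point strips y.
Proof.
have [s sE] := @strips_polytopes R (vertex G) (edge G) vtx nu.
move=> /strips_half[h [kappa [t [r [/andP[t0 t2] /andP[r0 r1] ->]]]]].
have rP : [\/ r = 0, 0 < r < 1 | r = 1].
  have [->|rn0] := eqVneq r 0; first by constructor 1.
  have [->|rn1] := eqVneq r 1; first by constructor 3.
  by constructor 2; rewrite !lt_neqAle eq_sym rn0 rn1 r0 r1.
have t01 : 0 <= t <= 1 by apply/andP; split; lra.
have [end_|nend] := pselect (kappa = None /\ r = 1).
  by left; exists h, t; case: end_ => -> ->.
right; rewrite -sE; have [t00|tn0] := eqVneq t 0.
  have [hh [hh1 hh2 hh3 hh4]] := half_edges_at_vertex (vtx h) tG.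
  have [i hE] := hh3 h erefl; rewrite t00 hE.
  case: rP nend => [->|rr|->] nend.
  - by constructor 3; exact: (vertex_chart_seam sE hh1 hh2 hh3 hh4).
  - case: (kappa) => [b|].
      by constructor 1; exact: (vertex_chart_arc sE hh1 hh2 hh3 hh4).
    by constructor 2; exact: (vertex_chart_whisker sE hh1 hh2 hh3).
  - case: kappa nend => [b _|[] //].
    by constructor 1; exact: (vertex_chart_arcs sE hh1 hh2 hh3 hh4).
have tb : 0 < t <= 2^-1 by rewrite lt_neqAle eq_sym tn0 t0.
case: rP nend => [->|rr|->] nend.
- by constructor 2; exact: (edge_chart_seam sE).
- case: (kappa) => [b|]; constructor 1.
    exact: (edge_chart_arc sE).
  exact: (edge_chart_whisker sE).
- case: kappa nend => [b _|[] //].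
  by constructor 1; exact: (edge_chart_arcs sE).
Qed.

Lemma strips_fake_boundary y : fake_boundary strips y <->
  exists h t, 0 <= t <= 1 /\ y = strip h None t 1.
Proof.
split=> [[sy by_]|[h [t [t01 ->]]]].
  by have [//|/(interior_not_boundary sy)] := strips_points sy.
split; last exact: whisker_end_boundary.
by exists h, None, t, 1; rewrite ler01 lexx.
Qed.

Lemma strips_fake_surface (e0 : edge G) : fake_surface_with_boundary strips.
Proof.
have [s sE] := @strips_polytopes R (vertex G) (edge G) vtx nu.
pose h : H := (e0, false).
(* A triangle in a whisker strip, with corners (0, 0), (1/3, 0) and (0, 1): up to [t = 3^-1] all the
   hats are affine. *)
pose Q : 'M[R]_(3, 2) := \matrix_(i, j) [:: [:: 0; 0]`_j; [:: 3^-1; 0]`_j; [:: 0; 1]`_j]`_i.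
pose f (p : 'rV[R]_2) := strip h None (p 0 0) (p 0 1).
have QD p : polytope Q p -> 0 <= p 0 0 <= 3^-1 /\ 0 <= p 0 1 <= 1.
  move=> [w [w0 w1] <-]; rewrite !mxE !big_ord_recl !big_ord0 !mxE /=.
  move: w1; rewrite !big_ord_recl big_ord0.
  have := w0 (lift ord0 ord0); have := w0 (lift ord0 (lift ord0 ord0)); have := w0 ord0.
  by move=> *; split; apply/andP; split; lra.
have fA : affine_map (polytope Q) f.
  apply/affine_mapP => j.
  have tA : affine_fun (polytope Q) (fun p => p 0 0) by exact: affine_fun_coord.
  have rA : affine_fun (polytope Q) (fun p => p 0 1) by exact: affine_fun_coord.
  have mulrbA (g : 'rV[R]_2 -> R) (b : bool) :
      affine_fun (polytope Q) g -> affine_fun (polytope Q) (fun p => g p *+ b).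
    case: b => // _; apply: eq_affine_fun (affine_fun_cst _ 0) => x _.
    by rewrite mulr0n.
  have vA : affine_fun (polytope Q) (fun p => vertex_hat (p 0 0)).
    apply: eq_affine_fun (affine_funB (affine_fun_cst _ 3^-1) tA) => p /QD[/andP[? ?] _].
    by rewrite vertex_hat_small.
  have eA : affine_fun (polytope Q) (fun p => edge_hat (p 0 0)).
    by apply: eq_affine_fun tA => p /QD[? _]; rewrite edge_hat_small.
  have vA' : affine_fun (polytope Q) (fun p => vertex_hat (1 - p 0 0)).
    apply: eq_affine_fun (affine_fun_cst _ 0) => p /QD[/andP[? ?] _].
    by rewrite vertex_hat_large//; lra.
  have eA' : affine_fun (polytope Q) (fun p => edge_hat (1 - p 0 0)).
    apply: eq_affine_fun (affine_fun_cst _ 0) => p /QD[/andP[? ?] _].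
    by rewrite edge_hat_large//; lra.
  suff h' : affine_fun (polytope Q)
      (fun p => strip_coord vtx nu h None (p 0 0) (p 0 1) (enum_val j)).
    by apply: eq_affine_fun h' => p _; rewrite mxE.
  case: (enum_val j) => [v|[h'|[b|[l|h']]]] /=.
  - by apply: affine_funD; exact: mulrbA.
  - by apply: affine_funD; exact: mulrbA.
  - exact: mulrbA.
  - exact: affine_fun_cst.
  - exact: affine_fun_cst.
have rowsE i : row i (map_rows f Q) = strip h None (Q i 0) (Q i 1).
  by apply/rowP => j; rewrite !mxE.
rewrite -sE; apply: (@polytopes_fake_surface _ _ _ (map_rows f Q)).
- apply: inj_row_free => w; rewrite mul_mx_row -[RHS]row_mx0 => /eq_row_mx[wP /rowP/(_ 0)].
  (* [L h], [W] and the column of ones already give an invertible 3 by 3 matrix at the three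
     corners. *)
  have key i : \sum_l w 0 l * ambient_coord i (strip h None (Q l 0) (Q l 1)) = 0.
    move/rowP: wP => /(_ (enum_rank i)); rewrite [LHS]mxE [RHS]mxE => e.
    rewrite -[RHS]e; apply: eq_bigr => l _; congr (_ * _).
    by rewrite -rowsE /ambient_coord [LHS]mxE.
  have := key (inr (inl h)); have := key (inr (inr (inl false))).
  rewrite !mxE !big_ord_recl !big_ord0 /= !strip_W_None !strip_L ?mxE ?eqxx /=; last 3 first.
  - by rewrite lexx invr_ge0 ler0n.
  - by rewrite lexx invr_ge0 ler0n.
  - by rewrite lexx invr_ge0 ler0n.
  rewrite ?mulr0 ?mulr1 ?mulr1n ?addr0 ?add0r => e2 e1 e3.
  have w2 : w 0 (lift ord0 (lift ord0 ord0)) = 0 by lra.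
  have w1 : w 0 (lift ord0 ord0) = 0 by lra.
  have w0 : w 0 ord0 = 0 by lra.
  apply/rowP; apply: forall_I3; rewrite mxE.
  + by rewrite -[RHS]w0; congr (w 0 _); exact: val_inj.
  + by rewrite -[RHS]w1; congr (w 0 _); exact: val_inj.
  + by rewrite -[RHS]w2; congr (w 0 _); exact: val_inj.
- rewrite (polytope_map_rows fA) sE => _ [p /QD[/andP[p0 p1] p2] <-].
  by exists h, None, (p 0 0), (p 0 1); split=> //; apply/andP; split; lra.
- move=> y; rewrite sE => sy; have [[h' [t [t01 ->]]]|] := strips_points sy; last by left.
  by right; exact: whisker_end_boundary.
Qed.

Definition end_vertex (e : edge G) (t : R) : option (vertex G) :=
  if t == 0 then Some (ends e).1 else if t == 1 then Some (ends e).2 else None.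

(** The gluing of edges at vertices in purely combinatorial form, against which both the whisker
    ends and an arbitrary realization are compared. *)
Definition same_point (e : edge G) (t : R) (e' : edge G) (t' : R) : Prop :=
  (e = e' /\ t = t') \/ (end_vertex e t = end_vertex e' t' /\ end_vertex e t <> None).

Lemma end_vertexP e (t : R) : 0 <= t <= 1 ->
  (0 < t < 1 /\ end_vertex e t = None) \/
  exists b : bool, t = b%:R /\ end_vertex e t = Some (vtx (e, b)).
Proof.
move=> /andP[t0 t1]; rewrite /end_vertex.
have [->|tn0] := eqVneq t 0; first by right; exists false.
have [->|tn1] := eqVneq t 1; first by right; exists true.
by left; rewrite !lt_neqAle eq_sym tn0 tn1 t0 t1.
Qed.

Lemma whisker_end_eq e (t : R) e' t' : 0 <= t <= 1 -> 0 <= t' <= 1 ->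
  strip (e, false) None t 1 = strip (e', false) None t' 1 <-> same_point e t e' t'.
Proof.
have endE e1 (b : bool) : strip (e1, false) None b%:R 1 = strip (e1, b) None 0 1.
  by case: b => //; rewrite -[LHS]strip_flip subrr.
(* At an inner point the hat of the half-edge identifies the edge, and [strip_t] recovers the
   parameter. *)
have inner e1 (t1 : R) e2 t2 : 0 < t1 < 1 ->
    strip (e1, false) None t1 1 = strip (e2, false) None t2 1 -> 0 <= t2 <= 1 ->
    e1 = e2 /\ t1 = t2.
  have main b (t3 t4 : R) : 0 < t3 < 2 / 3 ->
      strip (e1, b) None t3 1 = strip (e2, b) None t4 1 -> 0 <= t4 <= 1 -> e1 = e2 /\ t3 = t4.
    move=> t3b eqs t4b; have Lp : 0 < L (e1, b) (strip (e2, b) None t4 1).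
      by rewrite -eqs strip_Lh edge_hat_gt0.
    have [ee|ne] := eqVneq e1 e2; last first.
      move: Lp; rewrite ambient_coord_strip /flip /= !xpair_eqE (negPf ne) /=.
      by rewrite !mulr0n addr0 ltxx.
    split=> //; move: ee eqs Lp => <- eqs; rewrite strip_Lh edge_hat_gt0 => t4p.
    have w (x : R) : 0 < x < 2 / 3 -> 0 <= x <= 2 / 3 by move=> /andP[/ltW -> /ltW ->].
    rewrite -(strip_t vtx nu (e1, b) None 1 (w _ t3b)) eqs.
    by rewrite (strip_t vtx nu (e1, b) None 1 (w _ t4p)).
  (* The hat at the start of the edge reaches only to 2/3; beyond, both edges are read from their
     other ends. *)
  move=> /andP[t0 t1']; have [t2'|t2'] := ltP t1 (2 / 3).
    by move=> eqs tb; apply: (main false) => //; rewrite t0.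
  move=> eqs /andP[t20 t21].
  have eqs' : strip (e1, true) None (1 - t1) 1 = strip (e2, true) None (1 - t2) 1.
    by rewrite -[(e1, true)]/(flip (e1, false)) -[(e2, true)]/(flip (e2, false)) !strip_flip.
  have [||ee te] := main true _ _ _ eqs'; try (by apply/andP; split; lra).
  by split=> //; lra.
move=> tb tb'; split.
  move=> eqs; have [[ti _]|[b [tE vE]]] := end_vertexP e tb.
    by left; exact: inner eqs tb'.
  have [[ti' _]|[b' [tE' vE']]] := end_vertexP e' tb'.
    by have [-> ->] := inner _ _ _ _ ti' (esym eqs) tb; left.
  right; rewrite vE vE'; split=> //; congr Some.
  (* The hat of [vtx (e, b)] is [3^-1] over this vertex and 0 over every other one, so it identifies
     the vertex. *)
  have z3 : 0 <= (0 : R) <= 3^-1 by rewrite lexx invr_ge0 ler0n.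
  have := strip_U vtx nu (e, b) None 1 z3.
  have -> : strip (e, b) None 0 1 = strip (e', b') None 0 1 by rewrite -!endE -tE -tE'.
  rewrite ambient_coord_strip /= subr0 (@vertex_hat_large _ 1); last lra.
  rewrite mul0rn addr0; have [//|_] := eqVneq; rewrite mulr0n => z; exfalso; lra.
move=> [[-> ->]//|[evE evn]].
have [[_ n]|[b [tE vE]]] := end_vertexP e tb; first by rewrite n in evn.
have [[_ n]|[b' [tE' vE']]] := end_vertexP e' tb'; first by rewrite evE n in evn.
rewrite tE tE' !endE; apply: glue_vertex_None.
by move: evE; rewrite vE vE' => -[].
Qed.

Lemma realization_eq m (p : vertex G -> 'rV[R]_m) (c : edge G -> R -> 'rV[R]_m) e (t : R) e' t' :
  injective p -> (forall e, c e 0 = p (ends e).1 /\ c e 1 = p (ends e).2) ->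
  (forall e e' (t t' : R), 0 < t < 1 -> 0 < t' < 1 -> c e t = c e' t' -> e = e' /\ t = t') ->
  (forall e (t : R) v, 0 < t < 1 -> c e t <> p v) ->
  0 <= t <= 1 -> 0 <= t' <= 1 -> c e t = c e' t' <-> same_point e t e' t'.
Proof.
move=> pinj cend cinj cp tb tb'.
have endE e1 (b : bool) : c e1 b%:R = p (vtx (e1, b)).
  by have [c0 c1] := cend e1; case: b.
split.
  move=> eqs; have [[ti _]|[b [tE vE]]] := end_vertexP e tb;
    have [[ti' _]|[b' [tE' vE']]] := end_vertexP e' tb'.
  - by left; exact: cinj eqs.
  - by exfalso; move: eqs; rewrite tE' endE; exact: cp.
  - by exfalso; move: eqs; rewrite tE endE => /esym; exact: cp.
  - right; rewrite vE vE'; split=> //; congr Some; apply: pinj.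
    by rewrite -!endE -tE -tE'.
move=> [[-> ->]//|[evE evn]].
have [[_ n]|[b [tE vE]]] := end_vertexP e tb; first by rewrite n in evn.
have [[_ n]|[b' [tE' vE']]] := end_vertexP e' tb'; first by rewrite evE n in evn.
by rewrite tE tE' !endE; congr p; move: evE; rewrite vE vE' => -[].
Qed.

Lemma strips_boundary_realization m (T : set 'rV[R]_m) :
  realization G T -> PL_homeomorphic (fake_boundary strips) T.
Proof.
move=> [p [c [pinj cends cinj cp ->]]].
have cPL e : piecewise_linear unit_segment (fun x : 'rV[R]_1 => c e (x 0 0)).
  by have [] := cends e.
have cend e : c e 0 = p (ends e).1 /\ c e 1 = p (ends e).2 by have [] := cends e.
pose psi1 (e : edge G) (x : 'rV[R]_1) := strip (e, false) None (x 0 0) 1.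
pose psi2 (e : edge G) (x : 'rV[R]_1) := c e (x 0 0).
(* Both paths have to be affine on the same pieces, so a list adapted to the given edge path is
   refined for the whisker end. *)
have /choice[s sP] e : exists s : seq 'M[R]_(2, 1), [/\ polytopes s = unit_segment,
    forall P, P \in s -> affine_map (polytope P) (psi1 e) &
    forall P, P \in s -> affine_map (polytope P) (psi2 e)].
  have [s [sE sA]] := unit_segment_cover (cPL e).
  have [|s' r' a'] := @piecewise_affine_map_refines _ _ _ (psi1 e) _ s.
    by move=> j; apply: strip_piecewise_affine; [exact: affine_fun_coord|exact: affine_fun_cst].
  exists s'; split=> //; first by rewrite (refines_polytopes r').
  by move=> Q /(r'.1)[P Ps QP]; exact: affine_mapS QP (sA P Ps).
have sE e : polytopes (s e) = unit_segment by have [] := sP e.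
have inS e t : 0 <= t <= 1 -> polytopes (s e) (const_mx t).
  by move=> tb; rewrite sE /unit_segment/= mxE.
apply: (@PL_homeomorphic_of_parametrizations _ _ _ _ _ _ s psi1 psi2).
- by move=> e P Ps; have [_ h _] := sP e; exact: h.
- by move=> e P Ps; have [_ _ h] := sP e; exact: h.
- move=> e e' x x'; rewrite !sE => xb x'b.
  by rewrite (whisker_end_eq _ _ xb x'b) (realization_eq _ _ pinj cend cinj cp xb x'b).
- move=> y; split.
    move=> /strips_fake_boundary[[e b] [t [/andP[t0 t1] ->]]].
    exists e, (const_mx (if b then 1 - t else t)); split.
      by apply: inS; case: b; apply/andP; split; lra.
    rewrite /psi1 mxE; case: b => //.
    by rewrite -[(e, true)]/(flip (e, false)) -{1}[t](subKr 1) strip_flip.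
  move=> [e [x [+ ->]]]; rewrite sE => xb; apply/strips_fake_boundary.
  by exists (e, false), (x 0 0).
- move=> y; split.
    have onto e t : 0 <= t <= 1 ->
        exists e' (x : 'rV[R]_1), polytopes (s e') x /\ c e t = psi2 e' x.
      by move=> tb; exists e, (const_mx t); rewrite /psi2 mxE; split=> //; exact: inS.
    (* By trivalence a vertex has half-edges, so its point is an end of some edge path. *)
    move=> [[v _ <-]|[e [t [tb ->]]]]; last exact: onto.
    have [hh [_ hv _ _]] := half_edges_at_vertex v tG.
    have -> : p v = c (hh 0).1 (hh 0).2%:R.
      rewrite -(hv 0) /half_edge_vertex; have [c0 c1] := cend (hh 0).1.
      by case: (hh 0).2.
    by apply: onto; rewrite ler0n lern1 leq_b1.
  move=> [e [x [+ ->]]]; rewrite sE => xb; right.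
  by exists e, (x 0 0).
Qed.

End StripSurface.

Theorem proposition12 (R : realType) (m : nat) (T : set 'rV[R]_m) :
  finite_trivalent_graph T ->
  exists (n : nat) (F : set 'rV[R]_n),
    fake_surface_with_boundary F /\ PL_homeomorphic (fake_boundary F) T.
Proof.
move=> [G [tG GT]].
have [e0|noE] := pickP (@predT (edge G)).
  exists _, (@strips R _ _ (@half_edge_vertex G) (@next_half_edge G)).
  by split; [exact: strips_fake_surface|exact: strips_boundary_realization].
have [n [F [Fs Fb]]] := @empty_fake_boundary R.
exists n, F; split=> //.
have T0 : T = set0.
  have [p [c [_ _ _ _ ->]]] := GT.
  rewrite -subset0 => y [[v _ _]|[e _]]; last by have := noE e.
  by have [hh _] := half_edges_at_vertex v tG; have := noE (hh 0).1.
rewrite Fb T0; exists (fun=> 0); split=> //; split=> //.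
by exists (fun=> 0); split=> // y; rewrite in_set0.
Qed.
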